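(* Let $\gamma$ be a smooth starlike Jordan curve with respect to the origin such that every tangent line of $\gamma$ is disjoint from the origin. Assume that $G(e^{it})=g(t)=\rho(t)e^{i\psi(t)}:\mathbf T\to\gamma$ is a homeomorphism. Let $w:\mathbf C\to\mathbf C$, $w(z)=|z|\,G(z/|z|)$. Then the following conditions are equivalent: (a) $G$ is bi-Lipschitz; (b) $\psi$ is bi-Lipschitz; (c) $w$ is bi-Lipschitz; (d) $w$ is quasiconformal. Moreover, if $\psi$ is $L$ bi-Lipschitz, then: (e) $w$ is $(\ell,\mathcal L)$ bi-Lipschitz continuous, where $$\mathcal L=\frac{|\rho|_\infty}{2\sin\alpha_\gamma}\left(\sqrt{L^2+\sin^2\alpha_\gamma(1-2L)}+\sqrt{L^2+\sin^2\alpha_\gamma(1+2L)}\right),\qquad \ell=\frac{4\,\mathrm{dist}^2(\gamma,0)}{L\,\mathcal L};$$ and (f) $w$ is $k$-quasiconformal, where $$k=\sqrt{\frac{L^2+\sin^2\alpha_\gamma(1-2L)}{L^2+\sin^2\alpha_\gamma(1+2L)}}.$$ On the other hand, if $w$ is $k$-quasiconformal, then: (g) $\psi$ is $\left(\frac{1-k}{1+k},\frac{1+k}{1-k}\right)$ bi-Lipschitz; and (h) $\sin\alpha_\gamma\ge\dfrac{1-k^2}{1+k^2}$.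
   Context: $\mathbf T$ is the unit circle in the complex plane $\mathbf C$. A Jordan curve $\gamma$ bounding the Jordan domain $\Omega$ is starlike with respect to the origin if $\overline\Omega=\bigcup_{z\in\gamma}[0,z]$. In the representation $g(t)=\rho(t)e^{i\psi(t)}$, $\rho(t)=|g(t)|$ and $\psi$ is a continuous real function giving the argument of $g$; the value of $w$ at the origin is $w(0)=0$. Let $s\mapsto r(s)e^{is}$ be the polar parametrization of $\gamma$ ($r>0$). The angle $\alpha_s$ between $\zeta=r(s)e^{is}$ and the positively oriented tangent of $\gamma$ at $\zeta$ is given by $\cos\alpha_s=r'(s)/\sqrt{r^2(s)+r'(s)^2}$, $\sin\alpha_s=r(s)/\sqrt{r^2(s)+r'(s)^2}$, so $\cot\alpha_s=r'(s)/r(s)$. Put $\alpha_1=\min_s\alpha_s$ and $\alpha_2=\max_s\alpha_s$ (so $0<\alpha_1\le\alpha_2<\pi$), and $\alpha_\gamma=\min\{\alpha_1,\pi-\alpha_2\}$. A mapping $h$ between metric spaces is $(\ell,\mathcal L)$ bi-Lipschitz, for constants $0<\ell\le\mathcal L$, if $\ell\,d(x,y)\le d(h(x),h(y))\le\mathcal L\,d(x,y)$ for all $x,y$; it is $L$ bi-Lipschitz if this holds with $\ell=1/L$ and $\mathcal L=L$; it is bi-Lipschitz if this holds for some constants. $\mathbf T$, $\gamma$ and $\mathbf C$ carry the Euclidean distance, and $\psi$ is regarded as a real function of the real variable $t$. $|\rho|_\infty$ is the $L^\infty$ norm of $\rho$, and $\mathrm{dist}(\gamma,0)=\min_{z\in\gamma}|z|$.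 An orientation preserving homeomorphism $w:D\to\mathbf C$ of a domain $D\subset\mathbf C$, of Sobolev class $W^{1,1}_{\mathrm{loc}}(D;\mathbf C)$, is $K$-quasiconformal, $1\le K<\infty$, if $\frac{|w_z|+|w_{\bar z}|}{|w_z|-|w_{\bar z}|}\le K$ a.e. on $D$; equivalently $|w_{\bar z}/w_z|\le k$ a.e. on $D$ with $k=\frac{K-1}{K+1}$, in which case $w$ is also called $k$-quasiconformal. It is quasiconformal if it is $K$-quasiconformal for some such $K$.
   Formalization: In (e) the lower constant is ℓ = dist²(γ,0)/(L𝓛) without the factor 4, which fails for γ = T, G = id, L = 1; and (c)⇒(d) and (f) assume that G is orientation preserving, since for G(z) = z̄ on T the map w is an isometry but not quasiconformal. *)

(* Defs.v *)
From HB Require Import structures.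
From mathcomp Require Import all_boot all_order all_algebra complex.
From mathcomp Require Import all_classical all_reals all_analysis.

Set Implicit Arguments.
Unset Strict Implicit.
Unset Printing Implicit Defensive.

Import Order.TTheory GRing.Theory Num.Theory.
Import numFieldNormedType.Exports.

Local Open Scope classical_set_scope.
Local Open Scope complex_scope.
Local Open Scope ring_scope.

(* The library gives a topology to [K^o] for any [K : numFieldType]; this
   transports it to [R[i]], where it is the usual topology of the plane. *)
HB.instance Definition _ (R : realType) :=
  PseudoPointedMetric.copy R[i] (R[i])^o.

Section Plane.
Context {R : realType}.
Implicit Types (z : R[i]) (p : R * R).

(* [`|z|] lives in [R[i]]; [modulus z] is the same number as an element of
   [R]. *)
Definition modulus z : R := Normc.normc z.

Definition expi (t : R) : R[i] := cos t +i* sin t.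

Definition unit_circle : set R[i] := [set z | modulus z = 1].

Definition distC (x y : R[i]) : R := modulus (x - y).
Definition distR (x y : R) : R := `|x - y|.

Definition toC p : R[i] := p.1 +i* p.2.

Definition plane_measure := (@lebesgue_measure R \x @lebesgue_measure R)%E.

End Plane.

Section BiLipschitz.
Context {R : realType} {X Y : Type}.
Variables (dX : X -> X -> R) (dY : Y -> Y -> R) (A : set X).

Definition bilipschitz_with (l L : R) (h : X -> Y) : Prop :=
  0 < l <= L /\
  forall x y, A x -> A y ->
    l * dX x y <= dY (h x) (h y) /\ dY (h x) (h y) <= L * dX x y.

Definition bilipschitz_const (L : R) (h : X -> Y) : Prop :=
  bilipschitz_with L^-1 L h.

Definition bilipschitz (h : X -> Y) : Prop :=
  exists l L : R, bilipschitz_with l L h.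

End BiLipschitz.

Definition homeomorphism_between {X Y : topologicalType}
    (A : set X) (B : set Y) (f : X -> Y) : Prop :=
  [/\ set_bij A B f,
      {within A, continuous f} &
      exists g : Y -> X,
        {within B, continuous g} /\ forall x, A x -> g (f x) = x].

Section Curves.
Context {R : realType}.
Implicit Types (gamma l Omega : set R[i]) (c : R -> R[i]) (r : R -> R).

Definition velocity c (t : R) : R[i] :=
  derive1 (fun u => complex.Re (c u)) t +i* derive1 (fun u => complex.Im (c u)) t.

Definition C1_curve c : Prop :=
  [/\ forall t, derivable (fun u => complex.Re (c u)) t 1,
      forall t, derivable (fun u => complex.Im (c u)) t 1 &
      continuous (velocity c)].

Definition smooth_jordan_parametrization gamma c : Prop :=
  [/\ forall t, c (t + 2 * pi) = c t,
      {in `[0, 2 * pi[ &, injective c},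
      C1_curve c,
      forall t, velocity c t != 0 &
      gamma = range c].

Definition smooth_jordan_curve gamma : Prop :=
  exists c, smooth_jordan_parametrization gamma c.

Definition tangent_line gamma l : Prop :=
  exists c t, smooth_jordan_parametrization gamma c /\
    l = range (fun s : R => c t + s%:C * velocity c t).

(* For a Jordan curve [gamma], the bounded component of its complement is the
   only set [Omega] with these properties. *)
Definition jordan_domain gamma Omega : Prop :=
  [/\ open Omega, connected Omega, Omega !=set0,
      exists M : R, forall z, Omega z -> modulus z <= M &
      closure Omega `\` Omega = gamma].

Definition segment0 (z : R[i]) : set R[i] :=
  [set s%:C * z | s in `[0, 1 : R]].

Definition starlike_wrt_origin gamma : Prop :=
  exists2 Omega, jordan_domain gamma Omega &
    closure Omega = \bigcup_(z in gamma) segment0 z.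

Definition polar_parametrization gamma r : Prop :=
  [/\ forall s, 0 < r s,
      forall s, r (s + 2 * pi) = r s &
      gamma = range (fun s => (r s)%:C * expi s)].

(* [acos] takes its values in [0, pi], so the sine of this angle is
   [r s / sqrt (r s ^ 2 + r' s ^ 2)]. *)
Definition tangent_angle r (s : R) : R :=
  acos (derive1 r s / Num.sqrt (r s ^+ 2 + derive1 r s ^+ 2)).

(* The infimum and supremum are attained when [r] is C^1 and periodic. *)
Definition alpha_of r : R :=
  Num.min (inf (range (tangent_angle r)))
          (pi - sup (range (tangent_angle r))).

Definition dist_to_origin gamma : R := inf [set modulus z | z in gamma].

(* [c] winds exactly once, counterclockwise, around [a] on [0, 2 pi]. *)
Definition winds_once c (a : R[i]) : Prop :=
  exists2 theta : R -> R, continuous theta &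
    (forall t, c t - a = (modulus (c t - a))%:C * expi (theta t)) /\
    theta (2 * pi) = theta 0 + 2 * pi.

End Curves.

Section Sobolev.
Context {R : realType}.
Implicit Types (D : set (R * R)) (u v phi : R * R -> R).

Definition ex : R * R := (1, 0).
Definition ey : R * R := (0, 1).

Fixpoint class_C (n : nat) phi : Prop :=
  continuous phi /\
  (if n is m.+1 then
     [/\ forall p, derivable phi p ex, forall p, derivable phi p ey,
         class_C m ('D_ex phi) & class_C m ('D_ey phi)]
   else True).

Definition test_function D phi : Prop :=
  [/\ forall n, class_C n phi,
      compact (closure [set p | phi p != 0]) &
      closure [set p | phi p != 0] `<=` D].

Definition L1loc D u : Prop :=
  measurable_fun D u /\
  forall K, K `<=` D -> compact K -> plane_measure.-integrable K (EFin \o u).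

Definition weak_derivative D (e : R * R) u v : Prop :=
  [/\ L1loc D u, L1loc D v &
      forall phi, test_function D phi ->
        (\int[plane_measure]_(p in D) (u p * 'D_e phi p))%R =
        - (\int[plane_measure]_(p in D) (v p * phi p))%R].

End Sobolev.

Section Quasiconformal.
Context {R : realType}.
Implicit Types (D : set R[i]) (w f g : R[i] -> R[i]).

Definition weak_partial D (e : R * R) f g : Prop :=
  weak_derivative (toC @^-1` D) e
    (fun p => complex.Re (f (toC p))) (fun p => complex.Re (g (toC p))) /\
  weak_derivative (toC @^-1` D) e
    (fun p => complex.Im (f (toC p))) (fun p => complex.Im (g (toC p))).

(* [w] is in W^{1,1}_loc(D; C), with weak partial derivatives [wx], [wy]. *)
Definition W11loc_with D w wx wy : Prop :=
  weak_partial D ex w wx /\ weak_partial D ey w wy.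

Definition ae_on D (P : R[i] -> Prop) : Prop :=
  {ae @plane_measure R, forall p, D (toC p) -> P (toC p)}.

Definition domain D : Prop := [/\ open D, connected D & D !=set0].

Definition orientation_preserving_on D w : Prop :=
  forall (z : R[i]) (rad : R), 0 < rad ->
    (forall y, modulus (y - z) <= rad -> D y) ->
    winds_once (fun t => w (z + rad%:C * expi t)) (w z).

Definition orientation_preserving_homeomorphism D w : Prop :=
  [/\ domain D, homeomorphism_between D (w @` D) w &
      orientation_preserving_on D w].

Definition dz (wx wy : R[i] -> R[i]) (z : R[i]) : R[i] :=
  (wx z - 'i%C * wy z) / 2.
Definition dzbar (wx wy : R[i] -> R[i]) (z : R[i]) : R[i] :=
  (wx z + 'i%C * wy z) / 2.

(* The strict inequality makes the denominator of the quotient positive. *)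
Definition K_quasiconformal D (K : R) w : Prop :=
  [/\ 1 <= K, orientation_preserving_homeomorphism D w &
      exists wx wy, W11loc_with D w wx wy /\
        ae_on D (fun z =>
          let a := modulus (dz wx wy z) in
          let b := modulus (dzbar wx wy z) in
          b < a /\ (a + b) / (a - b) <= K)].

Definition k_quasiconformal D (k : R) w : Prop :=
  [/\ 0 <= k < 1, orientation_preserving_homeomorphism D w &
      exists wx wy, W11loc_with D w wx wy /\
        ae_on D (fun z =>
          dz wx wy z != 0 /\ modulus (dzbar wx wy z / dz wx wy z) <= k)].

Definition quasiconformal D w : Prop := exists K : R, K_quasiconformal D K w.

End Quasiconformal.

Section Radial.
Context {R : realType}.
Implicit Types (G : R[i] -> R[i]).

(* Only the values of [G] on the unit circle matter, and the value at the
   origin is 0 since [`|0| = 0]. *)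
Definition radial_extension G (z : R[i]) : R[i] := `|z| * G (z / `|z|).

Definition rho_of G (t : R) : R := modulus (G (expi t)).

Definition Linfty_norm (f : R -> R) : R :=
  fine ('N[@lebesgue_measure R]_+oo[EFin \o f])%E.

(* [G] maps the circle onto a curve around the origin. *)
Definition orientation_preserving_circle_map G : Prop :=
  winds_once (fun t => G (expi t)) 0.

(* The upper constant for the radial extension, with
   [M] = |rho|_oo and [s] = sin alpha_gamma. *)
Definition upper_const (M s L : R) : R :=
  M / (2 * s) *
  (Num.sqrt (L ^+ 2 + s ^+ 2 * (1 - 2 * L)) +
   Num.sqrt (L ^+ 2 + s ^+ 2 * (1 + 2 * L))).

(* The minimal stretching |w_z| - |w_zbar| is the Jacobian divided by the
   maximal stretching. Here the Jacobian is rho^2 psi', which is at least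
   [d] ^ 2 / L for [d] = dist(gamma, 0), hence the value below. A factor 4 in
   the numerator cannot hold: for the unit circle and [G] the identity, [w] is
   the identity, [M = s = L = d = 1] and [upper_const M s L = 1]. *)
Definition lower_const (d M s L : R) : R := d ^+ 2 / (L * upper_const M s L).

Definition qc_const (s L : R) : R :=
  Num.sqrt ((L ^+ 2 + s ^+ 2 * (1 - 2 * L)) /
            (L ^+ 2 + s ^+ 2 * (1 + 2 * L))).

End Radial.

(* Main.v *)
Require Import Defs.
From HB Require Import structures.
From mathcomp Require Import all_boot all_order all_algebra complex.
From mathcomp Require Import all_classical all_reals all_analysis.
From mathcomp Require Import ring lra zify.
From mathcomp Require Import measurable_realfun.
Set Implicit Arguments.
Unset Strict Implicit.
Unset Printing Implicit Defensive.
Import Order.TTheory GRing.Theory Num.Theory.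
Import numFieldNormedType.Exports.
Local Open Scope classical_set_scope.
Local Open Scope complex_scope.
Local Open Scope ring_scope.

(** In polar form the radial extension is [w (lam e^(it)) = lam P (psi t)], where
    [P s = r s e^(is)] runs along the curve. The tangent lines avoid the origin,
    so the angle [s] is a legitimate C^1 parameter, and [P' = P (kappa + i)]
    with [kappa = r' / r = cot alpha_s] continuous and periodic
    ([polar_curve_kappa], [kappa_continuous]). Moreover [sin alpha_gamma] is the
    largest [c >= 0] with [c ^ 2 (1 + kappa ^ 2) <= 1] everywhere
    ([sin_alpha_le], [sin_alpha_ge]): this is the only way in which the angle
    enters the estimates.

    Bi-Lipschitz maps. In the orthonormal frames given by the radial and the
    angular direction, the differential of [w] is [r] times the matrix
    [[1, q kappa], [0, q]], where [q] is the speed of [psi]. Its singular values,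
    for [1 / L <= q <= L], are controlled by the constants of the theorem
    ([distortion_bounds]). The phase need not be differentiable, but the same
    computation applies to difference quotients; it yields pointwise Lipschitz
    bounds for [w] and for its inverse, which are integrated along segments
    ([radial_bilipschitz]). This is the explicit bi-Lipschitz bound. Conversely
    [G] is the restriction of [w] to the circle, and if [G] is bi-Lipschitz then
    so is [psi], because chords of the circle and of the curve are comparable to
    increments of [t] and of [psi] ([bilipschitz_phase]).

    From bi-Lipschitz to quasiconformal. A Lipschitz map has weak partial
    derivatives that are almost everywhere the classical ones
    ([lipschitz_W11loc]). Where the classical ones exist, [psi] has a derivative
    [q] and
    [ |w_zbar / w_z| ^ 2 = ((1 - q) ^ 2 + (q kappa) ^ 2) /
                           ((1 + q) ^ 2 + (q kappa) ^ 2) ]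
    ([radial_dilatation]), which for [1 / L <= q <= L] is at most the square of
    the constant of the theorem ([qc_const_dilatation]). The speed is positive
    because [G] preserves the orientation; the same fact and a homotopy argument
    show that [w] preserves the orientation at every point
    ([bilipschitz_orientation]).

    From quasiconformal to bi-Lipschitz. A continuous function with a weak
    partial derivative satisfies the fundamental theorem of calculus on almost
    every line in that direction ([weak_on_lines]), hence has the weak derivative
    as classical partial derivative almost everywhere ([weak_ae_derivable]). So
    on almost every vertical line the dilatation bound, inserted in the formula
    above, gives [(1 - k) / (1 + k) <= q <= (1 + k) / (1 - k)] at almost every
    point. Then [w_y] is bounded there, so [w] and therefore [psi] are Lipschitz
    along the line, and the bounds on [q] integrate to bounds on the increments
    of [psi]. One line on each side of the origin sees a full half circle of
    arguments, which gives the bi-Lipschitz constants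
    ([quasiconformal_half_circle], [quasiconformal_phase]). The same dilatation
    bound, with [q] eliminated, reads
    [((1 - k ^ 2) / (1 + k ^ 2)) ^ 2 (1 + kappa ^ 2) <= 1]; it holds on a dense
    set, hence everywhere by continuity, and bounds [sin alpha_gamma]. *)

(** * The complex plane and polar coordinates *)

Section Plane_basics.
Context {R : realType}.
Implicit Types (z u v : R[i]) (t s : R).

Lemma complex_ext z u :
  complex.Re z = complex.Re u -> complex.Im z = complex.Im u -> z = u.
Proof. by case: z u => a b [c d] /= -> ->. Qed.

Lemma ReD z u : complex.Re (z + u) = complex.Re z + complex.Re u.
Proof. by case: z u => a b [c d]. Qed.
Lemma ImD z u : complex.Im (z + u) = complex.Im z + complex.Im u.
Proof. by case: z u => a b [c d]. Qed.
Lemma ReN z : complex.Re (- z) = - complex.Re z.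
Proof. by case: z. Qed.
Lemma ImN z : complex.Im (- z) = - complex.Im z.
Proof. by case: z. Qed.
Lemma ReM z u : complex.Re (z * u) =
  complex.Re z * complex.Re u - complex.Im z * complex.Im u.
Proof. by case: z u => a b [c d]. Qed.
Lemma ImM z u : complex.Im (z * u) =
  complex.Re z * complex.Im u + complex.Im z * complex.Re u.
Proof. by case: z u => a b [c d]. Qed.
Definition ReImE := (ReD, ImD, ReN, ImN, ReM, ImM).

Lemma modulus_sqr z : modulus z ^+ 2 = complex.Re z ^+ 2 + complex.Im z ^+ 2.
Proof.
by case: z => a b; rewrite /modulus /= sqr_sqrtr// addr_ge0// sqr_ge0.
Qed.

Lemma modulus_ge0 z : 0 <= modulus z.
Proof. by case: z => a b; exact: sqrtr_ge0. Qed.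

Lemma modulusM z u : modulus (z * u) = modulus z * modulus u.
Proof. exact: Normc.normcM. Qed.

Lemma modulusV z : modulus z^-1 = (modulus z)^-1.
Proof. exact: Normc.normcV. Qed.

Lemma modulusD z u : modulus (z + u) <= modulus z + modulus u.
Proof. exact: le_normcD. Qed.

Lemma modulusN z : modulus (- z) = modulus z.
Proof. exact: normcN. Qed.

Lemma modulusB z u : modulus (z - u) = modulus (u - z).
Proof. by rewrite -modulusN opprB. Qed.

Lemma modulus0 : modulus (0 : R[i]) = 0.
Proof. exact: Normc.normc0. Qed.

Lemma modulus0_eq0 z : modulus z = 0 -> z = 0.
Proof. exact: Normc.eq0_normc. Qed.

Lemma modulus_gt0 z : (0 < modulus z) = (z != 0).
Proof.
rewrite lt_def modulus_ge0 andbT; apply/idP/idP.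
  by apply: contraNN => /eqP ->; rewrite modulus0.
by apply: contraNN => /eqP /modulus0_eq0 ->.
Qed.

Lemma modulus_real (x : R) : modulus x%:C = `|x|.
Proof. by rewrite /modulus /= expr0n /= addr0 sqrtr_sqr. Qed.

Lemma modulus_triB z u : modulus z - modulus u <= modulus (z - u).
Proof.
by rewrite lerBlDr; apply: le_trans (modulusD _ _); rewrite subrK.
Qed.

Lemma modulus_dist z u : `|modulus z - modulus u| <= modulus (z - u).
Proof.
rewrite ler_norml modulus_triB andbT lerNl opprB modulusB.
exact: modulus_triB.
Qed.

Lemma normc_modulus z : `|z| = (modulus z)%:C.
Proof. by case: z. Qed.

Lemma le_modulus z (x : R) : 0 <= x ->
  (modulus z <= x) = (complex.Re z ^+ 2 + complex.Im z ^+ 2 <= x ^+ 2).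
Proof.
by move=> x0; rewrite -modulus_sqr ler_sqr ?nnegrE// modulus_ge0.
Qed.

Lemma ge_modulus z (x : R) : 0 <= x ->
  (x <= modulus z) = (x ^+ 2 <= complex.Re z ^+ 2 + complex.Im z ^+ 2).
Proof.
by move=> x0; rewrite -modulus_sqr ler_sqr ?nnegrE// modulus_ge0.
Qed.

Lemma Re_le_modulus z : `|complex.Re z| <= modulus z.
Proof.
by rewrite ge_modulus// real_normK ?num_real // lerDl sqr_ge0.
Qed.

Lemma Im_le_modulus z : `|complex.Im z| <= modulus z.
Proof.
by rewrite ge_modulus// real_normK ?num_real // lerDr sqr_ge0.
Qed.

Lemma modulus_le_sum z : modulus z <= `|complex.Re z| + `|complex.Im z|.
Proof.
rewrite le_modulus ?addr_ge0// sqrrD !real_normK ?num_real // -addrA lerD2l lerDr.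
by rewrite mulrn_wge0// mulr_ge0.
Qed.

Lemma modulus_expi t : modulus (expi t) = 1.
Proof. by rewrite /modulus /= cos2Dsin2 sqrtr1. Qed.

Lemma modulus_polar (x : R) t : 0 <= x -> modulus (x%:C * expi t) = x.
Proof. by move=> x0; rewrite modulusM modulus_expi mulr1 modulus_real ger0_norm. Qed.

Lemma expi_neq0 t : expi t != 0.
Proof. by rewrite -modulus_gt0 modulus_expi. Qed.

Lemma expi0 : expi (0 : R) = 1.
Proof. by rewrite /expi cos0 sin0. Qed.

Lemma expiD t s : expi (t + s) = expi t * expi s.
Proof.
by apply: complex_ext; rewrite ReImE /= ?cosD ?sinD; ring.
Qed.

Lemma expiNK t : expi t * expi (- t) = 1.
Proof. by rewrite -expiD subrr expi0. Qed.

Lemma expi_period t : expi (t + 2 * pi) = expi t.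
Proof.
rewrite mulrDl mul1r -mulr2n; apply: complex_ext => /=.
  exact: cosD2pi.
exact: sinD2pi.
Qed.

Lemma expi_period_int t (n : int) : expi (t + n%:~R * (2 * pi)) = expi t.
Proof.
have H m s : expi (s + m%:R * (2 * pi)) = expi s.
  elim: m => [|m IH]; first by rewrite mul0r addr0.
  by rewrite -natr1 mulrDl mul1r addrA expi_period.
case: n => n; first exact: H.
by rewrite NegzE mulrNz mulNr -[RHS](H n.+1) -[RHS]/(expi _) -{2}(subrK (n.+1%:R * (2 * pi)) t) H.
Qed.

Lemma expi1_eq t : expi t = 1 -> exists n : int, t = n%:~R * (2 * pi).
Proof.
move=> t1; pose n := Num.floor (t / (2 * pi)).
have pi0 : 0 < 2 * pi :> R by rewrite mulr_gt0 ?pi_gt0.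
exists n; pose y := t - n%:~R * (2 * pi).
have y1 : expi y = 1.
  by rewrite /y -mulNr -mulrNz expi_period_int.
have y0 : 0 <= y.
  rewrite /y subr_ge0 -ler_pdivlMr//; exact: Num.Theory.floor_le_tmp.
have y2 : y < 2 * pi.
  rewrite /y ltrBlDr -[X in X + _]mul1r -mulrDl -ltr_pdivrMr// addrC.
  by rewrite -intrD1 Num.Theory.floorD1_gt.
(* [cos y = 1] means [sin (y / 2) = 0], while [0 <= y / 2 < pi] *)
suff : y = 0 by move/eqP; rewrite subr_eq0 => /eqP.
have c2 : cos y = 1 by have := congr1 (@complex.Re R) y1.
have : sin (y / 2) = 0.
  have : cos y = cos ((y / 2) *+ 2) by congr cos; rewrite mulr2n; lra.
  rewrite cos_mulr2n c2 cos2sin2 => h; apply/eqP; rewrite -sqrf_eq0.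
  by apply/eqP; move: h; rewrite mulr2n; lra.
apply: contraPP => /eqP yn0.
have : 0 < sin (y / 2).
  have : 0 < y by rewrite lt_def yn0 y0.
  by move=> ?; apply: sin_gt0_pi; lra.
by rewrite lt_def => /andP[/eqP + _].
Qed.

Lemma expi_eq t s : expi t = expi s -> exists n : int, t = s + n%:~R * (2 * pi).
Proof.
move=> ts; have [|n hn] := @expi1_eq (t - s).
  by rewrite expiD ts expiNK.
by exists n; rewrite -hn; lra.
Qed.

(** On the right half-plane the principal argument is [atan (y / x)]; every local
    choice of an argument below is obtained from it by a rotation. *)
Lemma polar_atan z : 0 < complex.Re z ->
  z = (modulus z)%:C * expi (atan (complex.Im z / complex.Re z)).
Proof.
case: z => a b; rewrite [complex.Re _]/= [complex.Im _]/= => a0.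
have h : 0 < 1 + (b / a) ^+ 2 by rewrite ltr_pwDl// sqr_ge0.
have hm : modulus (a +i* b) = a * Num.sqrt (1 + (b / a) ^+ 2).
  have hab : a ^+ 2 + b ^+ 2 = a ^+ 2 * (1 + (b / a) ^+ 2).
    by field; rewrite gt_eqF.
  by rewrite /modulus /= hab sqrtrM ?sqr_ge0// sqrtr_sqr gtr0_norm.
have hs : Num.sqrt (1 + (b / a) ^+ 2) != 0 by rewrite gt_eqF// sqrtr_gt0.
have hc : cos (atan (b / a)) = (Num.sqrt (1 + (b / a) ^+ 2))^-1 by exact: cos_atan.
have hsn : sin (atan (b / a)) = (b / a) * (Num.sqrt (1 + (b / a) ^+ 2))^-1.
  have := atanK (b / a); rewrite /tan hc => /(congr1 (fun x => x / Num.sqrt (1 + (b / a) ^+ 2))) <-.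
  by rewrite invrK mulfK.
rewrite hm; apply: complex_ext; rewrite ReImE /= ?hc ?hsn ?mul0r ?subr0 ?addr0.
  by rewrite mulfK.
by field; rewrite hs gt_eqF.
Qed.

Lemma polar z : exists t, z = (modulus z)%:C * expi t.
Proof.
have pos u : 0 < complex.Re u -> exists t, u = (modulus u)%:C * expi t.
  by move=> /polar_atan h; eexists; exact: h.
have [z0|z0|z0] := ltgtP 0 (complex.Re z).
- exact: pos.
- have [|t ht] := pos (- z); first by rewrite ReN oppr_gt0.
  exists (t + pi); have -> : expi (t + pi) = - expi t.
    by rewrite expiD; apply: complex_ext; rewrite !ReImE /= cospi sinpi; ring.
  by rewrite mulrN -(modulusN z) -ht opprK.
- have -> : z = 'i%C * (complex.Im z)%:C.
    by apply: complex_ext; rewrite !ReImE /= -?z0; ring.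
  rewrite modulusM modulus_real [modulus _](_ : _ = 1) ?mul1r; last first.
    by rewrite /modulus /= expr0n /= expr1n add0r sqrtr1.
  have [i0|i0] := leP 0 (complex.Im z).
    exists (pi / 2); rewrite ger0_norm//.
    by apply: complex_ext; rewrite !ReImE /= cos_pihalf sin_pihalf; ring.
  exists (- (pi / 2)); rewrite ltr0_norm//.
  by apply: complex_ext; rewrite !ReImE /= cosN sinN cos_pihalf sin_pihalf; ring.
Qed.

End Plane_basics.

(** * One-sided derivative bounds *)

Section Epsilon_delta.
Context {R : realType}.
Implicit Types (f g : R -> R) (x t : R).

Lemma continuous_epsP f x : {for x, continuous f} <->
  forall e : R, 0 < e -> exists2 d : R, 0 < d &
    forall y, `|y - x| < d -> `|f y - f x| < e.
Proof.
split => [/cvgrPdist_lt h e e0|h].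
  have [d /= d0 hd] := h e e0; exists d => // y yx.
  by rewrite distrC; apply: hd; rewrite /ball_ /= distrC.
apply/cvgrPdist_lt => e e0; have [d d0 hd] := h e e0.
exists d => // y /= yx; rewrite distrC; apply: hd.
by rewrite distrC.
Qed.

Lemma is_derive_epsP f x (l : R) : is_derive x 1 f l <->
  forall e : R, 0 < e -> exists2 d : R, 0 < d &
    forall h, `|h| < d -> `|f (x + h) - f x - l * h| <= e * `|h|.
Proof.
pose Q (h : R) : R := h^-1 *: ((f \o shift x) (h *: (1 : R)) - f x).
have key (m h : R) : h != 0 ->
    `|f (x + h) - f x - m * h| = `|m - Q h| * `|h|.
  move=> h0; rewrite -normrM distrC /Q /= -[h *: (1 : R)]/(h * 1) mulr1 (addrC h).
  rewrite -[_ *: _]/(h^-1 * _); congr `|_|; field; exact: h0.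
split => [[dv <-] e e0|H].
  have /cvgrPdist_lt /(_ e e0) [d /= d0 hd] := dv.
  exists d => // h hl.
  have [->|h0] := eqVneq h 0.
    by rewrite normr0 !mulr0 subr0 addr0 subrr normr0.
  have := hd h; rewrite /ball_ /= sub0r normrN => /(_ hl h0) hh.
  by rewrite key// ler_wpM2r// ltW.
have hQ : Q h @[h --> 0^'] --> l.
  apply/cvgrPdist_le => e e0; have [d d0 hd] := H e e0.
  exists d => // h /= hl h0; rewrite -(@ler_pM2r _ `|h|) ?normr_gt0// -key//.
  by apply: hd; rewrite -(normrN h) -sub0r.
apply: DeriveDef; first by apply/cvg_ex; exists l.
exact: (cvg_lim _ hQ).
Qed.

Lemma is_derive_continuous f x (l : R) :
  is_derive x 1 f l -> {for x, continuous f}.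
Proof.
by move=> [dv _]; apply: differentiable_continuous; apply/derivable1_diffP.
Qed.

(** The right-hand Dini derivative controls increments: the set of points up to
    which the bound with slope [C + e] holds is closed, and cannot stop before
    [b]. *)
Lemma dini_increment f (C a b : R) : a <= b -> continuous f ->
  (forall t, a <= t < b -> forall e : R, 0 < e -> exists2 d : R, 0 < d &
    forall h, 0 < h < d -> f (t + h) - f t <= (C + e) * h) ->
  f b - f a <= C * (b - a).
Proof.
move=> ab cf H.
suff K e : 0 < e -> f b - f a <= (C + e) * (b - a).
  apply/ler_addgt0Pr => e e0; have ba : 0 <= b - a by rewrite subr_ge0.
  pose e' := e / (b - a + 1).
  have e'0 : 0 < e' by rewrite divr_gt0// ltr_wpDl.
  have := K e' e'0; rewrite mulrDl => /le_trans; apply; rewrite lerD2l.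
  rewrite /e' mulrAC ler_pdivrMr ?ltr_wpDl//.
  by rewrite ler_wpM2l ?(ltW e0)// lerDl.
move=> e0; pose S := [set t | a <= t <= b /\
  forall u, a <= u <= t -> f u - f a <= (C + e) * (u - a)].
have Sa : S a.
  split; first by rewrite lexx.
  move=> u; rewrite -eq_le => /eqP ->; by rewrite !subrr mulr0.
have supS : has_sup S by split; [exists a | exists b => t [/andP[]]].
pose c := sup S.
have ac : a <= c by apply: ub_le_sup => //; case: supS.
have cb : c <= b by apply: ge_sup; [exists a|move=> t [/andP[]]].
have below u : a <= u -> u < c -> f u - f a <= (C + e) * (u - a).
  move=> au uc; have [|t [_ ht] ut] := @sup_adherent _ S (c - u) _ supS.
    by rewrite subr_gt0.
  by apply: ht; rewrite au ltW//; move: ut; rewrite -/c opprB addrC subrK.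
have atc : f c - f a <= (C + e) * (c - a).
  rewrite leNgt; apply/negP => lt.
  pose g u := f u - f a - (C + e) * (u - a).
  have gc : 0 < g c by rewrite /g subr_gt0.
  have cg : {for c, continuous g}.
    rewrite /g; apply: cvgB; first by apply: cvgB; [exact: cf|exact: cvg_cst].
    by apply: cvgM; [exact: cvg_cst|apply: cvgB; [exact: cvg_id|exact: cvg_cst]].
  have [d d0 hd] := (continuous_epsP g c).1 cg _ gc.
  have [ac'|ac'] := eqVneq a c.
    by move: lt; rewrite -ac' !subrr mulr0 ltxx.
  have {}ac : a < c by rewrite lt_neqAle ac' ac.
  pose u := Num.max a (c - d / 2).
  have uc : u < c by rewrite gt_max ac/= ltrBlDr ltrDl divr_gt0.
  have au : a <= u by rewrite le_max lexx.
  have ucd : `|u - c| < d.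
    rewrite ltr0_norm ?subr_lt0// opprB ltrBlDr -ltrBlDl lt_max.
    by apply/orP; right; lra.
  have := hd u ucd; rewrite ltr_norml => /andP[+ _].
  have : g u <= 0 by rewrite /g subr_le0 below.
  by move=> *; lra.
have [cb'|cb'] := eqVneq c b; first by rewrite -cb'.
have {}cb : c < b by rewrite lt_neqAle cb' cb.
have [d d0 hd] := H c ltac:(by rewrite ac cb) e e0.
pose t := Num.min b (c + d / 2).
have ct : c < t by rewrite lt_min cb/= ltrDl divr_gt0.
suff : S t by move=> /(ub_le_sup (proj2 supS)); rewrite leNgt ct.
split; first by rewrite ge_min lexx andbT (le_trans ac) ?ltW.
move=> u /andP[au ut]; have [uc|] := ltP u c; first exact: below.
rewrite le_eqVlt => /predU1P[<-//|cu].
have -> : f u - f a = (f (c + (u - c)) - f c) + (f c - f a).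
  by rewrite (addrC c) subrK; lra.
have -> : (C + e) * (u - a) = (C + e) * (u - c) + (C + e) * (c - a) by ring.
apply: lerD => //; apply: hd; rewrite subr_gt0 cu/=.
have : u <= c + d / 2 by move: ut; rewrite le_min => /andP[].
by move: d0; lra.
Qed.

(** The Dini bound may fail at points that are isolated from the right: both
    applications of [dini_increment] together remove them, the first one next
    to an exceptional point, the second one everywhere. *)
Lemma dini_increment_except f (C a b : R) : a <= b -> continuous f ->
  (forall t, a <= t < b -> exists2 d : R, 0 < d & forall t', t < t' < t + d ->
    forall e : R, 0 < e -> exists2 d : R, 0 < d &
    forall h, 0 < h < d -> f (t' + h) - f t' <= (C + e) * h) ->
  f b - f a <= C * (b - a).
Proof.
move=> ab cf H; apply: dini_increment => // t tab e e0.
have [d d0 hd] := H t tab; exists d => // h /andP[h0 hlt].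
suff : f (t + h) - f t <= C * h.
  move=> /le_trans; apply; rewrite ler_wpM2r ?ltW//; lra.
apply/ler_addgt0Pr => e' e'0.
have [d1 d10 hd1] := (continuous_epsP f t).1 (cf t) _ (divr_gt0 e'0 (ltr0n _ 2)).
pose k := e' / (2 * (`|C| + 1)).
have C1 : 0 < `|C| + 1 by rewrite ltr_wpDl.
have k0 : 0 < k by rewrite divr_gt0 ?mulr_gt0.
pose u := Num.min h (Num.min k (d1 / 2)).
have u0 : 0 < u by rewrite !lt_min h0 k0 divr_gt0.
have uh : u <= h by rewrite ge_min lexx.
have ud1 : u < d1.
  have : u <= d1 / 2 by rewrite !ge_min lexx !orbT.
  by lra.
have uk : u <= k by rewrite !ge_min lexx !orbT.
have := @dini_increment f C (t + u) (t + h) ltac:(lra) cf.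
have -> : t + h - (t + u) = h - u by lra.
move=> /(_ _)/= D.
have {}D : f (t + h) - f (t + u) <= C * (h - u).
  apply: D => t' /andP[t1 t2]; apply: hd; apply/andP; split; lra.
have := hd1 (t + u); rewrite addrAC subrr add0r gtr0_norm// => /(_ ud1).
move=> /(le_lt_trans (ler_norm _)) D2.
have : - C * u <= e' / 2.
  have : - C * u <= `|C| * u.
    by rewrite ler_wpM2r ?(ltW u0)// -normrN ler_norm.
  move=> /le_trans; apply.
  have : `|C| * u <= (`|C| + 1) * k.
    by apply: ler_pM => //; [exact: ltW|rewrite lerDl].
  suff -> : (`|C| + 1) * k = e' / 2 by [].
  by rewrite /k; field; rewrite gt_eqF.
by rewrite mulrBr in D; move=> ?; lra.
Qed.

End Epsilon_delta.

(** * Curves and Lipschitz maps in the plane *)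

Section Complex_functions.
Context {R : realType}.
Implicit Types (F : R[i] -> R[i]) (g : R -> R[i]) (z : R[i]) (t : R).

Definition eps_continuous F := forall z (e : R), 0 < e -> exists2 d : R, 0 < d &
  forall z', modulus (z' - z) < d -> modulus (F z' - F z) < e.

Definition local_lipschitz_at F (C : R) z := forall e : R, 0 < e ->
  exists2 d : R, 0 < d & forall z', modulus (z' - z) < d ->
    modulus (F z' - F z) <= (C + e) * modulus (z' - z).

(** A pointwise Lipschitz bound integrates along segments. The origin may be left
    out because a segment that is not reduced to a point meets it at most once, and
    such isolated exceptions are harmless by [dini_increment_except]. *)
Lemma lipschitz_of_local F (C : R) : eps_continuous F ->
  (forall z, z != 0 -> local_lipschitz_at F C z) ->
  forall z0 z1, modulus (F z1 - F z0) <= C * modulus (z1 - z0).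
Proof.
move=> cF lF z0 z1.
have [->|z01] := eqVneq z1 z0; first by rewrite !subrr modulus0 mulr0.
set D := modulus (z1 - z0).
have D0 : 0 < D by rewrite modulus_gt0 subr_eq0.
pose p (t : R) := z0 + t%:C * (z1 - z0).
have pB (t s : R) : modulus (p t - p s) = `|t - s| * D.
  have -> : p t - p s = (t - s)%:C * (z1 - z0) by rewrite /p rmorphB /=; ring.
  by rewrite modulusM modulus_real.
have cp (t : R) (e : R) : 0 < e -> exists2 d : R, 0 < d & forall s : R,
    `|s - t| < d -> modulus (F (p s) - F (p t)) < e.
  move=> e0; have [d d0 hd] := cF (p t) e e0; exists (d / D); first exact: divr_gt0.
  by move=> s st; apply: hd; rewrite pB -ltr_pdivlMr.
pose f t := modulus (F (p t) - F z0).
have fB (t s : R) : `|f t - f s| <= modulus (F (p t) - F (p s)).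
  apply: le_trans (modulus_dist _ _) _.
  by rewrite [X in modulus X](_ : _ = F (p t) - F (p s))//; ring.
have cf : continuous f.
  move=> t; apply/continuous_epsP => e e0; have [d d0 hd] := cp t e e0.
  by exists d => // s st; apply: le_lt_trans (fB _ _) (hd _ st).
have p0 : p 0 = z0 by rewrite /p mul0r addr0.
have p1 : p 1 = z1 by rewrite /p mul1r addrC subrK.
have := @dini_increment_except R f (C * D) 0 1 ler01 cf.
rewrite subr0 mulr1 /f p0 p1 subrr modulus0 subr0; apply => t _.
have [d d0 hd] : exists2 d : R, 0 < d & forall t', t < t' < t + d -> p t' != 0.
  have [pt0|pt0] := eqVneq (p t) 0.
    exists 1 => // t' /andP[tt' _].
    by rewrite -modulus_gt0 -(subr0 (p t')) -pt0 pB mulr_gt0// normr_gt0 subr_eq0 gt_eqF.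
  exists (modulus (p t) / D); first by rewrite divr_gt0// modulus_gt0.
  move=> t' /andP[tt' t'd]; apply/eqP => pt'.
  have := pB t t'; rewrite pt' subr0 distrC gtr0_norm ?subr_gt0// => h.
  by move: t'd; rewrite h mulfK ?gt_eqF// addrC subrK ltxx.
exists d => // t' /hd pt' e e0.
have [d' d'0 hd'] := lF _ pt' _ (divr_gt0 e0 D0).
exists (d' / D); first exact: divr_gt0.
move=> h /andP[h0 hd1].
have hB : modulus (p (t' + h) - p t') = h * D.
  by rewrite pB addrAC subrr add0r gtr0_norm.
apply: le_trans (ler_norm _) _; apply: le_trans (fB _ _) _.
have := hd' (p (t' + h)); rewrite hB -ltr_pdivlMr// => /(_ hd1).
move=> /le_trans; apply.
suff -> : (C + e / D) * (h * D) = (C * D + e) * h by [].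
by field; rewrite gt_eqF.
Qed.

Definition is_cderive g t (l : R[i]) :=
  is_derive t 1 (fun u => complex.Re (g u)) (complex.Re l) /\
  is_derive t 1 (fun u => complex.Im (g u)) (complex.Im l).

Lemma is_cderive_eps g t l : is_cderive g t l ->
  forall e : R, 0 < e -> exists2 d : R, 0 < d &
    forall h : R, `|h| < d -> modulus (g (t + h) - g t - h%:C * l) <= e * `|h|.
Proof.
move=> [/is_derive_epsP h1 /is_derive_epsP h2] e e0.
have e20 : 0 < e / 2 by rewrite divr_gt0.
have [d1 d10 k1] := h1 _ e20; have [d2 d20 k2] := h2 _ e20.
exists (Num.min d1 d2); first by rewrite lt_min d10.
move=> h; rewrite lt_min => /andP[/k1 k3 /k2 k4].
apply: le_trans (modulus_le_sum _) _.
have -> : complex.Re (g (t + h) - g t - h%:C * l) =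
  complex.Re (g (t + h)) - complex.Re (g t) - complex.Re l * h.
  by rewrite !ReImE /=; ring.
have -> : complex.Im (g (t + h) - g t - h%:C * l) =
  complex.Im (g (t + h)) - complex.Im (g t) - complex.Im l * h.
  by rewrite !ReImE /=; ring.
by apply: le_trans (lerD k3 k4) _; rewrite -mulrDl -splitr.
Qed.

Lemma is_cderive_continuous g t l : is_cderive g t l ->
  forall e : R, 0 < e -> exists2 d : R, 0 < d &
    forall u : R, `|u - t| < d -> modulus (g u - g t) < e.
Proof.
move=> /is_cderive_eps H e e0; have [d d0 hd] := H 1 ltr01.
pose m := modulus l + 1.
have m0 : 0 < m by rewrite ltr_wpDl// modulus_ge0.
exists (Num.min d (e / (m + 1))).
  by rewrite lt_min d0 divr_gt0// addr_gt0.
move=> u; rewrite lt_min => /andP[ud ue].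
have := hd (u - t) ud; rewrite (addrC t) subrK mul1r => h.
have -> : g u - g t = (g u - g t - (u - t)%:C * l) + (u - t)%:C * l by ring.
apply: le_lt_trans (modulusD _ _) _; rewrite modulusM modulus_real.
apply: le_lt_trans (_ : _ <= `|u - t| * m) _.
  by rewrite /m mulrDr mulr1 addrC lerD2l.
have [->|ut] := eqVneq u t; first by rewrite subrr normr0 mul0r.
rewrite ltr_pdivlMr in ue; last by rewrite addr_gt0.
apply: le_lt_trans ue; rewrite ler_wpM2l//; lra.
Qed.

Lemma is_cderive_expi t : is_cderive expi t ('i%C * expi t).
Proof.
split => /=; first by apply: is_derive_eq; rewrite ?scaler1; ring.
by apply: is_derive_eq; rewrite ?scaler1; ring.
Qed.

(** Nearby points have nearby arguments: after division by the given point one is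
    close to 1, where the argument is a continuous arctangent. *)
Lemma polar_local (lam t : R) : 0 < lam -> forall e : R, 0 < e ->
  exists2 d : R, 0 < d & forall z', modulus (z' - lam%:C * expi t) < d ->
    exists t', `|t' - t| < e /\ z' = (modulus z')%:C * expi t'.
Proof.
move=> l0 e e0.
have [d d0 hd] := (continuous_epsP atan 0).1 (@continuous_atan R 0) e e0.
(* in the disc of radius [k] about 1 the real part exceeds [1 / 2], so that
   [|Im u / Re u| < 2 k < d] *)
pose k := Num.min (2^-1) (d / 4).
have k0 : 0 < k by rewrite lt_min invr_gt0 ltr0n divr_gt0.
have k2 : k <= 2^-1 by rewrite ge_min lexx.
have kd : k <= d / 4 by rewrite ge_min lexx orbT.
exists (lam * k); first exact: mulr_gt0.
move=> z' hz; pose u := z' / (lam%:C * expi t).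
have z0 : lam%:C * expi t != 0.
  by rewrite mulf_neq0 ?expi_neq0// -modulus_gt0 modulus_real gtr0_norm.
have u1 : modulus (u - 1) < k.
  have -> : u - 1 = (z' - lam%:C * expi t) / (lam%:C * expi t).
    by rewrite mulrBl divff.
  by rewrite modulusM modulusV modulus_polar ?ltW// ltr_pdivrMr// (mulrC k).
have hre : `|complex.Re u - 1| < k.
  by apply: le_lt_trans u1; have := Re_le_modulus (u - 1); rewrite !ReImE /=.
have him : `|complex.Im u| < k.
  by apply: le_lt_trans u1; have := Im_le_modulus (u - 1); rewrite !ReImE /= oppr0 addr0.
have re2 : 2^-1 < complex.Re u by move: hre; rewrite ltr_norml => /andP[+ _]; lra.
have re0 : 0 < complex.Re u by apply: lt_trans re2; rewrite invr_gt0.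
exists (t + atan (complex.Im u / complex.Re u)); split.
  rewrite addrAC subrr add0r -(subr0 (atan _)) -atan0; apply: hd.
  rewrite subr0 normrM normfV (gtr0_norm re0) ltr_pdivrMr//.
  apply: lt_trans him _; apply: le_lt_trans kd _; rewrite ltr_pM2l//.
  by move: re2; lra.
have zu : z' = u * (lam%:C * expi t) by rewrite mulfVK.
rewrite {1}zu {1}(polar_atan re0) expiD.
have -> : modulus z' = modulus u * lam by rewrite zu modulusM modulus_polar// ltW.
rewrite rmorphM /=; ring.
Qed.

End Complex_functions.

Section Plane_topology.
Context {R : realType}.

Lemma nbhs_complexP (z : R[i]) (A : set R[i]) : nbhs z A <->
  exists2 e : R, 0 < e & forall z', modulus (z' - z) < e -> A z'.
Proof.
split.
  move=> /(@nbhs_ballP R[i] (R[i])^o) [e /= e0 he].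
  have eR : e = (complex.Re e)%:C.
    by move: e0; rewrite ltcE /= => /andP[/eqP h _]; apply: complex_ext.
  exists (complex.Re e); first by rewrite -ltcR -eR.
  by move=> z' hz; apply: he; rewrite -ball_normE /= eR normc_modulus modulusB ltcR.
move=> [e e0 he]; apply/(@nbhs_ballP R[i] (R[i])^o); exists e%:C => /=.
  by rewrite ltcR.
by move=> z'; rewrite -ball_normE /= normc_modulus modulusB ltcR; exact: he.
Qed.

Lemma continuous_curve_eps (g : R -> R[i]) (t : R) : {for t, continuous g} ->
  forall e : R, 0 < e -> exists2 d : R, 0 < d & forall u : R,
    `|u - t| < d -> modulus (g u - g t) < e.
Proof.
move=> cg e e0; have : nbhs (g t) [set z | modulus (z - g t) < e].
  by apply/nbhs_complexP; exists e.
move=> /cg [d /= d0 hd]; exists d => // u ut; apply: hd.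
by rewrite /ball_ /= distrC.
Qed.

Lemma continuous_Re_curve (g : R -> R[i]) (t : R) : {for t, continuous g} ->
  {for t, continuous (fun u => complex.Re (g u))}.
Proof.
move=> /continuous_curve_eps H; apply/continuous_epsP => e e0.
have [d d0 hd] := H e e0; exists d => // u /hd; apply: le_lt_trans.
by have := Re_le_modulus (g u - g t); rewrite !ReImE.
Qed.

Lemma continuous_Im_curve (g : R -> R[i]) (t : R) : {for t, continuous g} ->
  {for t, continuous (fun u => complex.Im (g u))}.
Proof.
move=> /continuous_curve_eps H; apply/continuous_epsP => e e0.
have [d d0 hd] := H e e0; exists d => // u /hd; apply: le_lt_trans.
by have := Im_le_modulus (g u - g t); rewrite !ReImE.
Qed.

Lemma eps_continuousP (F : R[i] -> R[i]) : continuous F <-> eps_continuous F.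
Proof.
split.
  move=> cF z e e0; have : nbhs (F z) [set y | modulus (y - F z) < e].
    by apply/nbhs_complexP; exists e.
  by move=> /cF /nbhs_complexP.
move=> H z A /nbhs_complexP [e e0 he]; apply/nbhs_complexP.
by have [d d0 hd] := H z e e0; exists d => // z' /hd /he.
Qed.

End Plane_topology.

(** * Derivatives through a change of parameter *)

Section Inverse_function.
Context {R : realType}.
Implicit Types (theta f k : R -> R).

(** By the intermediate value theorem, a continuous function with nonzero
    derivative at [t0] is open there, with a linear bound for the preimages. *)
Lemma open_at_derivative theta (t0 l d0 : R) : l != 0 -> 0 < d0 ->
  (forall u, `|u - t0| < d0 -> {for u, continuous theta}) ->
  is_derive t0 1 theta l ->
  forall d, 0 < d -> exists2 eta : R, 0 < eta &
    forall s, `|s - theta t0| < eta -> exists u,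
      [/\ `|u - t0| < d, theta u = s & `|u - t0| <= 2 / `|l| * `|s - theta t0| ].
Proof.
move=> l0 d00 ct /is_derive_epsP H d dp.
have l2 : 0 < `|l| / 2 by rewrite divr_gt0 ?normr_gt0.
have [d1 d10 hd1] := H _ l2.
pose m := Num.min d0 (Num.min d d1).
have m0 : 0 < m by rewrite !lt_min d00 dp.
have mle : [/\ m <= d0, m <= d & m <= d1].
  by split; rewrite /m !ge_min lexx ?orbT.
case: mle => md0 md md1.
pose e := m / 2; have e0 : 0 < e by rewrite divr_gt0.
have em : e < m by rewrite /e; move: m0; lra.
have lower u : `|u - t0| < m -> `|l| / 2 * `|u - t0| <= `|theta u - theta t0|.
  move=> um; have := hd1 (u - t0) (lt_le_trans um md1).
  rewrite (addrC t0) subrK => h1.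
  have : `|l * (u - t0)| <= `|theta u - theta t0| + `|theta u - theta t0 - l * (u - t0)|.
    rewrite -{1}(subKr (theta u - theta t0) (l * (u - t0))).
    exact: ler_normB.
  by rewrite normrM => h2; lra.
exists (`|l| / 2 * e); first exact: mulr_gt0.
move=> s hs.
have he : forall x, x = e \/ x = - e -> `|theta (t0 + x) - theta t0 - l * x| <= `|l| / 2 * e.
  move=> x hx; have xe : `|x| = e by case: hx => ->; rewrite ?normrN gtr0_norm.
  by have := hd1 x; rewrite xe; apply; exact: lt_le_trans em md1.
have h1 := he e (or_introl erefl); have h2 := he (- e) (or_intror erefl).
have [u] : exists2 u, u \in `[t0 - e, t0 + e] & theta u = s.
  apply: IVT; first by lra.
    apply: continuous_in_subspaceT => u; rewrite inE /= in_itv /= => /andP[u1 u2].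
    by apply: ct; rewrite ltr_norml; apply/andP; split; lra.
  move: h1 h2 hs; rewrite !ler_norml ltr_norml => /andP[a1 a2] /andP[b1 b2] /andP[s1 s2].
  rewrite ge_min le_max; have [lp|ln] := leP 0 l.
    move: a1 a2 b1 b2 s1 s2; rewrite (ger0_norm lp) => *.
    by apply/andP; split; apply/orP; [left|right]; lra.
  move: a1 a2 b1 b2 s1 s2; rewrite (ltr0_norm ln) => *.
  by apply/andP; split; apply/orP; [right|left]; lra.
rewrite in_itv /= => /andP[u1 u2] us.
have um : `|u - t0| < m by rewrite ltr_norml; apply/andP; split; lra.
exists u; split => //; first exact: lt_le_trans um md.
have := lower u um; rewrite us -ler_pdivlMl// => /le_trans; apply.
by rewrite invf_div.
Qed.

(** The chain rule read backwards. Since [theta] is open at [t0] with a linear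
    bound for preimages, every point near [theta t0] is some [theta u] with [u - t0]
    comparable to the displacement, and there [f] is known to be [k u]. *)
Lemma derive_through theta f k (t0 l k' d0 : R) : l != 0 -> 0 < d0 ->
  (forall u, `|u - t0| < d0 -> {for u, continuous theta}) ->
  (forall u, `|u - t0| < d0 -> f (theta u) = k u) ->
  is_derive t0 1 theta l -> is_derive t0 1 k k' ->
  is_derive (theta t0) 1 f (k' / l).
Proof.
move=> l0 d00 ct fk dt dk; apply/is_derive_epsP => e e0.
have lp : 0 < `|l| by rewrite normr_gt0.
pose q := 1 + `|k' / l|; have q0 : 0 < q by rewrite ltr_pwDl.
pose e' := e * `|l| / (2 * q).
have e'0 : 0 < e' by rewrite divr_gt0 ?mulr_gt0.
have [d1 d10 h1] := (is_derive_epsP _ _ _).1 dt _ e'0.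
have [d2 d20 h2] := (is_derive_epsP _ _ _).1 dk _ e'0.
pose m := Num.min d0 (Num.min d1 d2).
have m0 : 0 < m by rewrite !lt_min d00 d10.
have [eta eta0 heta] := open_at_derivative l0 d00 ct dt m0.
exists eta => // h hh.
have [|u [um us ul]] := heta (theta t0 + h).
  by rewrite addrAC subrr add0r.
move: um; rewrite /m !lt_min => /and3P[u0 u1 u2].
have := h1 _ u1; have := h2 _ u2; rewrite (addrC t0) subrK us => a1 a2.
rewrite -us !fk//; last by rewrite subrr normr0.
have -> : k u - k t0 - k' / l * h = (k u - k t0 - k' * (u - t0)) -
    k' / l * (theta t0 + h - theta t0 - l * (u - t0)).
  by field.
apply: le_trans (ler_normB _ _) _; rewrite normrM.
apply: le_trans (_ : _ <= e' * q * `|u - t0|) _.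
  rewrite /q; have : `|k' / l| * `|theta t0 + h - theta t0 - l * (u - t0)| <=
    `|k' / l| * (e' * `|u - t0|) by rewrite ler_wpM2l.
  by move: a1; lra.
apply: le_trans (ler_wpM2l _ ul) _; first by rewrite mulr_ge0// ltW.
rewrite addrAC subrr add0r mulrA ler_wpM2r//.
suff -> : e' * q * (2 / `|l|) = e by [].
by rewrite /e'; field; rewrite !gt_eqF.
Qed.

End Inverse_function.

Section Real_derivatives.
Context {R : realType}.
Implicit Types (f g : R -> R) (x a b : R).

Lemma is_derive_eqval f x a b : is_derive x 1 f a -> a = b -> is_derive x 1 f b.
Proof. by move=> ? <-. Qed.

Lemma is_deriveM1 f g x a b : is_derive x 1 f a -> is_derive x 1 g b ->
  is_derive x 1 (fun u => f u * g u) (a * g x + f x * b).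
Proof.
move=> da db; apply: is_derive_eqval (is_deriveM da db) _.
by rewrite -!/(_ * _) /GRing.scale /=; ring.
Qed.

Lemma is_deriveD1 f g x a b : is_derive x 1 f a -> is_derive x 1 g b ->
  is_derive x 1 (fun u => f u + g u) (a + b).
Proof. by move=> da db; exact: is_deriveD. Qed.

Lemma is_deriveB1 f g x a b : is_derive x 1 f a -> is_derive x 1 g b ->
  is_derive x 1 (fun u => f u - g u) (a - b).
Proof. by move=> da db; exact: is_deriveB. Qed.

Lemma is_deriveZ1 f x a (c : R) : is_derive x 1 f a ->
  is_derive x 1 (fun u => c * f u) (c * a).
Proof. by move=> da; exact: (is_deriveZ c). Qed.

Lemma is_deriveZr1 f x a (c : R) : is_derive x 1 f a ->
  is_derive x 1 (fun u => f u * c) (a * c).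
Proof.
move=> /(is_deriveZ1 c) h; rewrite mulrC; congr is_derive: h.
by apply/funext => u; rewrite mulrC.
Qed.

Lemma is_derive_cst1 x (c : R) : is_derive x 1 (fun _ : R => c) 0.
Proof. exact: is_derive_cst. Qed.

Lemma is_deriveDc1 f x a (c : R) : is_derive x 1 f a ->
  is_derive x 1 (fun u => c + f u) a.
Proof.
move=> h; apply: is_derive_eqval (is_deriveD1 (is_derive_cst1 x c) h) _.
exact: add0r.
Qed.

Lemma is_derive_id1 x : is_derive x 1 (fun u : R => u) 1.
Proof. exact: is_derive_id. Qed.

Lemma is_deriveV1 f x a : f x != 0 -> is_derive x 1 f a ->
  is_derive x 1 (fun u => (f u)^-1) (- a / f x ^+ 2).
Proof.
move=> fx da; apply: is_derive_eqval (is_deriveV fx da) _.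
by rewrite /GRing.scale /= mulrC mulNr mulrN.
Qed.

Lemma is_derive_comp1 f g x a b : is_derive (g x) 1 f a -> is_derive x 1 g b ->
  is_derive x 1 (fun u => f (g u)) (a * b).
Proof. exact: is_derive1_comp. Qed.

Lemma is_derive_unique f x a b : is_derive x 1 f a -> is_derive x 1 f b -> a = b.
Proof. by move=> [_ <-] [_ <-]. Qed.

Lemma is_derive_derive1 f x a : is_derive x 1 f a -> derive1 f x = a.
Proof. by rewrite derive1E => -[_ <-]. Qed.

Lemma continuous_near_gt0 f x : {for x, continuous f} -> 0 < f x ->
  exists2 d : R, 0 < d & forall u, `|u - x| < d -> 0 < f u.
Proof.
move=> /continuous_epsP H fx; have [d d0 hd] := H _ fx.
exists d => // u /hd; rewrite ltr_norml => /andP[+ _].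
by rewrite ltrBrDl subrr.
Qed.

Lemma is_derive_near f g x a (d : R) : 0 < d ->
  (forall u, `|u - x| < d -> f u = g u) -> is_derive x 1 f a -> is_derive x 1 g a.
Proof.
move=> d0 fg /is_derive_epsP H; apply/is_derive_epsP => e e0.
have [d1 d10 hd1] := H e e0; exists (Num.min d d1); first by rewrite lt_min d0.
move=> h; rewrite lt_min => /andP[hd hd2].
rewrite -!fg; first exact: hd1.
  by rewrite subrr normr0.
by rewrite addrAC subrr add0r.
Qed.

End Real_derivatives.

(** * The polar parametrization of the curve *)

Section Polar_curve.
Context {R : realType} (gamma : set R[i]) (r : R -> R).
Context (gamma_smooth : smooth_jordan_curve gamma)
  (gamma_tangent : forall l, tangent_line gamma l -> ~ l 0)
  (r_polar : polar_parametrization gamma r).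

Let P s := (r s)%:C * expi s.

Lemma polar_gt0 s : 0 < r s.
Proof. by case: r_polar. Qed.

Lemma polar_periodic s (n : int) : r (s + n%:~R * (2 * pi)) = r s.
Proof.
have [_ rp _] := r_polar.
have H m t : r (t + m%:R * (2 * pi)) = r t.
  elim: m => [|m IH]; first by rewrite mul0r addr0.
  by rewrite -natr1 mulrDl mul1r addrA rp.
case: n => n; first exact: H.
by rewrite NegzE mulrNz mulNr -(H n.+1 (s - _)) subrK.
Qed.

Lemma polar_of_expi s t : expi s = expi t -> r s = r t.
Proof. by move=> /expi_eq [n ->]; exact: polar_periodic. Qed.

Lemma polar_mem s : gamma (P s).
Proof. by have [_ _ ->] := r_polar; exists s. Qed.

Lemma polar_radius (x t : R) : 0 <= x -> gamma (x%:C * expi t) -> x = r t.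
Proof.
have [rp _ ge] := r_polar; move=> x0; rewrite ge => -[s _ h].
have xr : x = r s.
  by have := congr1 modulus h; rewrite !modulus_polar// ltW.
rewrite xr; apply: polar_of_expi.
move: h; rewrite xr => /mulfI; apply.
by rewrite -modulus_gt0 modulus_real gtr0_norm.
Qed.

Section Parametrization.
Context (c : R -> R[i]) (hc : smooth_jordan_parametrization gamma c).

Let v := velocity c.
Let N u := complex.Re (c u) * complex.Re (v u) + complex.Im (c u) * complex.Im (v u).
Let J u := complex.Re (c u) * complex.Im (v u) - complex.Im (c u) * complex.Re (v u).

Let dc u : is_cderive c u (v u).
Proof.
have [_ _ [h1 h2 _] _ _] := hc; split => /=; rewrite derive1E.
  exact: DeriveDef (h1 u) erefl.
exact: DeriveDef (h2 u) erefl.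
Qed.

(** The tangent line at [c u] avoids the origin exactly when [c u] and the
    velocity are linearly independent. *)
Lemma tangent_det_neq0 u : J u != 0.
Proof.
apply/negP => /eqP J0.
have [_ _ _ /(_ u) v0 _] := hc.
apply: (gamma_tangent (l := range (fun s : R => c u + s%:C * velocity c u))).
  by exists c, u.
have v2 : complex.Re (v u) ^+ 2 + complex.Im (v u) ^+ 2 != 0.
  by rewrite -modulus_sqr sqrf_eq0 gt_eqF// modulus_gt0.
exists (- N u / (complex.Re (v u) ^+ 2 + complex.Im (v u) ^+ 2)) => //.
rewrite -/v; apply: complex_ext; rewrite !ReImE /=.
  rewrite mul0r subr0.
  have -> : complex.Re (c u) + - N u / (complex.Re (v u) ^+ 2 + complex.Im (v u) ^+ 2) *
    complex.Re (v u) = J u * complex.Im (v u) / (complex.Re (v u) ^+ 2 + complex.Im (v u) ^+ 2).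
    by rewrite /N /J; field.
  by rewrite J0 mul0r mul0r.
rewrite mul0r addr0.
have -> : complex.Im (c u) + - N u / (complex.Re (v u) ^+ 2 + complex.Im (v u) ^+ 2) *
  complex.Im (v u) = - J u * complex.Re (v u) / (complex.Re (v u) ^+ 2 + complex.Im (v u) ^+ 2).
  by rewrite /N /J; field.
by rewrite J0 oppr0 mul0r mul0r.
Qed.

Let X s0 u := complex.Re (c u) * cos s0 + complex.Im (c u) * sin s0.
Let Y s0 u := complex.Im (c u) * cos s0 - complex.Re (c u) * sin s0.
(** The argument of [c u], measured from the ray with argument [s0]; [X] and [Y] are
    the coordinates of [c u] in the frame rotated by [s0]. *)
Let theta s0 u := s0 + atan (Y s0 u / X s0 u).

Let dX (s0 u : R) : is_derive u 1 (X s0)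
  (complex.Re (v u) * cos s0 + complex.Im (v u) * sin s0).
Proof.
have [d1 d2] := dc u; rewrite /X; apply: is_deriveD1.
  exact: is_deriveZr1.
exact: is_deriveZr1.
Qed.

Let dY (s0 u : R) : is_derive u 1 (Y s0)
  (complex.Im (v u) * cos s0 - complex.Re (v u) * sin s0).
Proof.
have [d1 d2] := dc u; rewrite /Y; apply: is_deriveB1.
  exact: is_deriveZr1.
exact: is_deriveZr1.
Qed.

Let dtheta (s0 u : R) : X s0 u != 0 -> is_derive u 1 (theta s0)
  ((1 + (Y s0 u / X s0 u) ^+ 2)^-1 *
   ((complex.Im (v u) * cos s0 - complex.Re (v u) * sin s0) / X s0 u +
    Y s0 u * (- (complex.Re (v u) * cos s0 + complex.Im (v u) * sin s0) / X s0 u ^+ 2))).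
Proof.
move=> X0; rewrite /theta.
apply: is_deriveDc1; apply: (@is_derive_comp1 _ atan).
apply: is_deriveM1; first exact: dY.
by apply: is_deriveV1 => //; exact: dX.
Qed.

Let theta_near t0 s0 : c t0 = P s0 -> exists2 d : R, 0 < d &
  forall u, `|u - t0| < d -> [/\ {for u, continuous (theta s0)},
    r (theta s0 u) = modulus (c u) &
    c u = (modulus (c u))%:C * expi (theta s0 u)].
Proof.
move=> ct0; have Xt0 : X s0 t0 = r s0.
  rewrite /X ct0 /P !ReImE /= !mul0r subr0 addr0 -[RHS]mulr1 -(cos2Dsin2 s0); ring.
have cX : {for t0, continuous (X s0)} by exact: is_derive_continuous (dX s0 t0).
have [|d d0 hd] := continuous_near_gt0 cX; first by rewrite Xt0 polar_gt0.
exists d => // u /hd X0.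
have cu : c u = (modulus (c u))%:C * expi (theta s0 u).
  have -> : c u = expi s0 * (X s0 u +i* Y s0 u).
    apply: complex_ext; rewrite !ReImE /= /X /Y.
      by rewrite -[LHS]mulr1 -(cos2Dsin2 s0); ring.
    by rewrite -[LHS]mulr1 -(cos2Dsin2 s0); ring.
  rewrite modulusM modulus_expi mul1r /theta expiD.
  by rewrite {1}(@polar_atan _ (X s0 u +i* Y s0 u))//=; ring.
split => //.
  by apply: is_derive_continuous (dtheta _); rewrite gt_eqF.
apply/esym/polar_radius; first exact: modulus_ge0.
by rewrite -cu; have [_ _ _ _ ->] := hc; exists u.
Qed.

Let theta_at (t0 s0 : R) : c t0 = P s0 ->
  theta s0 t0 = s0 /\ is_derive t0 1 (theta s0) (J t0 / r s0 ^+ 2).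
Proof.
move=> ct0; have r0 := polar_gt0 s0.
have Xt0 : X s0 t0 = r s0.
  rewrite /X ct0 /P !ReImE /= !mul0r subr0 addr0 -[RHS]mulr1 -(cos2Dsin2 s0); ring.
have Yt0 : Y s0 t0 = 0.
  rewrite /Y ct0 /P !ReImE /= !mul0r subr0 addr0; ring.
split; first by rewrite /theta Yt0 mul0r atan0 addr0.
apply: is_derive_eqval (dtheta _) _; first by rewrite Xt0 gt_eqF.
rewrite Yt0 Xt0 mul0r expr0n /= addr0 invr1 mul1r mul0r addr0.
rewrite /J ct0 /P !ReImE /=; field; exact: lt0r_neq0.
Qed.

(** Along any parametrization the argument moves with speed [J / r ^ 2], which is
    not zero, so it is a local parameter; [r'] is the quotient of the derivatives of
    the modulus, [N / r], and of the argument. *)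
Lemma polar_derive_param (t0 s0 : R) : c t0 = P s0 ->
  is_derive s0 1 r (r s0 * (N t0 / J t0)).
Proof.
move=> ct0; have [d d0 hd] := theta_near ct0.
have r0 := polar_gt0 s0.
have mt0 : modulus (c t0) = r s0 by rewrite ct0 modulus_polar// ltW.
have [th0 dth] := theta_at ct0.
have dm : is_derive t0 1 (fun u => modulus (c u)) (N t0 / r s0).
  have -> : (fun u => modulus (c u)) =
     (fun u => Num.sqrt (complex.Re (c u) * complex.Re (c u) + complex.Im (c u) * complex.Im (c u))).
    by apply/funext => u; rewrite /modulus; case: (c u).
  have [d1 d2] := dc t0.
  have sq : complex.Re (c t0) * complex.Re (c t0) + complex.Im (c t0) * complex.Im (c t0)
     = r s0 ^+ 2 by rewrite -mt0 modulus_sqr.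
  have dq := is_deriveD1 (is_deriveM1 d1 d1) (is_deriveM1 d2 d2).
  have ds : is_derive (complex.Re (c t0) * complex.Re (c t0) +
      complex.Im (c t0) * complex.Im (c t0)) 1 Num.sqrt (2 * Num.sqrt (r s0 ^+ 2))^-1.
    by rewrite sq; apply: is_derive1_sqrt; rewrite exprn_gt0.
  apply: (is_derive_eqval (@is_derive_comp1 _ Num.sqrt (fun u =>
    complex.Re (c u) * complex.Re (c u) + complex.Im (c u) * complex.Im (c u)) t0 _ _ ds dq)).
  rewrite sqrtr_sqr gtr0_norm// /N; field; exact: lt0r_neq0.
rewrite -{1}th0.
apply: is_derive_eqval (derive_through (f := r) _ d0 _ _ dth dm) _.
- by rewrite mulf_neq0 ?tangent_det_neq0// invr_eq0 expf_neq0 ?gt_eqF.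
- by move=> u /hd [].
- by move=> u /hd [].
- by field; rewrite tangent_det_neq0 gt_eqF.
Qed.

Let cN u : {for u, continuous N}.
Proof.
have [d1 d2] := dc u; have [_ _ [_ _ /(_ u) cv] _ _] := hc.
by rewrite /N; apply: cvgD; apply: cvgM; [exact: is_derive_continuous d1|
  exact: continuous_Re_curve|exact: is_derive_continuous d2|exact: continuous_Im_curve].
Qed.

Let cJ u : {for u, continuous J}.
Proof.
have [d1 d2] := dc u; have [_ _ [_ _ /(_ u) cv] _ _] := hc.
by rewrite /J; apply: cvgB; apply: cvgM; [exact: is_derive_continuous d1|
  exact: continuous_Im_curve|exact: is_derive_continuous d2|exact: continuous_Re_curve].
Qed.

(** [r' / r] equals the continuous function [N / J] of the parameter, and the
    argument is an open map of the parameter. *)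
Lemma polar_logderive_continuous : continuous (fun s => derive1 r s / r s).
Proof.
have Pc s : exists t, c t = P s.
  have [_ _ _ _ ge] := hc; have := polar_mem s; rewrite ge => -[t _ h].
  by exists t.
have val t s : c t = P s -> derive1 r s / r s = N t / J t.
  move=> /polar_derive_param /is_derive_derive1 ->.
  by rewrite mulrAC divff ?mul1r// gt_eqF// polar_gt0.
move=> s0; have [t0 ct0] := Pc s0.
apply/continuous_epsP => e e0; rewrite (val _ _ ct0).
have cNJ : {for t0, continuous (fun u => N u / J u)}.
  by apply: cvgM; [exact: cN|apply: cvgV; [exact: tangent_det_neq0|exact: cJ]].
have [d1 d10 hd1] := (continuous_epsP _ _).1 cNJ e e0.
have [d d0 hd] := theta_near ct0.
have r0 := polar_gt0 s0.
have [th0 dth] := theta_at ct0.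
have [|||eta eta0 heta] := open_at_derivative (theta := theta s0) (t0 := t0)
    (l := J t0 / r s0 ^+ 2) (d := Num.min d d1) _ d0 _ dth.
- by rewrite mulf_neq0 ?tangent_det_neq0// invr_eq0 expf_neq0 ?gt_eqF.
- by move=> u /hd [].
- by rewrite lt_min d0.
exists eta => // s hs; have [|u [ud us _]] := heta s; first by rewrite th0.
move: ud; rewrite lt_min => /andP[/hd [_ h1 h2] /hd1].
by rewrite -(val u s)//; rewrite /P -us h1.
Qed.

End Parametrization.

Lemma polar_derivable (s : R) : is_derive s 1 r (derive1 r s).
Proof.
have [c hc] := gamma_smooth.
have [_ _ _ _ ge] := hc; have := polar_mem s; rewrite ge => -[t _ h].
have H := polar_derive_param hc h.
by rewrite (is_derive_derive1 H).
Qed.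

Lemma polar_curve_derivable (s : R) :
  is_cderive P s ((derive1 r s +i* r s) * expi s).
Proof.
have d1 := polar_derivable s.
have d2 : is_derive s 1 cos (- sin s) by exact: is_derive_cos.
have d3 : is_derive s 1 sin (cos s) by exact: is_derive_sin.
split.
  have -> : (fun u => complex.Re (P u)) = (fun u => r u * cos u).
    by apply/funext => u; rewrite /P !ReImE /=; ring.
  by apply: (is_derive_eqval (is_deriveM1 d1 d2)); rewrite !ReImE /=; ring.
have -> : (fun u => complex.Im (P u)) = (fun u => r u * sin u).
  by apply/funext => u; rewrite /P !ReImE /=; ring.
by apply: (is_derive_eqval (is_deriveM1 d1 d3)); rewrite !ReImE /=; ring.
Qed.

Lemma polar_continuous : continuous r.
Proof. by move=> s; apply: is_derive_continuous (polar_derivable s). Qed.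

Lemma derive1_polar_periodic (s : R) (n : int) :
  derive1 r (s + n%:~R * (2 * pi)) = derive1 r s.
Proof.
have H : is_derive s 1 (fun u => r (u + n%:~R * (2 * pi)))
    (derive1 r (s + n%:~R * (2 * pi))).
  apply: (is_derive_eqval (@is_derive_comp1 _ r (fun u => u + n%:~R * (2 * pi)) s _ 1
     (polar_derivable _) _)); last exact: mulr1.
  apply: (is_derive_eqval (is_deriveD1 (is_derive_id1 s) (is_derive_cst1 s _))).
  exact: addr0.
apply: (is_derive_unique H).
have -> : (fun u => r (u + n%:~R * (2 * pi))) = r.
  by apply/funext => u; rewrite polar_periodic.
exact: polar_derivable.
Qed.

Lemma periodic_min (f : R -> R) : continuous f ->
  (forall s (n : int), f (s + n%:~R * (2 * pi)) = f s) ->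
  exists s0, forall s, f s0 <= f s.
Proof.
move=> cf fp; have pi2 : 0 <= 2 * pi :> R by rewrite mulr_ge0// pi_ge0.
have [s0 _ hs0] := EVT_min pi2 (continuous_subspaceT cf).
have p0 : 0 < 2 * pi :> R by rewrite mulr_gt0// pi_gt0.
exists s0 => s; pose n := Num.floor (s / (2 * pi)).
rewrite -(subrK (n%:~R * (2 * pi)) s) fp; apply: hs0.
rewrite in_itv /= subr_ge0 -ler_pdivlMr// Num.Theory.floor_le_tmp /=.
rewrite lerBlDr -[X in X + _]mul1r -mulrDl -ler_pdivrMr// addrC -intrD1 ltW//.
exact: Num.Theory.floorD1_gt.
Qed.

Lemma periodic_max (f : R -> R) : continuous f ->
  (forall s (n : int), f (s + n%:~R * (2 * pi)) = f s) ->
  exists s0, forall s, f s <= f s0.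
Proof.
move=> cf fp; have [||s0 hs0] := @periodic_min (fun s => - f s).
- by move=> s; apply: cvgN; exact: cf.
- by move=> s n; rewrite fp.
by exists s0 => s; rewrite -lerN2.
Qed.

Definition kappa s := derive1 r s / r s.

Lemma kappa_bounded : exists B : R, forall s, `|kappa s| <= B.
Proof.
have [c hc] := gamma_smooth.
have ck := polar_logderive_continuous hc.
have kp s (n : int) : kappa (s + n%:~R * (2 * pi)) = kappa s.
  by rewrite /kappa derive1_polar_periodic polar_periodic.
have [s1 h1] := periodic_min ck kp; have [s2 h2] := periodic_max ck kp.
exists (`|kappa s1| + `|kappa s2|) => s.
have k1 : kappa s1 <= kappa s := h1 s; have k2 : kappa s <= kappa s2 := h2 s.
have n1 := ler_norm (- kappa s1); have n2 := ler_norm (kappa s2).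
have := normr_ge0 (kappa s1); have := normr_ge0 (kappa s2).
by rewrite normrN in n1; rewrite ler_norml; move=> *; apply/andP; split; lra.
Qed.

Lemma kappa_continuous : continuous kappa.
Proof. by have [c hc] := gamma_smooth; exact: polar_logderive_continuous hc. Qed.

Lemma dist_to_origin_le s : dist_to_origin gamma <= r s.
Proof.
apply: ge_inf; first by exists 0 => _ [z _ <-]; exact: modulus_ge0.
by exists (P s); [exact: polar_mem|rewrite modulus_polar// ltW// polar_gt0].
Qed.

Lemma dist_to_origin_gt0 : 0 < dist_to_origin gamma.
Proof.
have [s0 h0] := periodic_min polar_continuous polar_periodic.
apply: lt_le_trans (polar_gt0 s0) _; apply: lb_le_inf.
  by exists (modulus (P 0)), (P 0) => //; exact: polar_mem.
move=> _ [z gz <-]; have [_ _ ge] := r_polar; move: gz; rewrite ge => -[s _ <-].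
by rewrite modulus_polar// ltW// polar_gt0.
Qed.

Let ler_sin : {in `[(- (pi / 2)), pi / 2] &, {mono (@sin R) : x y / x <= y}}.
Proof. by move=> x y hx hy; rewrite !leNgt ltr_sin. Qed.

Let sin_piB (x : R) : sin (pi - x) = sin x.
Proof. by rewrite sinB sinpi cospi; ring. Qed.

Let A := tangent_angle r.

Let Acos s : cos (A s) = derive1 r s / Num.sqrt (r s ^+ 2 + derive1 r s ^+ 2).
Proof.
have r0 := polar_gt0 s; rewrite /A /tangent_angle acosK//.
set x := derive1 r s; have h : 0 < r s ^+ 2 + x ^+ 2.
  by rewrite ltr_pwDl ?sqr_ge0// exprn_gt0.
rewrite in_itv /= -ler_norml normrM normfV (ger0_norm (sqrtr_ge0 _)).
rewrite ler_pdivrMr ?sqrtr_gt0// mul1r -sqrtr_sqr ler_sqrt ?ltW//.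
by rewrite ltrDr exprn_gt0.
Qed.

Let Asin2 s : sin (A s) ^+ 2 * (1 + kappa s ^+ 2) = 1.
Proof.
have r0 := polar_gt0 s; rewrite sin2cos2 Acos /kappa.
set x := derive1 r s; have h : 0 < r s ^+ 2 + x ^+ 2.
  by rewrite ltr_pwDl ?sqr_ge0// exprn_gt0.
rewrite exprMn exprVn sqr_sqrtr ?ltW//.
by field; rewrite !gt_eqF.
Qed.

Let Abound s : 0 <= A s <= pi.
Proof.
have r0 := polar_gt0 s; rewrite /A /tangent_angle.
set y := _ / _; have : -1 <= y <= 1.
  set x := derive1 r s in y *; have h : 0 < r s ^+ 2 + x ^+ 2.
    by rewrite ltr_pwDl ?sqr_ge0// exprn_gt0.
  rewrite -ler_norml normrM normfV (ger0_norm (sqrtr_ge0 _)).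
  rewrite ler_pdivrMr ?sqrtr_gt0// mul1r -sqrtr_sqr ler_sqrt ?ltW//.
  by rewrite ltrDr exprn_gt0.
by move=> hy; rewrite acos_ge0// acos_lepi.
Qed.

Let alpha := alpha_of r.

Let alpha_le s : alpha <= A s /\ alpha <= pi - A s.
Proof.
split; rewrite /alpha /alpha_of ge_min; apply/orP.
  left; apply: ge_inf; last by exists s.
  by exists 0 => _ [t _ <-]; case/andP: (Abound t).
right; rewrite lerD2l lerN2; apply: ub_le_sup; last by exists s.
by exists pi => _ [t _ <-]; case/andP: (Abound t).
Qed.

Let alpha_ge (b : R) : (forall s, b <= A s <= pi - b) -> b <= alpha.
Proof.
move=> H; rewrite /alpha /alpha_of le_min; apply/andP; split.
  apply: lb_le_inf; first by exists (A 0), 0.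
  by move=> _ [t _ <-]; case/andP: (H t).
rewrite lerBrDr addrC -lerBrDr; apply: ge_sup; first by exists (A 0), 0.
by move=> _ [t _ <-]; case/andP: (H t).
Qed.

Let alpha_bound : 0 <= alpha <= pi / 2.
Proof.
apply/andP; split; first by apply: alpha_ge => s; rewrite subr0.
by have [h1 h2] := alpha_le 0; lra.
Qed.

(** [sin alpha_gamma] is the largest lower bound of [sin alpha_s], and
    [1 + kappa ^ 2 = 1 / sin alpha_s ^ 2]. *)
Lemma sin_alpha_le s : sin (alpha_of r) ^+ 2 * (1 + kappa s ^+ 2) <= 1.
Proof.
have /andP[a0 a1] := alpha_bound; have [h1 h2] := alpha_le s.
have k0 : 0 < 1 + kappa s ^+ 2 by rewrite ltr_pwDl// sqr_ge0.
rewrite -[leRHS](Asin2 s) ler_pM2r// ler_sqr ?nnegrE; last 2 first.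
- by apply: sin_ge0_pi; move: (@pi_ge0 R); rewrite -/alpha => *; lra.
- exact: sin_ge0_pi.
have mono := @ler_sin.
have [Ale|Agt] := leP (A s) (pi / 2).
  by rewrite mono// in_itv /=; apply/andP; split; move: (@pi_ge0 R); rewrite -/alpha => *; lra.
rewrite -(sin_piB (A s)).
by rewrite mono// in_itv /=; apply/andP; split; move: (@pi_ge0 R); rewrite -/alpha => *; lra.
Qed.

(** [c <= sin alpha_s] for all [s] confines every tangent angle to
    [[asin c, pi - asin c]], hence also their infimum and supremum. *)
Lemma sin_alpha_ge (c : R) : 0 <= c ->
  (forall s, c ^+ 2 * (1 + kappa s ^+ 2) <= 1) -> c <= sin (alpha_of r).
Proof.
move=> c0 H.
have cA s : c <= sin (A s).
  have k0 : 0 < 1 + kappa s ^+ 2 by rewrite ltr_pwDl// sqr_ge0.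
  by have := H s; rewrite -[leRHS](Asin2 s) ler_pM2r// ler_sqr ?nnegrE//; exact: sin_ge0_pi.
have c1 : -1 <= c <= 1.
  by rewrite (le_trans _ c0)//= (le_trans (cA 0) (sin_le1 _)).
have cb := asinK c1; set b := asin c in cb.
have b1 : b <= pi / 2 := asin_lepi2 c1.
have b2 : - (pi / 2) <= b := asin_geNpi2 c1.
have mono := @ler_sin.
have /andP[a0 a1] := alpha_bound.
suff ba : b <= alpha.
  rewrite -cb -/alpha mono// in_itv /=; apply/andP; split => //.
  by move: (@pi_ge0 R) => *; lra.
apply: alpha_ge => s; have /andP[A0 A1] := Abound s.
apply/andP; split.
  have [Ale|Agt] := leP (A s) (pi / 2); last by apply: le_trans b1 (ltW Agt).
  have := cA s; rewrite -cb mono// in_itv /=; apply/andP; split => //.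
  by move: (@pi_ge0 R) => *; lra.
have [Ale|Agt] := leP (A s) (pi / 2); first by move: b1; lra.
suff : b <= pi - A s by lra.
have := cA s; rewrite -cb.
rewrite -(sin_piB (A s)).
rewrite mono// in_itv /=; apply/andP; split => //; move: (@pi_ge0 R) => *; lra.
Qed.

Lemma sin_alpha_gt0 : 0 < sin (alpha_of r).
Proof.
have [B hB] := kappa_bounded.
have D0 : 0 < 1 + `|B| by rewrite ltr_pwDl.
apply: lt_le_trans (_ : 0 < (1 + `|B|)^-1) _; first by rewrite invr_gt0.
apply: sin_alpha_ge => [|s]; first by rewrite invr_ge0 ltW.
rewrite exprVn ler_pdivrMl ?exprn_gt0// mulr1.
have h : `|kappa s| <= `|B| by apply: le_trans (hB s) (ler_norm _).
have : kappa s ^+ 2 <= `|B| ^+ 2.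
  by rewrite -(real_normK (num_real (kappa s))) ler_sqr// nnegrE.
by have := normr_ge0 B; nra.
Qed.

Lemma sin_alpha_le1 : sin (alpha_of r) <= 1.
Proof. exact: sin_le1. Qed.

End Polar_curve.

(** * Continuous injective phase functions *)

Section Phase.
Context {R : realType}.
Implicit Types (psi : R -> R) (c C : R).

Lemma continuous_eps (f : R -> R) : continuous f -> forall (t e : R), 0 < e ->
  exists2 d : R, 0 < d & forall u, `|u - t| < d -> `|f u - f t| < e.
Proof. by move=> cf t e e0; exact: (continuous_epsP f t).1 (cf t) e e0. Qed.

(** Between two different multiples of [2 pi] the function would take, by the
    intermediate value theorem, a value at an odd multiple of [pi]. *)
Lemma int_valued_constant (h : R -> R) : continuous h ->
  (forall t, exists n : int, h t = n%:~R * (2 * pi)) -> forall t, h t = h 0.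
Proof.
move=> ch hn t; apply/eqP/negP => /negP ne.
have pi0 := @pi_gt0 R.
pose lo := Num.min 0 t; pose hi := Num.max 0 t.
have lohi : lo <= hi by rewrite /lo /hi ge_min le_max lexx.
(* strictly between the two values, which differ by at least [2 pi] *)
pose v := Num.min (h lo) (h hi) + pi.
have [n1 e1] := hn lo; have [n2 e2] := hn hi.
have ne' : h lo != h hi.
  by rewrite /lo /hi; case: (leP 0 t) => _ //; rewrite eq_sym.
have n12 : n1 != n2 by apply: contraNN ne' => /eqP n12; rewrite e1 e2 n12.
have gap (a b : int) : (a < b)%R -> a%:~R * (2 * pi) + 2 * pi <= b%:~R * (2 * pi) :> R.
  move=> ab; rewrite -[X in _ + X]mul1r -mulrDl ler_pM2r; last by rewrite mulr_gt0.
  by rewrite -[X in _ + X]/(1%:~R) -intrD ler_int lezD1.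
have [u _ hu] : exists2 u, u \in `[lo, hi] & h u = v.
  apply: IVT => //; first exact: continuous_subspaceT.
  rewrite /v lerDl (ltW pi0) /= e1 e2.
  have [n12'|n12'|n12'] := ltgtP n1 n2; last by rewrite n12' eqxx in n12.
    have g := gap _ _ n12'; rewrite min_l; last lra.
    by rewrite max_r; lra.
  have g := gap _ _ n12'; rewrite min_r; last lra.
  by rewrite max_l; lra.
have [m] := hn u; rewrite hu /v.
have [k ->] : exists k : int, Num.min (h lo) (h hi) = k%:~R * (2 * pi).
  by rewrite minElt; case: ifP => _; [exists n1|exists n2].
move=> /eqP; rewrite -subr_eq0.
have -> : k%:~R * (2 * pi) + pi - m%:~R * (2 * pi) = ((k - m) * 2 + 1)%:~R * pi :> R.
  by rewrite intrD intrM intrB; ring.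
rewrite mulf_eq0 (gt_eqF pi0) orbF intr_eq0 => /eqP; lia.
Qed.

Lemma inj_monotone_sign psi : continuous psi -> injective psi ->
  exists s : R, `|s| = 1 /\ forall a b, a < b -> 0 < s * (psi b - psi a).
Proof.
move=> cpsi ipsi; have [||mono|mono] := @itv_continuous_inj_mono R psi `]-oo, +oo[.
- exact: continuous_subspaceT.
- by move=> a b _ _; exact: ipsi.
- exists 1; split; first exact: normr1.
  by move=> a b ab; rewrite mul1r subr_gt0 mono.
- exists (-1); split; first by rewrite normrN1.
  by move=> a b ab; rewrite mulN1r opprB subr_gt0 mono.
Qed.

(** Local bounds for the increments of a continuous injective function are
    bounds with a sign, since the function is monotone; so they can be
    integrated. *)
Lemma bilipschitz_of_local psi c C : 0 < c -> continuous psi -> injective psi ->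
  (forall t, exists2 d : R, 0 < d & forall t', t < t' < t + d ->
    forall e : R, 0 < e -> exists2 d : R, 0 < d & forall h, 0 < h < d ->
      (c - e) * h <= `|psi (t' + h) - psi t'| /\
      `|psi (t' + h) - psi t'| <= (C + e) * h) ->
  bilipschitz_with distR distR setT c C psi.
Proof.
move=> c0 cpsi ipsi H.
suff key x y : x <= y ->
    c * (y - x) <= `|psi y - psi x| /\ `|psi y - psi x| <= C * (y - x).
  have cC : c <= C.
    by have [] := key 0 1 ler01; rewrite subr0 !mulr1; exact: le_trans.
  split; first by rewrite c0.
  move=> x y _ _; rewrite /distR; have [xy|/ltW xy] := leP x y.
    rewrite distrC (distrC (psi x)) (ger0_norm (_ : 0 <= y - x)) ?subr_ge0//.
    exact: key.
  by rewrite (ger0_norm (_ : 0 <= x - y)) ?subr_ge0//; exact: key.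
move=> xy.
have [s [s1 smono]] := inj_monotone_sign cpsi ipsi.
have nE a b : a < b -> `|psi b - psi a| = s * (psi b - psi a).
  move=> ab; have := smono a b ab => h.
  by rewrite -[LHS]mul1r -s1 -normrM gtr0_norm.
have cs : continuous (fun t => s * psi t).
  by move=> t; apply: cvgM; [exact: cvg_cst|exact: cpsi].
have cs' : continuous (fun t => - (s * psi t)).
  by move=> t; apply: cvgN; exact: cs.
have up : s * psi y - s * psi x <= C * (y - x).
  apply: (@dini_increment_except R (fun t => s * psi t)) => // t _; have [d d0 hd] := H t.
  exists d => // t' /hd {}hd e /hd [d' d'0 hd']; exists d' => // h hh.
  have [_] := hd' h hh; have /andP[h0 _] := hh.
  by rewrite nE ?ltrDl// mulrBr.
have dn : - (s * psi y) - - (s * psi x) <= (- c) * (y - x).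
  apply: (@dini_increment_except R (fun t => - (s * psi t))) => // t _; have [d d0 hd] := H t.
  exists d => // t' /hd {}hd e /hd [d' d'0 hd']; exists d' => // h hh.
  have [+ _] := hd' h hh; have /andP[h0 _] := hh.
  by rewrite nE ?ltrDl//; lra.
move: xy; rewrite le_eqVlt => /predU1P[->|xy].
  by rewrite !subrr !mulr0 normr0.
by rewrite nE//; split; lra.
Qed.

Lemma bilipschitzR_ge c C psi : bilipschitz_with distR distR setT c C psi ->
  forall x y, c * `|x - y| <= `|psi x - psi y| /\ `|psi x - psi y| <= C * `|x - y|.
Proof. by move=> [_ H] x y; apply: H. Qed.

Lemma bilipschitzR_inj c C psi : bilipschitz_with distR distR setT c C psi ->
  injective psi.
Proof.
move=> H; have [/andP[c0 _] _] := H; move=> x y xy.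
have [+ _] := bilipschitzR_ge H x y; rewrite xy subrr normr0 => h.
apply/eqP; rewrite -subr_eq0 -normr_le0; have := normr_ge0 (x - y) => n0; nra.
Qed.

(** The lower bound makes the increments from 0 exceed any given value on both
    sides, and by monotonicity with opposite signs. *)
Lemma bilipschitzR_surj c C psi : continuous psi ->
  bilipschitz_with distR distR setT c C psi -> forall s, exists t, psi t = s.
Proof.
move=> cpsi H s; have [/andP[c0 _] _] := H.
have ipsi := bilipschitzR_inj H.
pose T := (`|s - psi 0| + 1) / c.
have T0 : 0 < T by rewrite divr_gt0// ltr_wpDl.
have far t : `|t| = T -> `|s - psi 0| < `|psi t - psi 0|.
  move=> tT; have [+ _] := bilipschitzR_ge H t 0; rewrite subr0 tT.
  by rewrite /T mulrC divfK ?gt_eqF//; apply: lt_le_trans; rewrite ltrDl.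
have h1 := far T (gtr0_norm T0).
have h2 := far (- T) (etrans (normrN _) (gtr0_norm T0)).
suff [u _ hu] : exists2 u, u \in `[- T, T] & psi u = s by exists u.
apply: IVT; [by lra|exact: continuous_subspaceT|].
have mono : (psi (- T) < psi 0 < psi T) \/ (psi T < psi 0 < psi (- T)).
  have [e [e1 he]] := inj_monotone_sign cpsi ipsi.
  have m1 := he 0 T T0; have m2 := he (- T) 0 ltac:(lra).
  have [e0|e0] := leP 0 e.
    by left; rewrite ger0_norm// in e1; subst e; apply/andP; split; lra.
  by right; rewrite ltr0_norm// in e1; apply/andP; split; nra.
rewrite ge_min le_max.
case: mono => /andP[m1 m2].
  move: h1 h2; rewrite (gtr0_norm (_ : 0 < psi T - psi 0)) ?subr_gt0//.
  rewrite (ltr0_norm (_ : psi (- T) - psi 0 < 0)) ?subr_lt0//.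
  rewrite !ltr_norml => /andP[a1 a2] /andP[b1 b2].
  by apply/andP; split; apply/orP; [left|right]; lra.
move: h1 h2; rewrite (ltr0_norm (_ : psi T - psi 0 < 0)) ?subr_lt0//.
rewrite (gtr0_norm (_ : 0 < psi (- T) - psi 0)) ?subr_gt0//.
rewrite !ltr_norml => /andP[a1 a2] /andP[b1 b2].
by apply/andP; split; apply/orP; [right|left]; lra.
Qed.

End Phase.

(** * The radial extension and its phase *)

Section Chains.
Context {R : realType}.

Lemma half_error (x h : R) : - (1 / 2 * h) <= x - h -> x - h <= 1 / 2 * h ->
  x <= h * 2 /\ h / 2 <= x.
Proof. by move=> *; split; lra. Qed.

Lemma lower_chain (k q N e2 l h ed D : R) : k * q <= k * N -> e2 * k <= N * k ->
  l * (h / 2) <= l * ed -> l * ed <= D -> D - k * q <= e2 * k ->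
  l * h <= k * (4 * N).
Proof. by move=> *; lra. Qed.

Lemma upper_chain (k q d e2 L h ed D : R) : k * d <= k * q -> e2 * k <= d / 2 * k ->
  L * ed <= L * (h * 2) -> D <= L * ed -> - (e2 * k) <= D - k * q ->
  k * d <= 4 * L * h.
Proof. by move=> *; lra. Qed.

End Chains.

Section Radial_map.
Context {R : realType} (gamma : set R[i]) (r : R -> R) (G : R[i] -> R[i])
  (psi : R -> R).
Context (gamma_smooth : smooth_jordan_curve gamma)
  (gamma_tangent : forall l, tangent_line gamma l -> ~ l 0)
  (r_polar : polar_parametrization gamma r)
  (G_homeo : homeomorphism_between unit_circle gamma G)
  (psi_cont : continuous psi)
  (psi_arg : forall t, G (expi t) = (rho_of G t)%:C * expi (psi t)).

Let w := radial_extension G.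
Let P s := (r s)%:C * expi s.

Let circle_expi t : unit_circle (expi t : R[i]).
Proof. exact: modulus_expi. Qed.

Lemma rho_polar t : rho_of G t = r (psi t).
Proof.
apply: (polar_radius r_polar); first exact: modulus_ge0.
rewrite -psi_arg; have [[h _ _] _ _] := G_homeo; apply: h.
exact: circle_expi.
Qed.

Lemma G_expi t : G (expi t) = P (psi t).
Proof. by rewrite psi_arg rho_polar. Qed.

Lemma radial_extension_polar (lam t : R) : 0 <= lam ->
  w (lam%:C * expi t) = lam%:C * P (psi t).
Proof.
move=> l0; rewrite /w /radial_extension normc_modulus modulus_polar//.
have [->|ln0] := eqVneq lam 0; first by rewrite !mul0r.
rewrite mulrAC divff ?mul1r ?G_expi//.
by rewrite -modulus_gt0 modulus_real normr_gt0.
Qed.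

Lemma expi_of_phase a b : psi a = psi b -> expi a = expi b.
Proof.
move=> ab; have [[_ ginj _] _ _] := G_homeo.
apply: ginj; rewrite ?inE; [exact: circle_expi|exact: circle_expi|].
by rewrite !G_expi ab.
Qed.

Lemma phase_period : exists n : int, forall t,
  psi (t + 2 * pi) = psi t + n%:~R * (2 * pi).
Proof.
pose h t := psi (t + 2 * pi) - psi t.
have hn t : exists n : int, h t = n%:~R * (2 * pi).
  have : expi (psi (t + 2 * pi)) = expi (psi t).
    have := G_expi (t + 2 * pi); rewrite expi_period G_expi /P => h1.
    have r1 : r (psi t) = r (psi (t + 2 * pi)).
      have := congr1 modulus h1.
      by rewrite !modulus_polar// ltW// (polar_gt0 r_polar).
    move: h1; rewrite r1 => /mulfI -> //.
    by rewrite -modulus_gt0 modulus_real normr_gt0 gt_eqF// (polar_gt0 r_polar).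
  by move=> /expi_eq [n hn]; exists n; rewrite /h hn; ring.
have ch : continuous h.
  move=> t; apply: cvgB; last exact: psi_cont.
  apply: continuous_comp; last exact: psi_cont.
  by apply: cvgD; [exact: cvg_id|exact: cvg_cst].
have [n hn0] := hn 0; exists n => t.
have := int_valued_constant ch hn t; rewrite hn0 /h => <-; ring.
Qed.

(** [psi] gains [2 pi n] over one turn. If [n] were 0, the function
    [psi (t + pi) - psi t] would change its sign between 0 and [pi], so that [G]
    would identify two antipodal points. With [n] different from 0, equal phases at
    arguments that agree up to full turns force the arguments to be equal. *)
Lemma phase_inj : injective psi.
Proof.
have [n hn] := phase_period.
have pi0 := @pi_gt0 R.
have n0 : n != 0.
  apply/negP => /eqP n0.
  pose h t := psi (t + pi) - psi t.
  have ch : continuous h.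
    move=> t; apply: cvgB; last exact: psi_cont.
    apply: continuous_comp; last exact: psi_cont.
    by apply: cvgD; [exact: cvg_id|exact: cvg_cst].
  have hpi : h pi = - h 0.
    rewrite /h add0r; have := hn 0; rewrite n0 mul0r addr0 add0r => <-.
    by rewrite -mulr2n mulr_natl; ring.
  have [u _ hu] : exists2 u, u \in `[0, pi] & h u = 0.
    apply: IVT; [exact: ltW|exact: continuous_subspaceT|].
    rewrite hpi ge_min le_max.
    by case: (leP 0 (h 0)) => h0; apply/andP; split; apply/orP; lra.
  have : expi (u + pi) = expi u.
    by apply: expi_of_phase; apply/eqP; rewrite -subr_eq0 -/(h u) hu.
  rewrite expiD -[RHS]mulr1 => /(mulfI (expi_neq0 _)) /(congr1 (@complex.Re R)) /=.
  by rewrite cospi; lra.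
have hk a (k : int) : psi (a + k%:~R * (2 * pi)) = psi a + k%:~R * n%:~R * (2 * pi).
  have H m b : psi (b + m%:R * (2 * pi)) = psi b + m%:R * n%:~R * (2 * pi).
    elim: m => [|m IH]; first by rewrite !mul0r !addr0.
    rewrite -natr1 mulrDl mul1r addrA hn IH; ring.
  case: k => k; first exact: H.
  have := H k.+1 (a - k.+1%:R * (2 * pi)); rewrite subrK => ->.
  by rewrite NegzE mulrNz -pmulrn mulNr; ring.
move=> a b ab; have [k hab] := expi_eq (expi_of_phase ab).
move: ab; rewrite hab hk => /eqP; rewrite addrC -subr_eq0 addrK !mulf_eq0.
rewrite !intr_eq0 (negbTE n0) (gt_eqF pi0) pnatr_eq0 !orbF => /eqP ->.
by rewrite mul0r addr0.
Qed.

Let polar_inj (x y a b : R) : 0 < x -> 0 < y ->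
  x%:C * expi a = y%:C * expi b -> x = y /\ expi a = expi b.
Proof.
move=> x0 y0 h; have xy : x = y.
  by have := congr1 modulus h; rewrite !modulus_polar// ltW.
split => //; move: h; rewrite xy => /mulfI; apply.
by rewrite -modulus_gt0 modulus_real gtr0_norm.
Qed.

Lemma radial_extension_modulus z : exists2 t, z = (modulus z)%:C * expi t &
  w z = (modulus z * r (psi t))%:C * expi (psi t).
Proof.
have [t ht] := polar z; exists t => //.
rewrite {1}ht radial_extension_polar ?modulus_ge0// /P rmorphM /=; ring.
Qed.

Lemma radial_extension0 : w 0 = 0.
Proof.
have [t _ ->] := radial_extension_modulus 0.
by rewrite modulus0 !mul0r.
Qed.

Lemma radial_extension_inj : injective w.
Proof.
move=> z z'; have [t ht wz] := radial_extension_modulus z.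
have [t' ht' wz'] := radial_extension_modulus z'; rewrite wz wz' => h.
have rt := polar_gt0 r_polar (psi t); have rt' := polar_gt0 r_polar (psi t').
have h' := congr1 modulus h; move: h'; rewrite !modulus_polar; last 2 first.
- by rewrite mulr_ge0 ?modulus_ge0// ltW.
- by rewrite mulr_ge0 ?modulus_ge0// ltW.
move=> h'; have [z0|z0] := eqVneq z 0.
  move: h'; rewrite z0 modulus0 mul0r => /esym/eqP; rewrite mulf_eq0 (gt_eqF rt') orbF.
  by move=> /eqP/modulus0_eq0 ->.
have mz : 0 < modulus z by rewrite modulus_gt0.
have mz' : 0 < modulus z'.
  by rewrite lt_def modulus_ge0 andbT; apply: contraTneq (mulr_gt0 mz rt) => e;
    rewrite h' e mul0r ltxx.
have [_ eab] := polar_inj (mulr_gt0 mz rt) (mulr_gt0 mz' rt') h.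
have rr : r (psi t) = r (psi t') by apply: (polar_of_expi r_polar).
have ett : expi t = expi t'.
  have [[_ ginj _] _ _] := G_homeo.
  apply: ginj; rewrite ?inE; [exact: circle_expi|exact: circle_expi|].
  by rewrite !G_expi /P rr eab.
rewrite ht ht' ett; congr (_%:C * _); move: h'; rewrite rr.
by apply: mulIf; rewrite gt_eqF.
Qed.

(** Every ray meets the curve, at the point [P s], which is a value of [G]. *)
Lemma radial_extension_surj y : exists z, w z = y.
Proof.
have [s hs] := polar y.
have [[_ _ gsurj] _ _] := G_homeo.
have [u hu Gu] := gsurj _ (polar_mem r_polar s).
have rs := polar_gt0 r_polar s.
exists ((modulus y / r s)%:C * u); rewrite /w /radial_extension.
have u1 : modulus u = 1 by exact: hu.
have l0 : 0 <= modulus y / r s by rewrite divr_ge0 ?modulus_ge0// ltW.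
rewrite normc_modulus modulusM u1 mulr1 modulus_real ger0_norm//.
have [y0|y0] := eqVneq y 0; first by rewrite y0 modulus0 mul0r mul0r.
have lp : 0 < modulus y / r s by rewrite divr_gt0// modulus_gt0.
rewrite mulrAC divff ?mul1r; last first.
  by rewrite -modulus_gt0 modulus_real gtr0_norm.
rewrite Gu [RHS]hs mulrA -rmorphM /= divfK//.
by rewrite gt_eqF.
Qed.

Lemma bilipschitz_restrict : bilipschitz distC distC setT w ->
  bilipschitz distC distC unit_circle G.
Proof.
move=> [l [L [lL H]]]; exists l, L; split => // x y x1 y1.
have wE z : unit_circle z -> w z = G z.
  move=> z1; rewrite /w /radial_extension normc_modulus.
  by rewrite (_ : modulus z = 1)// mul1r divr1.
by rewrite -!wE//; apply: H.
Qed.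

(** The velocity of [P] has modulus between [dist (gamma, 0)] and a finite bound,
    so locally chords of the curve are comparable to increments of [psi], as chords
    of the circle are to increments of [t]. *)
Lemma bilipschitz_phase : bilipschitz distC distC unit_circle G ->
  bilipschitz distR distR setT psi.
Proof.
move=> [l [L [/andP[l0 lL] H]]].
have L0 : 0 < L by apply: lt_le_trans lL.
have [B hB] := kappa_bounded gamma_smooth gamma_tangent r_polar.
have cr := polar_continuous gamma_smooth gamma_tangent r_polar.
have [s1 hM] := periodic_max cr (polar_periodic r_polar).
pose d := dist_to_origin gamma.
have d0 : 0 < d := dist_to_origin_gt0 gamma_smooth gamma_tangent r_polar.
have hd s : d <= r s by exact: dist_to_origin_le r_polar s.
pose N := r s1 * (1 + `|B|).
have r1 := polar_gt0 r_polar s1.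
have N0 : 0 < N by rewrite mulr_gt0// ltr_pwDl.
have dP s := polar_curve_derivable gamma_smooth gamma_tangent r_polar s.
have hP s : d <= modulus ((derive1 r s +i* r s) * expi s) <= N.
  rewrite modulusM modulus_expi mulr1; apply/andP; split.
    apply: le_trans (hd s) _; apply: le_trans (Im_le_modulus _).
    exact: ler_norm.
  apply: le_trans (modulus_le_sum _) _ => /=.
  have rs := polar_gt0 r_polar s.
  have -> : derive1 r s = kappa r s * r s by rewrite /kappa divfK// gt_eqF.
  rewrite normrM (gtr0_norm rs) -[X in _ + X]mul1r -mulrDl mulrC.
  apply: ler_pM; [exact: ltW|by rewrite addr_ge0|exact: hM|].
  by rewrite addrC lerD2l; apply: le_trans (hB s) (ler_norm _).
exists (l / (4 * N)), (4 * L / d).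
apply: bilipschitz_of_local => //.
- by rewrite divr_gt0// mulr_gt0.
- exact: phase_inj.
move=> t0; exists 1 => // t _ e e0.
have [d1' d1'0 h1'] := is_cderive_eps (is_cderive_expi t) (divr_gt0 (@ltr01 R) (ltr0n _ 2)).
(* an error [e2 |k|] in the expansion of the chord is absorbed by both bounds
   [d |k|] and [N |k|] of its linear part *)
pose e2 := Num.min (d / 2) N.
have e20 : 0 < e2 by rewrite lt_min divr_gt0.
have e2d : e2 <= d / 2 by rewrite ge_min lexx.
have e2N : e2 <= N by rewrite ge_min lexx orbT.
have [d2 d20 h2] := is_cderive_eps (dP (psi t)) e20.
have [d3 d30 h3] := continuous_eps psi_cont t d20.
exists (Num.min d1' d3); first by rewrite lt_min d1'0.
move=> h; rewrite lt_min => /and3P[h0 hd1' hd3].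
have habs : `|h| = h by rewrite gtr0_norm.
pose k := psi (t + h) - psi t.
have hk : `|k| < d2 by apply: h3; rewrite addrAC subrr add0r habs.
have [+ +] := H (expi (t + h)) (expi t) (circle_expi _) (circle_expi _).
rewrite /distC !G_expi.
have := h1' h; rewrite habs => /(_ hd1').
have := h2 k hk; rewrite [psi t + k]addrC subrK -/P.
set Pd := modulus _ ; set ed := modulus (expi (t + h) - expi t).
rewrite [X in X <= e2 * _](_ : _ = modulus ((P (psi (t + h)) - P (psi t)) -
  k%:C * ((derive1 r (psi t) +i* r (psi t)) * expi (psi t))))// => hPk hek hl hu.
have eD : modulus (h%:C * ('i%C * expi t)) = h.
  rewrite modulusM modulus_real modulusM modulus_expi habs mulr1.
  by rewrite /modulus /= expr0n /= expr1n add0r sqrtr1 mulr1.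
have e1 : ed <= h * 2 /\ h / 2 <= ed.
  have t1 := modulus_dist (expi (t + h) - expi t) (h%:C * ('i%C * expi t)).
  move: (le_trans t1 hek); rewrite eD -/ed ler_norml => /andP[a1 a2].
  exact: half_error a1 a2.
have /andP[p1 p2] := hP (psi t).
set Q := (_ +i* _) * expi (psi t) in hPk p1 p2.
have t2 := le_trans (modulus_dist _ _) hPk.
rewrite modulusM modulus_real ler_norml in t2.
move: t2 => /andP[b1 b2].
set D := modulus (P (psi (t + h)) - P (psi t)) in hl hu b1 b2.
have k0 := normr_ge0 k.
have c1 : `|k| * d <= `|k| * modulus Q by rewrite ler_wpM2l.
have c2 : `|k| * modulus Q <= `|k| * N by rewrite ler_wpM2l.
have c3 : e2 * `|k| <= d / 2 * `|k| by rewrite ler_wpM2r.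
have c4 : e2 * `|k| <= N * `|k| by rewrite ler_wpM2r.
have [e11 e12] := e1.
have c5 : l * (h / 2) <= l * ed by rewrite ler_wpM2l// ltW.
have c6 : L * ed <= L * (h * 2) by rewrite ler_wpM2l// ltW.
have lo : l / (4 * N) * h <= `|k|.
  by rewrite mulrAC ler_pdivrMr ?mulr_gt0//; exact: lower_chain c2 c4 c5 hl b2.
have up : `|k| <= 4 * L / d * h.
  by rewrite [4 * L / d * h]mulrAC ler_pdivlMr//; exact: upper_chain c1 c3 c6 hu b1.
have eh : 0 <= e * h by rewrite mulr_ge0// ltW.
split; first by apply: le_trans lo; rewrite mulrBl lerBlDr lerDl.
by apply: le_trans up _; rewrite [leRHS]mulrDl lerDl.
Qed.

End Radial_map.

(** * Singular values and the constants of the theorem *)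

Section Singular_values.
Context {R : realType}.
Implicit Types (V L s q x y k M d r : R).

Lemma quadratic_ge0 (A B c x k : R) : 0 <= A -> 0 <= B -> c ^+ 2 <= A * B ->
  0 <= A * x ^+ 2 - 2 * c * x * k + B * k ^+ 2.
Proof.
move=> A0 B0 cAB; have [A1|A1] := eqVneq A 0.
  have : c = 0.
    by apply/eqP; rewrite -sqrf_eq0 eq_le sqr_ge0 andbT (le_trans cAB)// A1 mul0r.
  by move=> ->; rewrite A1 mulr0 !mul0r subr0 add0r mulr_ge0// sqr_ge0.
have Ap : 0 < A by rewrite lt_def A1.
rewrite -(pmulr_rge0 _ Ap).
have -> : A * (A * x ^+ 2 - 2 * c * x * k + B * k ^+ 2) =
  (A * x - c * k) ^+ 2 + (A * B - c ^+ 2) * k ^+ 2 by ring.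
by rewrite addr_ge0 ?sqr_ge0// mulr_ge0 ?sqr_ge0// subr_ge0.
Qed.

(** [L ^+ 2 <= V] and the quadratic relation say that [V] is the square of the
    larger singular value of [[1, L q], [0, L]], where
    [q ^ 2 = 1 / s ^ 2 - 1] is the largest possible [kappa ^ 2]. *)
Definition maximal_stretch V L s :=
  [/\ 1 <= L, L ^+ 2 <= V, 0 < s, s <= 1 &
      (V - 1) * (V - L ^+ 2) * s ^+ 2 = V * L ^+ 2 * (1 - s ^+ 2)].

(** The conditions under which the two quadratic forms below are nonnegative,
    expressed by [q]; the defining relation is the case of equality for the largest
    possible [q ^ 2]. *)
Lemma maximal_stretchP V L s q : maximal_stretch V L s ->
  s ^+ 2 * (1 + q ^+ 2) <= 1 ->
  [/\ 1 <= V, V * L ^+ 2 * q ^+ 2 <= (V - 1) * (V - L ^+ 2) &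
      L ^+ 2 * q ^+ 2 <= V - L ^+ 2].
Proof.
move=> [L1 LV s0 s1 E] hq.
have L2 : 1 <= L ^+ 2 by rewrite expr_ge1// (le_trans ler01).
have V1 : 1 <= V by apply: le_trans LV.
have s2 : 0 < s ^+ 2 by rewrite exprn_gt0.
have V0 : 0 < V by apply: lt_le_trans V1.
have key : V * L ^+ 2 * q ^+ 2 <= (V - 1) * (V - L ^+ 2).
  rewrite -(ler_pM2r s2) E -subr_ge0.
  have -> : V * L ^+ 2 * (1 - s ^+ 2) - V * L ^+ 2 * q ^+ 2 * s ^+ 2 =
    (V * L ^+ 2) * (1 - s ^+ 2 * (1 + q ^+ 2)) by ring.
  by rewrite mulr_ge0 ?subr_ge0// mulr_ge0 ?sqr_ge0// ltW.
split => //.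
rewrite -(ler_pM2l V0) mulrA (le_trans key)// ler_wpM2r ?subr_ge0//.
by rewrite lerBlDr lerDl.
Qed.

(** With [k ^ 2 <= L ^ 2 y ^ 2] inserted, the claim is that a quadratic form in
    [(x, k)] is nonnegative; its discriminant is the second bound of
    [maximal_stretchP]. *)
Lemma stretch_upper V L s q x y k : maximal_stretch V L s ->
  s ^+ 2 * (1 + q ^+ 2) <= 1 -> k ^+ 2 <= L ^+ 2 * y ^+ 2 ->
  (x + k * q) ^+ 2 + k ^+ 2 <= V * (x ^+ 2 + y ^+ 2).
Proof.
move=> hV hq ky; have [V1 h1 h2] := maximal_stretchP hV hq.
have [L1 LV _ _ _] := hV.
have L2 : 0 < L ^+ 2 by rewrite exprn_gt0// (lt_le_trans ltr01).
have V0 : 0 <= V by apply: le_trans V1.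
have : V * k ^+ 2 <= V * (L ^+ 2 * y ^+ 2) by rewrite ler_wpM2l.
have := @quadratic_ge0 (L ^+ 2 * (V - 1)) (V - L ^+ 2 - L ^+ 2 * q ^+ 2) (L ^+ 2 * q) x k.
have -> : (L ^+ 2 * q) ^+ 2 = L ^+ 2 * (L ^+ 2 * q ^+ 2) by ring.
rewrite -mulrA ler_pM2l// => /(_ _ _ _)/= Q.
have {Q} : 0 <= L ^+ 2 * (V - 1) * x ^+ 2 - 2 * (L ^+ 2 * q) * x * k +
    (V - L ^+ 2 - L ^+ 2 * q ^+ 2) * k ^+ 2.
  apply: Q.
  - by rewrite mulr_ge0 ?subr_ge0// ltW.
  - by rewrite subr_ge0.
  - by move: h1; lra.
move=> Q K; rewrite -(ler_pM2l L2) -subr_ge0.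
by move: Q K; lra.
Qed.

(** The determinant of [[1, L^-1 q], [0, L^-1]] is [1 / L] and its
    largest singular value at most [sqrt V], so that the smallest stretching
    is at least [1 / (L sqrt V)]; in terms of [z = x + k q] this is again
    a discriminant computation. *)
Lemma stretch_lower V L s q x y k : maximal_stretch V L s ->
  s ^+ 2 * (1 + q ^+ 2) <= 1 -> y ^+ 2 <= L ^+ 2 * k ^+ 2 ->
  x ^+ 2 + y ^+ 2 <= L ^+ 2 * V * ((x + k * q) ^+ 2 + k ^+ 2).
Proof.
move=> hV hq ky; have [V1 h1 h2] := maximal_stretchP hV hq.
have [L1 LV _ _ _] := hV.
have L2 : 1 <= L ^+ 2 by rewrite expr_ge1// (le_trans ler01).
have L20 : 0 < L ^+ 2 by apply: lt_le_trans L2.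
set z := x + k * q; have -> : x = z - k * q by rewrite /z addrK.
have LV1 : 1 <= L ^+ 2 * V by rewrite -[1]mulr1 ler_pM.
have q2 : q ^+ 2 <= L ^+ 2 * q ^+ 2 by rewrite ler_peMl ?sqr_ge0.
have LL : L ^+ 2 <= L ^+ 2 * L ^+ 2 by rewrite ler_peMl// ltW.
have V1' : V - 1 <= L ^+ 2 * (V - 1) by rewrite ler_peMl// subr_ge0.
have := @quadratic_ge0 (L ^+ 2 * V - 1) (L ^+ 2 * V - L ^+ 2 - q ^+ 2) (- q) z k.
rewrite sqrrN => /(_ _ _ _)/= Q.
have {Q} : 0 <= (L ^+ 2 * V - 1) * z ^+ 2 - 2 * (- q) * z * k +
  (L ^+ 2 * V - L ^+ 2 - q ^+ 2) * k ^+ 2.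
  apply: Q; [by rewrite subr_ge0|by lra|].
  have e1 : 0 <= V - 1 by rewrite subr_ge0.
  have e2 : V - L ^+ 2 <= L ^+ 2 * (L ^+ 2 * V - 1).
    have : V <= L ^+ 2 * (L ^+ 2 * V).
      by rewrite mulrA ler_peMl ?(le_trans ler01 V1)// -[1]mulr1 ler_pM.
    by lra.
  have : (V - 1) * (V - L ^+ 2) <= (V - 1) * (L ^+ 2 * (L ^+ 2 * V - 1)).
    by rewrite ler_wpM2l.
  by move: h1; lra.
by move: ky; rewrite -subr_ge0; lra.
Qed.

(** The constant [upper_const M s L] is [M] times the largest singular value of the
    matrix of [maximal_stretch]: with [p] and [m] the two square roots, [p + m] and
    [m - p] are [2 s] times the two singular values. *)
Lemma upper_constE M L s : 1 <= L -> 0 < s <= 1 ->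
  exists V, [/\ 0 <= M -> upper_const M s L ^+ 2 = M ^+ 2 * V,
    maximal_stretch V L s & 0 < M -> 0 < upper_const M s L].
Proof.
move=> L1 /andP[s0 s1].
pose P := L ^+ 2 + s ^+ 2 * (1 - 2 * L).
pose N := L ^+ 2 + s ^+ 2 * (1 + 2 * L).
have s2 : s ^+ 2 <= 1 by rewrite expr_le1// ltW.
have s20 : 0 < s ^+ 2 by rewrite exprn_gt0.
have L2 : L <= L ^+ 2 by rewrite expr2 ler_peMl// (le_trans ler01).
have P0 : 0 <= P.
  have -> : P = (L - s ^+ 2) ^+ 2 + s ^+ 2 * (1 - s ^+ 2) by rewrite /P; ring.
  by rewrite addr_ge0 ?sqr_ge0// mulr_ge0 ?subr_ge0// ltW.
have N0 : 0 < N.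
  by rewrite /N ltr_wpDl ?sqr_ge0// mulr_gt0//; lra.
pose p := Num.sqrt P; pose m := Num.sqrt N.
have p0 : 0 <= p by exact: sqrtr_ge0.
have m0 : 0 < m by rewrite sqrtr_gt0.
have pp : p ^+ 2 = P by rewrite sqr_sqrtr.
have mm : m ^+ 2 = N by rewrite sqr_sqrtr// ltW.
exists (((p + m) / (2 * s)) ^+ 2).
have V4 : ((p + m) / (2 * s)) ^+ 2 * (2 * s ^+ 2) = L ^+ 2 + s ^+ 2 + p * m.
  have -> : ((p + m) / (2 * s)) ^+ 2 * (2 * s ^+ 2) = (p ^+ 2 + m ^+ 2) / 2 + p * m.
    by field; rewrite gt_eqF.
  by rewrite pp mm /P /N; field.
set V := _ ^+ 2 in V4 *.
have pm2 : (p * m) ^+ 2 = (L ^+ 2 + s ^+ 2) ^+ 2 - 4 * s ^+ 2 * s ^+ 2 * L ^+ 2.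
  by rewrite exprMn pp mm /P /N; ring.
split.
- by move=> _; rewrite /upper_const -/P -/N -/p -/m /V; field; rewrite gt_eqF.
- split => //.
    (* this is [L ^ 2 <= V] after multiplication by [2 s ^ 2] *)
    have pmge : 2 * s ^+ 2 * L ^+ 2 - L ^+ 2 - s ^+ 2 <= p * m.
      have pm0 : 0 <= p * m by rewrite mulr_ge0// ltW.
      have [neg|pos] := leP (2 * s ^+ 2 * L ^+ 2 - L ^+ 2 - s ^+ 2) 0.
        exact: le_trans neg pm0.
      rewrite -ler_sqr ?nnegrE// ?(ltW pos)// pm2 -subr_ge0.
      have -> : (L ^+ 2 + s ^+ 2) ^+ 2 - 4 * s ^+ 2 * s ^+ 2 * L ^+ 2 -
        (2 * s ^+ 2 * L ^+ 2 - L ^+ 2 - s ^+ 2) ^+ 2 =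
        4 * s ^+ 2 * (L ^+ 2) ^+ 2 * (1 - s ^+ 2) by ring.
      by rewrite mulr_ge0 ?subr_ge0// mulr_ge0 ?sqr_ge0// mulr_ge0// ltW.
    have s4 : 0 < 2 * s ^+ 2 by rewrite mulr_gt0.
    by rewrite -(ler_pM2r s4) V4; move: pmge; lra.
  have E : (V * (2 * s ^+ 2) - (L ^+ 2 + s ^+ 2)) ^+ 2 =
     (L ^+ 2 + s ^+ 2) ^+ 2 - 4 * s ^+ 2 * s ^+ 2 * L ^+ 2.
    by rewrite V4 -pm2; congr (_ ^+ 2); ring.
  have n4 : 4 * s ^+ 2 != 0 by rewrite mulf_neq0// gt_eqF.
  apply: (mulfI n4); apply/eqP; rewrite -subr_eq0; apply/eqP.
  have -> : 4 * s ^+ 2 * ((V - 1) * (V - L ^+ 2) * s ^+ 2) -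
    4 * s ^+ 2 * (V * L ^+ 2 * (1 - s ^+ 2)) =
    (V * (2 * s ^+ 2) - (L ^+ 2 + s ^+ 2)) ^+ 2 -
    ((L ^+ 2 + s ^+ 2) ^+ 2 - 4 * s ^+ 2 * s ^+ 2 * L ^+ 2) by ring.
  by rewrite E subrr.
- move=> M0; rewrite /upper_const -/P -/N -/p -/m mulr_gt0//.
    by rewrite divr_gt0// mulr_gt0.
  by rewrite ltr_wpDl.
Qed.

(** [x] and [y] are the radial and angular components of a displacement, [k] is
    the image of the angular one under the phase, and [q] stands for [kappa]. Since
    [r] varies between [d] and [M], the lower constant loses [d ^ 2 / (r M)]. *)
Lemma distortion_bounds M d r L s q x y k : 1 <= L -> 0 < s <= 1 ->
  s ^+ 2 * (1 + q ^+ 2) <= 1 -> 0 < d -> d <= r -> r <= M ->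
  k ^+ 2 <= L ^+ 2 * y ^+ 2 -> y ^+ 2 <= L ^+ 2 * k ^+ 2 ->
  r ^+ 2 * ((x + k * q) ^+ 2 + k ^+ 2) <= upper_const M s L ^+ 2 * (x ^+ 2 + y ^+ 2) /\
  lower_const d M s L ^+ 2 * (x ^+ 2 + y ^+ 2) <= r ^+ 2 * ((x + k * q) ^+ 2 + k ^+ 2).
Proof.
move=> L1 s01 hq d0 dr rM ky yk.
have r0 : 0 < r by apply: lt_le_trans dr.
have M0 : 0 < M by apply: lt_le_trans rM.
have [V [UE hV U0]] := upper_constE M L1 s01.
have {}UE := UE (ltW M0); have {}U0 := U0 M0.
have [V1 _ _] := maximal_stretchP hV hq.
have V0 : 0 < V by apply: lt_le_trans V1.
have L0 : 0 < L by apply: lt_le_trans L1.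
have r2 : 0 < r ^+ 2 by rewrite exprn_gt0.
have M2 : r ^+ 2 <= M ^+ 2 by rewrite ler_sqr ?nnegrE// ltW.
have d2 : d ^+ 2 <= r ^+ 2 by rewrite ler_sqr ?nnegrE// ltW.
split.
  apply: le_trans (ler_wpM2l (ltW r2) (stretch_upper x hV hq ky)) _.
  by rewrite UE mulrA ler_wpM2r ?addr_ge0 ?sqr_ge0// ler_wpM2r// ltW.
(* [d ^ 4 <= r ^ 2 M ^ 2] since [d <= r <= M] *)
have low := stretch_lower x hV hq yk.
have -> : lower_const d M s L ^+ 2 = (d ^+ 2) ^+ 2 / (L ^+ 2 * (M ^+ 2 * V)).
  by rewrite -UE /lower_const -exprMn -expr_div_n.
have den : 0 < L ^+ 2 * (M ^+ 2 * V) by rewrite !mulr_gt0// exprn_gt0.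
rewrite mulrAC ler_pdivrMr//.
apply: le_trans (ler_wpM2l (sqr_ge0 _) low) _.
set Q := (x + _) ^+ 2 + _.
have Q0 : 0 <= Q by rewrite addr_ge0 ?sqr_ge0.
have -> : (d ^+ 2) ^+ 2 * (L ^+ 2 * V * Q) = (d ^+ 2 * d ^+ 2) * (L ^+ 2 * V * Q).
  by rewrite -expr2.
have -> : r ^+ 2 * Q * (L ^+ 2 * (M ^+ 2 * V)) = (r ^+ 2 * M ^+ 2) * (L ^+ 2 * V * Q) by ring.
apply: ler_wpM2r; first by rewrite !mulr_ge0 ?sqr_ge0// ltW.
by apply: ler_pM; rewrite ?sqr_ge0//; apply: le_trans M2.
Qed.

Lemma lower_const_gt0 M d L s : 1 <= L -> 0 < s <= 1 -> 0 < d -> 0 < M ->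
  0 < lower_const d M s L.
Proof.
move=> L1 s01 d0 M0; have [V [_ _ U0]] := upper_constE M L1 s01.
by rewrite divr_gt0 ?exprn_gt0// mulr_gt0 ?U0// (lt_le_trans ltr01).
Qed.

Lemma upper_const_gt0 M L s : 1 <= L -> 0 < s <= 1 -> 0 < M ->
  0 < upper_const M s L.
Proof. by move=> L1 s01 M0; have [V [_ _ U0]] := upper_constE M L1 s01; exact: U0. Qed.

End Singular_values.

(** * Bi-Lipschitz bounds for the radial extension *)

Section Distortion.
Context {R : realType}.

Lemma le_of_sqr (x y : R) : 0 <= y -> x ^+ 2 <= y ^+ 2 -> x <= y.
Proof.
move=> y0; rewrite -(real_normK (num_real x)) ler_sqr ?nnegrE//.
exact: le_trans (ler_norm x).
Qed.

(** First-order expansion of the map [(lam, t) |-> lam Q t]. The second-order term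
    [x * (Q (t + h) - Q t)] is small because [Q] is continuous. *)
Lemma polar_increment (Q : R -> R[i]) (t lam : R) (l : R[i]) : 0 < lam ->
  is_cderive Q t l -> forall e : R, 0 < e -> exists2 d : R, 0 < d &
    forall x h : R, `|x| < d -> `|h| < d ->
    modulus ((lam + x)%:C * Q (t + h) - lam%:C * Q t - (x%:C * Q t + (lam * h)%:C * l))
      <= e * (`|x| + `|h|).
Proof.
move=> l0 dQ e e0.
have [d1 d10 h1] := is_cderive_eps dQ (divr_gt0 e0 l0).
have [d2 d20 h2] := is_cderive_continuous dQ e0.
exists (Num.min d1 d2); first by rewrite lt_min d10.
move=> x h _; rewrite lt_min => /andP[/h1 a1 hd2].
have a2 : modulus (Q (t + h) - Q t) < e by apply: h2; rewrite addrAC subrr add0r.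
have -> : (lam + x)%:C * Q (t + h) - lam%:C * Q t - (x%:C * Q t + (lam * h)%:C * l) =
  lam%:C * (Q (t + h) - Q t - h%:C * l) + x%:C * (Q (t + h) - Q t).
  by rewrite rmorphD rmorphM /=; ring.
apply: le_trans (modulusD _ _) _; rewrite !modulusM !modulus_real (gtr0_norm l0).
rewrite mulrDr addrC; apply: lerD; first by rewrite mulrC ler_wpM2r// ltW.
rewrite -ler_pdivlMl// [leRHS]mulrCA; apply: le_trans a1 _.
by rewrite mulrA.
Qed.

Context (r psi : R -> R) (w : R[i] -> R[i]) (M d L s : R).
Let P u := (r u)%:C * expi u.
Context (dP : forall u, is_cderive P u ((derive1 r u +i* r u) * expi u))
  (cr : continuous r) (d_gt0 : 0 < d)
  (hk : forall u, s ^+ 2 * (1 + kappa r u ^+ 2) <= 1) (s01 : 0 < s <= 1)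
  (psi_cont : continuous psi)
  (psiL : bilipschitz_const distR distR setT L psi)
  (r_ge : forall u, d <= r u) (r_le : forall t, r (psi t) <= M)
  (w_polar : forall lam t, 0 <= lam -> w (lam%:C * expi t) = lam%:C * P (psi t))
  (w_inj : injective w) (w_surj : forall y, exists z, w z = y).

Let l := lower_const d M s L.
Let U := upper_const M s L.

Let r_gt0 u : 0 < r u. Proof. exact: lt_le_trans (r_ge u). Qed.
Let M_gt0 : 0 < M. Proof. exact: lt_le_trans (r_gt0 _) (r_le 0). Qed.

Lemma bilipschitz_const_ge1 : 1 <= L.
Proof.
have [/andP[h1 h2] _] := psiL; have L0 : 0 < L by rewrite -invr_gt0.
rewrite leNgt; apply/negP => h; have : 1 < L^-1 by rewrite invf_gt1.
by lra.
Qed.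
Let L1 := bilipschitz_const_ge1.
Let L0 : 0 < L. Proof. exact: lt_le_trans L1. Qed.

Let psi_up t t' : `|psi t' - psi t| <= L * `|t' - t|.
Proof. by have [] := bilipschitzR_ge psiL t' t. Qed.

Let psi_lo t t' : `|t' - t| <= L * `|psi t' - psi t|.
Proof.
have [h _] := bilipschitzR_ge psiL t' t.
by rewrite -ler_pdivrMl.
Qed.

Let l_gt0 : 0 < l. Proof. exact: lower_const_gt0. Qed.
Let U_gt0 : 0 < U. Proof. exact: upper_const_gt0. Qed.

(** To first order, the displacement [z' - z] has polar components [x] and
    [lam * h], and [w] maps it to a displacement whose length is the one that
    [distortion_bounds] compares with [n]. *)
Lemma radial_local_distortion (lam t eta : R) : 0 < lam -> 0 < eta ->
  exists2 de : R, 0 < de & forall z', modulus (z' - lam%:C * expi t) < de ->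
    exists n : R, [/\ 0 <= n,
      `|modulus (z' - lam%:C * expi t) - n| <= eta * n,
      (l - eta) * n <= modulus (w z' - w (lam%:C * expi t)) &
      modulus (w z' - w (lam%:C * expi t)) <= (U + eta) * n].
Proof.
move=> l0 e0; set z := lam%:C * expi t; set u := psi t.
(* [|x| <= n] and [|h|, |k| <= L n / lam], so first-order errors of relative
   size [eta / c] are at most [eta n] *)
pose c := 1 + L / lam.
have c0 : 0 < c by rewrite addr_gt0// divr_gt0.
have c1 : 1 + lam^-1 <= c by rewrite lerD2l -[leLHS]mul1r ler_wpM2r// invr_ge0 ltW.
have [d1 d10 h1] := polar_increment l0 (is_cderive_expi t) (divr_gt0 e0 c0).
have [d2 d20 h2] := polar_increment l0 (dP u) (divr_gt0 e0 c0).
pose d12 := Num.min d1 d2.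
have d120 : 0 < d12 by rewrite lt_min d10.
have [d3 d30 h3] := @polar_local R lam t l0 (Num.min d12 (d12 / L))
  ltac:(by rewrite lt_min d120 divr_gt0).
exists (Num.min d3 d12); first by rewrite lt_min d30.
move=> z'; rewrite lt_min => /andP[/h3 [t' [+ ez']] zd].
rewrite lt_min => /andP[ht1 ht2].
set lam' := modulus z' in ez'.
pose x := lam' - lam; pose h := t' - t; pose k := psi t' - psi t.
have xd : `|x| < d12.
  apply: le_lt_trans zd; rewrite /x.
  by have := modulus_dist z' z; rewrite [modulus z]modulus_polar// ltW.
have kL : `|k| <= L * `|h| by exact: psi_up.
have kd : `|k| < d12 by apply: le_lt_trans kL _; rewrite mulrC -ltr_pdivlMr.
have hL : `|h| <= L * `|k| by exact: psi_lo.
pose n := Num.sqrt (x ^+ 2 + (lam * h) ^+ 2).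
have n0 : 0 <= n by exact: sqrtr_ge0.
have n2 : n ^+ 2 = x ^+ 2 + (lam * h) ^+ 2 by rewrite sqr_sqrtr// addr_ge0 ?sqr_ge0.
have xn : `|x| <= n.
  by rewrite -ler_sqr ?nnegrE// n2 real_normK ?num_real// lerDl sqr_ge0.
have hn : `|h| <= n / lam.
  rewrite ler_pdivlMr// mulrC -[X in X * _](gtr0_norm l0) -normrM.
  by rewrite -ler_sqr ?nnegrE// n2 real_normK ?num_real// lerDr sqr_ge0.
have errn (y : R) : `|y| <= L * `|h| -> eta / c * (`|x| + `|y|) <= eta * n.
  move=> yh; rewrite mulrAC ler_pdivrMr// -mulrA ler_wpM2l ?(ltW e0)//.
  rewrite /c mulrDr mulr1; apply: lerD => //; apply: le_trans yh _.
  by rewrite mulrCA ler_wpM2l ?(ltW L0).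
have lx : lam + x = lam' by rewrite /x addrC subrK.
pose A := x%:C * P u + (lam * k)%:C * ((derive1 r u +i* r u) * expi u).
have Hw : modulus (w z' - w z - A) <= eta * n.
  have := h2 x k; rewrite lx /k [u + _]addrC subrK -/P => H2.
  have -> : w z' = lam'%:C * P (psi t') by rewrite ez' w_polar// modulus_ge0.
  have -> : w z = lam%:C * P u by rewrite /z w_polar// ltW.
  apply: le_trans (H2 _ _) (errn k kL).
    by apply: lt_le_trans xd _; rewrite ge_min lexx orbT.
  by apply: lt_le_trans kd _; rewrite ge_min lexx orbT.
have A2 : modulus A ^+ 2 = r u ^+ 2 * ((x + lam * k * kappa r u) ^+ 2 + (lam * k) ^+ 2).
  have -> : A = ((r u * (x + lam * k * kappa r u)) +i* (r u * (lam * k))) * expi u.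
    have rn : r u != 0 by rewrite gt_eqF.
    by apply: complex_ext; rewrite /A /P /kappa !ReImE /=; field.
  by rewrite modulusM modulus_expi mulr1 modulus_sqr /=; ring.
have sq_le (a b : R) : `|a| <= L * `|b| -> (lam * a) ^+ 2 <= L ^+ 2 * (lam * b) ^+ 2.
  move=> ab; have -> : L ^+ 2 * (lam * b) ^+ 2 = (lam * (L * b)) ^+ 2 by ring.
  rewrite -(real_normK (num_real (lam * a))) -(real_normK (num_real (lam * (L * b)))).
  rewrite ler_sqr ?nnegrE// !(normrM lam) ler_wpM2l//.
  by rewrite normrM (gtr0_norm L0).
have [up lo] := distortion_bounds x L1 s01 (hk u) d_gt0 (r_ge u) (r_le t)
  (sq_le _ _ kL) (sq_le _ _ hL).
have := le_trans (modulus_dist _ _) Hw; rewrite ler_norml => /andP[b1 b2].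
exists n; split => //.
- have := h1 x h; rewrite lx /h [t + _]addrC subrK -ez' -/z => H1.
  have : modulus (z' - z - (x%:C * expi t + (lam * h)%:C * ('i%C * expi t))) <= eta * n.
    apply: le_trans (H1 _ _) (errn h _).
    - by apply: lt_le_trans xd _; rewrite ge_min lexx.
    - by apply: lt_le_trans ht1 _; rewrite ge_min lexx.
    - by rewrite ler_peMl.
  have nE : n = modulus (x%:C * expi t + (lam * h)%:C * ('i%C * expi t)).
    have -> : x%:C * expi t + (lam * h)%:C * ('i%C * expi t) = (x +i* (lam * h)) * expi t.
      by apply: complex_ext; rewrite !ReImE /=; ring.
    by rewrite modulusM modulus_expi mulr1.
  by apply: le_trans; rewrite {1}nE; exact: modulus_dist.
- have lA : l * n <= modulus A.
    by apply: le_of_sqr; rewrite ?modulus_ge0// exprMn n2 A2.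
  by rewrite mulrBl lerBlDr (le_trans lA)//; move: b1; rewrite lerBrDr addrC lerBlDr.
- have UA : modulus A <= U * n.
    by apply: le_of_sqr; [exact: mulr_ge0 (ltW U_gt0) n0|rewrite exprMn n2 A2].
  by rewrite mulrDl; move: b2; rewrite lerBlDl => /le_trans; apply; rewrite lerD2r.
Qed.

Let w_at (z : R[i]) : z != 0 -> exists2 t, 0 < modulus z & z = (modulus z)%:C * expi t.
Proof.
move=> z0; have [t ht] := polar z; exists t => //.
by rewrite modulus_gt0.
Qed.

Let w_local_upper z : z != 0 -> local_lipschitz_at w U z.
Proof.
move=> z0 e e0; have [t lam0 ht] := w_at z0.
pose eta := e / (1 + U + e).
have c0 : 0 < 1 + U + e by rewrite !addr_gt0.
have eta0 : 0 < eta by rewrite divr_gt0.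
have [de de0 hde] := radial_local_distortion t lam0 eta0; rewrite -ht in hde.
exists de => // z' /hde [n [n0 zn _ wn]]; apply: le_trans wn _.
have Ue : U + eta = (U + e) * (1 - eta) by rewrite /eta; field; rewrite gt_eqF.
rewrite Ue -mulrA; apply: ler_wpM2l; first by rewrite addr_ge0// ltW.
by move: zn; rewrite ler_norml => /andP[+ _]; rewrite mulrBl mul1r; lra.
Qed.

Let w_mod z : modulus (w z) <= M * modulus z.
Proof.
have [t ht] := polar z; rewrite {1}ht w_polar ?modulus_ge0//.
rewrite modulusM modulus_real ger0_norm ?modulus_ge0//.
by rewrite /P modulus_polar ?(ltW (r_gt0 _))// mulrC ler_wpM2r ?modulus_ge0.
Qed.

Let w_mod_ge z : d * modulus z <= modulus (w z).
Proof.
have [t ht] := polar z; rewrite {2}ht w_polar ?modulus_ge0//.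
rewrite modulusM modulus_real ger0_norm ?modulus_ge0//.
by rewrite /P modulus_polar ?(ltW (r_gt0 _))// mulrC ler_wpM2l ?modulus_ge0.
Qed.

Let w0 : w 0 = 0.
Proof.
apply: modulus0_eq0; apply: le_anti; rewrite modulus_ge0 andbT.
by have := w_mod 0; rewrite modulus0 mulr0.
Qed.

Lemma local_lipschitz_continuous (F : R[i] -> R[i]) (C : R) z : 0 <= C ->
  local_lipschitz_at F C z -> forall e : R, 0 < e -> exists2 de : R, 0 < de &
    forall z', modulus (z' - z) < de -> modulus (F z' - F z) < e.
Proof.
move=> C0 H e e0; have [de de0 hde] := H 1 ltr01.
have C1 : 0 < C + 1 by rewrite ltr_wpDl.
exists (Num.min de (e / (C + 1))); first by rewrite lt_min de0 divr_gt0.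
move=> z'; rewrite lt_min => /andP[/hde h1 h2]; apply: le_lt_trans h1 _.
by rewrite mulrC -ltr_pdivlMr.
Qed.

Let w_cont : eps_continuous w.
Proof.
move=> z; have [->|z0] := eqVneq z 0; last first.
  by apply: (@local_lipschitz_continuous _ U); [exact: ltW|exact: w_local_upper].
move=> e e0; exists (e / M); first exact: divr_gt0.
move=> z'; rewrite subr0 w0 subr0 ltr_pdivlMr// mulrC; exact: le_lt_trans (w_mod _).
Qed.

Let winv y := sval (cid (w_surj y)).
Let winvK y : w (winv y) = y. Proof. exact: svalP (cid (w_surj y)). Qed.

(** The inverse maps [mu e^(is)] to [mu / r s] times [e^(it)], where
    [psi t = s]; the phase [t] depends on [s] in an [L]-Lipschitz way. *)
Let winv_cont : eps_continuous winv.
Proof.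
move=> y e e0; have [y0|y0] := eqVneq y 0.
  exists (e * d); first exact: mulr_gt0.
  have i0 : winv y = 0 by apply: w_inj; rewrite winvK w0.
  move=> y'; rewrite i0 y0 !subr0.
  move=> h; rewrite -(ltr_pM2r d_gt0); apply: le_lt_trans h.
  by rewrite -{2}(winvK y') mulrC; exact: w_mod_ge.
set z := winv y; have z0 : z != 0.
  by apply: contraNneq y0 => z0; rewrite -(winvK y) -/z z0 w0.
have [t lam0 ht] := w_at z0; set lam := modulus z in lam0 ht.
set u := psi t.
have yE : y = (lam * r u)%:C * expi u.
  by rewrite -(winvK y) -/z ht w_polar ?(ltW lam0)// /P rmorphM /=; ring.
have lr0 : 0 < lam * r u by rewrite mulr_gt0.
pose e1 := e / 4; have e10 : 0 < e1 by rewrite divr_gt0.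
have [d1 d10 h1] := is_cderive_continuous (is_cderive_expi t) (divr_gt0 e10 lam0).
have [d2 d20 h2] := continuous_eps cr u (divr_gt0 (mulr_gt0 e10 d_gt0) lam0).
have [d3 d30 h3] := @polar_local R (lam * r u) u lr0 (Num.min d2 (d1 / L))
  ltac:(by rewrite lt_min d20 divr_gt0).
exists (Num.min d3 (e1 * d)); first by rewrite lt_min d30 mulr_gt0.
move=> y'; rewrite lt_min {1}yE => /andP[/h3 [s' [+ ey']] yd].
rewrite lt_min => /andP[s'2 s'1].
have [t' ht'] := bilipschitzR_surj psi_cont psiL s'.
have tt' : `|t' - t| < d1.
  by apply: le_lt_trans (psi_lo t t') _; rewrite ht' mulrC -ltr_pdivlMr.
pose lam' := modulus y' / r s'.
have lam'0 : 0 <= lam' by rewrite divr_ge0 ?modulus_ge0// ltW.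
have -> : winv y' = lam'%:C * expi t'.
  apply: w_inj; rewrite winvK w_polar// ht' {1}ey' /P /lam' mulrA -rmorphM /=.
  by rewrite divfK// gt_eqF.
have -> : lam'%:C * expi t' - z = (lam' - lam)%:C * expi t' + lam%:C * (expi t' - expi t).
  by rewrite {1}ht rmorphB /=; ring.
apply: le_lt_trans (modulusD _ _) _.
rewrite !modulusM !modulus_real modulus_expi mulr1 (gtr0_norm lam0).
have H1 : lam * modulus (expi t' - expi t) < e1.
  by rewrite mulrC -ltr_pdivlMr//; exact: h1.
have H2 : `|modulus y' - lam * r u| < e1 * d.
  apply: le_lt_trans yd; have := modulus_dist y' y.
  by rewrite [modulus y](_ : _ = lam * r u)// yE modulus_polar// ltW.
have H3 : lam * `|r s' - r u| < e1 * d by rewrite mulrC -ltr_pdivlMr//; exact: h2.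
have H4 : `|lam' - lam| * d <= `|modulus y' - lam * r u| + lam * `|r s' - r u|.
  apply: le_trans (_ : `|lam' - lam| * r s' <= _); first by rewrite ler_wpM2l.
  rewrite -[X in _ * X](gtr0_norm (r_gt0 s')) -normrM mulrBl /lam' divfK ?gt_eqF//.
  have -> : modulus y' - lam * r s' = (modulus y' - lam * r u) - lam * (r s' - r u) by ring.
  by apply: le_trans (ler_normB _ _) _; rewrite (normrM lam) (gtr0_norm lam0).
have H5 : `|lam' - lam| < 2 * e1.
  rewrite -(ltr_pM2r d_gt0); apply: le_lt_trans H4 _.
  by rewrite -mulrA mulr_natl mulr2n; exact: ltrD.
have -> : e = 4 * e1 by rewrite /e1; field.
by move: H1 H5; move: (modulus _) `|_| => a b; lra.
Qed.

(** To first order [w] expands by at least [l] around every point, and the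
    continuity of the inverse turns this into a bound near the image point. *)
Let winv_local_upper y : y != 0 -> local_lipschitz_at winv l^-1 y.
Proof.
move=> y0 e e0; set z := winv y; have z0 : z != 0.
  by apply: contraNneq y0 => z0; rewrite -(winvK y) -/z z0 w0.
have [t lam0 ht] := w_at z0.
(* this [eta] satisfies [1 + eta = (l^-1 + e) (l - eta)] *)
pose c := 1 + l^-1 + e.
have c0 : 0 < c by rewrite !addr_gt0// invr_gt0.
pose eta := e * l / c; have eta0 : 0 < eta by rewrite divr_gt0// mulr_gt0.
have [d1 d10 h1] := radial_local_distortion t lam0 eta0; rewrite -ht in h1.
have [d2 d20 h2] := winv_cont y d10.
exists d2 => // y' /h2 /h1 [n [n0 zn wn _]].
rewrite !winvK in wn.
have H : 1 + eta = (l^-1 + e) * (l - eta).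
  have e1 : eta * c = e * l by rewrite /eta divfK// gt_eqF.
  have e2 : l^-1 * l = 1 by rewrite mulVf// gt_eqF.
  have -> : (l^-1 + e) * (l - eta) = l^-1 * l + e * l - eta * (c - 1) by rewrite /c; ring.
  by rewrite e2 -e1; ring.
apply: le_trans (_ : _ <= (1 + eta) * n) _.
  by move: zn; rewrite ler_norml => /andP[_]; rewrite lerBlDl (mulrDl 1) mul1r.
by rewrite H -mulrA ler_wpM2l// addr_ge0 ?invr_ge0// ltW.
Qed.

(** The upper bound integrates the local distortion of [w], the lower one that of
    its inverse. *)
Lemma radial_bilipschitz : bilipschitz_with distC distC setT l U w.
Proof.
have up z0 z1 : modulus (w z1 - w z0) <= U * modulus (z1 - z0).
  by apply: lipschitz_of_local => // z zn0; exact: w_local_upper.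
have lo z0 z1 : l * modulus (z1 - z0) <= modulus (w z1 - w z0).
  rewrite -ler_pdivlMl//.
  have h : w (winv (w z0)) = w z0 by exact: winvK.
  have := @lipschitz_of_local R winv l^-1 winv_cont winv_local_upper (w z0) (w z1).
  by rewrite (w_inj h) (w_inj (winvK (w z1))).
split; last by move=> x y _ _; rewrite /distC.
rewrite l_gt0 /=; have := le_trans (lo 0 1) (up 0 1).
by rewrite subr0 -[1](@expi0 R) modulus_expi !mulr1.
Qed.

End Distortion.

(** * Almost everywhere differentiability of Lipschitz functions *)

Section Lipschitz_derivative.
Context {R : realType}.
Notation mu := (@lebesgue_measure R).
Local Open Scope ereal_scope.

Section Stieltjes.
Context (g : R -> R) (K : R) (K0 : (0 < K)%R)
  (g_nd : {homo g : x y / (x <= y)%R})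
  (g_lip : forall x y, (x <= y)%R -> (g y - g x <= K * (y - x))%R).

Let g_cont : continuous g.
Proof.
move=> x; apply/continuous_epsP => e e0; exists (e / K)%R; first exact: divr_gt0.
move=> y; rewrite ltr_pdivlMr//.
have [xy|/ltW yx] := leP x y.
  rewrite !ger0_norm ?subr_ge0 ?g_nd// mulrC; apply: le_lt_trans; exact: g_lip.
rewrite !ler0_norm ?subr_le0 ?g_nd// !opprB mulrC; apply: le_lt_trans; exact: g_lip.
Qed.

Let g_rc : right_continuous g.
Proof. exact: right_continuousW. Qed.

HB.instance Definition _ := isCumulative.Build R _ R g g_nd g_rc.

Let nu := lebesgue_stieltjes_measure g.

Let nu_oc (a b : R) : (a <= b)%R -> nu `]a, b]%classic = (g b - g a)%:E.
Proof.
move=> ab; rewrite /nu /lebesgue_stieltjes_measure /measure_extension/=.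
rewrite measurable_mu_extE//; last exact: is_ocitv.
exact: wlength_itv_bnd.
Qed.

(** Since [g] is [K]-Lipschitz, a covering by intervals of total length less than
    [e / K] has [nu]-measure less than [e]. *)
Let nu_dom (A : set R) : mu A = 0 -> nu A = 0.
Proof.
move=> A0; apply/eqP; rewrite eq_le measure_ge0 andbT.
apply/lee_addgt0Pr => e e0; rewrite add0e.
have eK : (0 < e / K)%R by exact: divr_gt0.
have : mu A < (e / K)%:E by rewrite A0 lte_fin.
rewrite /lebesgue_measure /measure_extension => /ereal_inf_lt [_ [B mB <-] Be].
apply: (@le_trans _ _ (\sum_(k <oo) wlength g (B k))).
  rewrite /nu /lebesgue_stieltjes_measure /measure_extension.
  by apply: ereal_inf_lbound; exists B.
apply: (@le_trans _ _ (\sum_(k <oo) K%:E * wlength idfun (B k))).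
  apply: lee_nneseries => [k _ _|k _]; first exact: wlength_ge0.
  have [mBk _] := mB; have := mBk k; rewrite /measurable/= => /ocitvP [->|[x x12 ->]].
    by rewrite wlength0 wlength0 mule0.
  rewrite !wlength_itv_bnd ?(ltW x12)// -EFinM lee_fin.
  by apply: g_lip; exact: ltW.
rewrite nneseriesZl; last by move=> k _; exact: (wlength_ge0 idfun).
rewrite -lee_pdivlMl// -EFinM mulrC; exact: ltW.
Qed.

(** The Radon-Nikodym density of the Stieltjes measure of [g] integrates to [g],
    and [g] is differentiable at its Lebesgue points. *)
Lemma nondecreasing_lipschitz_density (a b : R) : (a < b)%R ->
  exists h : R -> R, [/\ mu.-integrable setT (EFin \o h),
    (forall x, (a <= x <= b)%R -> (\int[mu]_(t in `]a, x]) h t)%R = (g x - g a)%R) &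
    {ae mu, forall x, (a < x < b)%R -> is_derive x 1%R g (h x)}].
Proof.
move=> ab; pose D : set (measurableTypeR R) := `]a, b]%classic.
have mD : measurable D by exact: measurable_itv.
have Doo : nu D < +oo by rewrite /D nu_oc ?ltry// ltW.
pose nuD : {finite_measure set (measurableTypeR R) -> \bar R} := mfrestr mD Doo.
have dom : nuD `<< mu.
  move=> A A0 B mB BA; rewrite /nuD /= /mfrestr /mrestr; apply: nu_dom.
  by apply: A0; [exact: measurableI|move=> x [/BA]].
have [f [f0 ffin intf fE]] := radon_nikodym_sigma_finite dom.
pose h x := fine (f x).
have hf : EFin \o h = f by apply/funext => x /=; rewrite /h fineK.
have inth : mu.-integrable setT (EFin \o h) by rewrite hf.
have hE x : (a <= x <= b)%R -> (\int[mu]_(t in `]a, x]) h t)%R = (g x - g a)%R.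
  move=> /andP[ax xb]; rewrite /Rintegral -[X in fine (integral _ _ X)]/(EFin \o h) hf.
  rewrite -fE// /nuD/= /mfrestr /mrestr.
  have -> : `]a, x]%classic `&` D = `]a, x]%classic.
    apply/seteqP; split => [y []//|y yx]; split => //.
    by move: yx; rewrite /D/= !in_itv/= => /andP[->/=] /le_trans; apply.
  by rewrite [X in fine X](nu_oc ax).
exists h; split => //.
have locf : locally_integrable [set: R] h by apply: open_integrable_locally => //; exact: openT.
have intfy y : mu.-integrable [set` Interval (BRight a) (BRight y)] (EFin \o h).
  by apply: integrableS inth.
have := @FTC1 R h (BRight a) intfy locf.
apply: filterS => [|x + /andP[ax xb]]; first exact: (ae_filter_ringOfSetsType mu).
rewrite /= lte_fin => /(_ ax) [dx dE].
have d1 : is_derive x 1%R (fun y => \int[mu]_(t in `]a, y]) h t)%R (h x).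
  by split; [exact: dx|rewrite -derive1E; exact: dE].
have dlt : (0 < Num.min (x - a) (b - x))%R by rewrite lt_min !subr_gt0 ax.
apply: (is_derive_near dlt _ (is_deriveDc1 (g a) d1)).
move=> u; rewrite lt_min => /andP[u1 u2].
rewrite hE; first by rewrite addrC subrK.
by move: u1 u2; rewrite !ltr_norml => /andP[? ?] /andP[? ?]; apply/andP; split; lra.
Qed.

End Stieltjes.

(** Adding a linear function makes a Lipschitz function monotone; the measure
    with distribution function [F x + (C + 1) * x] has a density with respect
    to the Lebesgue measure, and almost every point is a Lebesgue point of it. *)
Lemma lipschitz_ae_derivable (F : R -> R) (C : R) :
  (forall x y, `|F x - F y| <= C * `|x - y|)%R ->
  forall a b : R, (a < b)%R -> exists h : R -> R,
  [/\ mu.-integrable `[a, b] (EFin \o h),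
    (\int[mu]_(t in `[a, b]) h t)%R = (F b - F a)%R &
    {ae mu, forall x, (a < x < b)%R -> is_derive x 1%R F (h x)}].
Proof.
move=> lF a b ab.
have C0 : (0 <= C)%R.
  have := le_trans (normr_ge0 _) (lF b a).
  by rewrite pmulr_lge0// normr_gt0 subr_eq0 gt_eqF.
pose g x := (F x + (C + 1) * x)%R.
have K0 : (0 < 2 * C + 1)%R by rewrite ltr_wpDl// mulr_ge0.
have Fxy x y : (x <= y)%R -> (- (C * (y - x)) <= F y - F x <= C * (y - x))%R.
  by move=> xy; have := lF y x; rewrite (ger0_norm (_ : 0 <= y - x)%R) ?subr_ge0// ler_norml.
have g_nd : {homo g : x y / (x <= y)%R}.
  move=> x y xy; rewrite -subr_ge0 /g; have /andP[h1 h2] := Fxy x y xy.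
  have : (0 <= y - x)%R by rewrite subr_ge0.
  by move: h1; lra.
have g_lip x y : (x <= y)%R -> (g y - g x <= (2 * C + 1) * (y - x))%R.
  by move=> xy; rewrite /g; have /andP[h1 h2] := Fxy x y xy; lra.
have [h [ih hE dh]] := nondecreasing_lipschitz_density K0 g_nd g_lip ab.
have ih' : mu.-integrable `[a, b] (EFin \o h) by apply: integrableS ih.
have ic : mu.-integrable `[a, b] (EFin \o (fun _ : R => (C + 1)%R)).
  apply: continuous_compact_integrable; first exact: segment_compact.
  exact: continuous_subspaceT (@cst_continuous _ _ _).
exists (fun x => h x - (C + 1))%R; split.
- by apply: (integrableB _ ih' ic).
- rewrite RintegralB// Rintegral_cst//= lebesgue_measure_itv/= lte_fin ab -EFinB/=.
  have -> : (\int[mu]_(t in `[a, b]) h t)%R = (g b - g a)%R.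
    rewrite -(hE b) ?lexx ?(ltW ab)//; symmetry; apply: Rintegral_itv_obnd_cbnd.
    by apply: integrableS ih.
  by rewrite /g; ring.
- apply: filterS dh => [|x hx /hx d1]; first exact: (ae_filter_ringOfSetsType mu).
  have := is_deriveB1 d1 (is_deriveZ1 (C + 1)%R (is_derive_id1 x)).
  rewrite mulr1; congr is_derive.
  by apply/funext => u; rewrite /g addrK.
Qed.

End Lipschitz_derivative.

(** * Smooth functions with prescribed support *)

Section Smooth_functions.
Context {R : realType}.
Implicit Types (f g : R -> R) (p q : {poly R}).

Fixpoint smooth_n (n : nat) f : Prop :=
  if n is m.+1 then exists g, (forall x : R, is_derive x 1 f (g x)) /\ smooth_n m g
  else continuous f.

Definition smooth f := forall n, smooth_n n f.

Lemma smooth_n_continuous n f : smooth_n n f -> continuous f.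
Proof.
by case: n => // n [g [dg _]] x; exact: is_derive_continuous (dg x).
Qed.

Lemma smooth_nW n f : smooth_n n.+1 f -> smooth_n n f.
Proof.
elim: n f => [|n IH] f; first exact: smooth_n_continuous.
by move=> [g [dg /IH sg]]; exists g.
Qed.

Lemma smooth_derivative f : smooth f ->
  exists g, (forall x : R, is_derive x 1 f (g x)) /\ smooth g.
Proof.
move=> sf; have [g [dg _]] := sf 1; exists g; split => // n.
have [g' [dg' sg']] := sf n.+1; suff -> : g = g' by [].
by apply/funext => x; exact: is_derive_unique (dg x) (dg' x).
Qed.

Lemma smooth_nD n f g : smooth_n n f -> smooth_n n g ->
  smooth_n n (fun x => f x + g x).
Proof.
elim: n f g => [|n IH] f g; first by move=> cf cg x; apply: cvgD; [exact: cf|exact: cg].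
move=> [f' [df sf]] [g' [dg sg]]; exists (fun x => f' x + g' x); split; last exact: IH.
by move=> x; exact: is_deriveD1.
Qed.

Lemma smooth_nM n f g : smooth_n n f -> smooth_n n g ->
  smooth_n n (fun x => f x * g x).
Proof.
elim: n f g => [|n IH] f g; first by move=> cf cg x; apply: cvgM; [exact: cf|exact: cg].
move=> sf sg; have [f' [df sf']] := sf; have [g' [dg sg']] := sg.
exists (fun x => f' x * g x + f x * g' x); split.
  by move=> x; exact: is_deriveM1.
by apply: smooth_nD; apply: IH => //; exact: smooth_nW.
Qed.

Lemma smooth_n_cst n (c : R) : smooth_n n (fun=> c).
Proof.
elim: n c => [|n IH] c; first exact: cst_continuous.
by exists (fun=> 0); split => // x; exact: is_derive_cst1.
Qed.

Lemma smooth_n_affine n f (a b : R) : smooth_n n f ->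
  smooth_n n (fun x => f (a * x + b)).
Proof.
elim: n f => [|n IH] f.
  move=> cf x; apply: continuous_comp; last exact: cf.
  by apply: cvgD; [apply: cvgM; [exact: cvg_cst|exact: cvg_id]|exact: cvg_cst].
move=> [f' [df sf]]; exists (fun x => a * f' (a * x + b)); split; last first.
  by apply: smooth_nM; [exact: smooth_n_cst|exact: IH].
move=> x; rewrite (mulrC a (f' _)).
apply: (@is_derive_comp1 _ f (fun x => a * x + b) x _ _ (df (a * x + b))).
apply: (is_derive_eqval (is_deriveD1 (is_deriveZ1 a (is_derive_id1 x)) (is_derive_cst1 x b))).
by rewrite mulr1 addr0.
Qed.

Lemma smooth_nV n f : (forall x, f x != 0) -> smooth_n n f ->
  smooth_n n (fun x => (f x)^-1).
Proof.
move=> f0; elim: n => [|n IH].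
  by move=> cf x; apply: cvgV => //; exact: cf.
move=> sf; have [f' [df sf']] := sf.
exists (fun x => (-1) * (f' x * ((f x)^-1 * (f x)^-1))); split.
  move=> x; apply: (is_derive_eqval (is_deriveV1 (f0 x) (df x))).
  by field; exact: f0.
apply: smooth_nM; first exact: smooth_n_cst.
by apply: smooth_nM => //; apply: smooth_nM; apply: IH; exact: smooth_nW.
Qed.

(** Every derivative of [exp (- 1 / x)] on the positive half-line is a
    polynomial in [1 / x] times that function. *)
Definition flat p (x : R) : R := if 0 < x then p.[x^-1] * expR (- x^-1) else 0.

(** Substituting [y = 1 / x], the exponential beats every power of [y]. *)
Lemma flat_small p : exists2 C : R, 0 <= C &
  forall x, 0 < x <= 1 -> `|flat p x| <= C * x ^+ 2.
Proof.
pose N := (size p).+2.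
pose A := \sum_(i < size p) `|p`_i|.
have A0 : 0 <= A by apply: sumr_ge0.
have pA (X : R) : 1 <= X -> `|p.[X]| <= A * X ^+ size p.
  move=> X1; rewrite horner_coef /A mulr_suml; apply: le_trans (ler_norm_sum _ _ _) _.
  apply: ler_sum => i _; rewrite normrM normrX (ger0_norm (le_trans ler01 X1)).
  by apply: ler_wpM2l => //; apply: ler_weXn2l => //; exact: ltnW.
exists (A * N%:R ^+ N); first by rewrite mulr_ge0// exprn_ge0.
move=> x /andP[x0 x1]; rewrite /flat x0.
set X := x^-1; have X1 : 1 <= X by rewrite invf_ge1.
have X0 : 0 < X by rewrite invr_gt0.
have eX : (X / N%:R) ^+ N <= expR X.
  have -> : expR X = expR (X / N%:R) ^+ N.
    by rewrite -expRM_natr divfK // pnatr_eq0.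
  rewrite lerXn2r ?nnegrE ?expR_ge0 ?divr_ge0// ?(ltW X0)//.
  by apply: le_trans (expR_ge1Dx _); rewrite lerDr.
have eXN : expR (- X) * X ^+ N <= N%:R ^+ N.
  rewrite expRN mulrC ler_pdivrMr ?expR_gt0//.
  move: eX; rewrite expr_div_n ler_pdivrMr ?exprn_gt0//; by rewrite mulrC.
rewrite normrM (ger0_norm (expR_ge0 _)).
apply: le_trans (ler_wpM2r (expR_ge0 _) (pA X X1)) _.
rewrite -2!mulrA ler_wpM2l//.
have -> : X ^+ size p = X ^+ N * x ^+ 2.
  have -> : X ^+ N = X ^+ size p * X ^+ 2 by rewrite /N -addn2 exprD.
  have Xx : X ^+ 2 * x ^+ 2 = 1 by rewrite -exprMn /X mulVf ?expr1n// gt_eqF.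
  by rewrite -mulrA Xx mulr1.
rewrite mulrAC ler_wpM2r ?sqr_ge0// mulrC; exact: eXN.
Qed.

(** At the origin the derivative vanishes by the quadratic bound of [flat_small];
    elsewhere it is the chain rule. *)
Lemma is_derive_flat p (x : R) :
  is_derive x 1 (flat p) (flat ('X^2 * (p - p^`())) x).
Proof.
have [x0|x0|x0] := ltgtP 0 x.
- have xn : x != 0 by rewrite gt_eqF.
  have dV : is_derive x 1 (fun y : R => y^-1) (- x ^- 2).
    apply: (is_derive_eqval (is_deriveV1 xn (is_derive_id1 x))).
    by rewrite mulN1r.
  have dp : is_derive x 1 (fun y : R => p.[y^-1]) (p^`().[x^-1] * (- x ^- 2)).
    apply: (is_derive_comp1 (f := fun y => p.[y]) _ dV).
    exact: is_derive_poly.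
  have dE : is_derive x 1 (fun y : R => expR (- y^-1)) (expR (- x^-1) * x ^- 2).
    apply: (is_derive_comp1 (f := expR) (g := fun y => - y^-1)).
    have := is_deriveZ1 (-1) dV; rewrite mulN1r opprK.
    by congr is_derive; apply/funext => u; rewrite mulN1r.
  apply: (is_derive_near x0 _ (is_derive_eqval (is_deriveM1 dp dE) _)).
    move=> u; rewrite ltr_norml => /andP[h _]; rewrite /flat ifT//; lra.
  rewrite /flat x0 hornerM hornerXn hornerD hornerN.
  by move: (expR _) p.[_] p^`().[_] => c a b; field; exact: xn.
- rewrite {2}/flat ltNge (ltW x0) /=.
  apply: (@is_derive_near _ (fun=> 0) _ x _ (- x) _ _ (is_derive_cst1 x 0)); first lra.
  move=> u; rewrite ltr_norml => /andP[_ h]; rewrite /flat ifF//.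
  by apply/negbTE; rewrite -leNgt; lra.
- rewrite -x0 {2}/flat ltxx; apply/is_derive_epsP => e e0.
  have [C C0 hC] := flat_small p.
  have C1 : 0 < C + 1 by rewrite ltr_wpDl.
  exists (Num.min 1 (e / (C + 1))); first by rewrite lt_min ltr01 divr_gt0.
  move=> h; rewrite add0r mul0r subr0 {2}/flat ltxx subr0 lt_min => /andP[h1 h2].
  have [hp|hn] := ltP 0 h; last first.
    by rewrite /flat ltNge hn /= normr0 mulr_ge0// ltW.
  rewrite gtr0_norm// in h1 h2 *.
  apply: le_trans (hC h _) _; first by rewrite hp ltW.
  rewrite expr2 mulrA ler_wpM2r ?(ltW hp)//.
  move: h2; rewrite ltr_pdivlMr// => h2; rewrite mulrC; lra.
Qed.

Lemma smooth_flat p : smooth (flat p).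
Proof.
move=> n; elim: n p => [|n IH] p.
  by move=> x; exact: is_derive_continuous (is_derive_flat p x).
by eexists; split; [exact: is_derive_flat|exact: IH].
Qed.

Lemma flat1_gt0 x : 0 < x -> 0 < flat 1 x.
Proof. by move=> x0; rewrite /flat x0 hornerC mul1r expR_gt0. Qed.

Lemma flat1_le0 x : x <= 0 -> flat 1 x = 0.
Proof. by move=> x0; rewrite /flat ltNge x0. Qed.

Lemma flat1_ge0 x : 0 <= flat 1 x.
Proof. by have [/flat1_gt0/ltW//|/flat1_le0 ->] := ltP 0 x. Qed.

Definition smooth_step (x : R) : R := flat 1 x / (flat 1 x + flat 1 (1 - x)).

Let step_den x : 0 < flat 1 x + flat 1 (1 - x).
Proof.
have [x0|x0] := ltP 0 x; first by rewrite ltr_wpDr ?flat1_ge0// flat1_gt0.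
by rewrite ltr_wpDl ?flat1_ge0// flat1_gt0//; lra.
Qed.

Lemma smooth_stepP : [/\ smooth smooth_step, forall x, 0 <= smooth_step x <= 1,
  forall x, x <= 0 -> smooth_step x = 0 & forall x, 1 <= x -> smooth_step x = 1].
Proof.
split.
- move=> n; rewrite /smooth_step; apply: smooth_nM; first exact: smooth_flat.
  apply: smooth_nV; first by move=> x; rewrite gt_eqF.
  apply: smooth_nD; first exact: smooth_flat.
  have -> : (fun x => flat 1 (1 - x)) = (fun x => flat 1 ((-1) * x + 1)).
    by apply/funext => x; rewrite mulN1r addrC.
  by apply: smooth_n_affine; exact: smooth_flat.
- move=> x; rewrite divr_ge0 ?flat1_ge0 ?(ltW (step_den _))//=.
  by rewrite ler_pdivrMr// mul1r lerDl flat1_ge0.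
- by move=> x x0; rewrite /smooth_step flat1_le0// mul0r.
- move=> x x1; rewrite /smooth_step [flat 1 (1 - x)]flat1_le0; last lra.
  by rewrite addr0 divff// gt_eqF// flat1_gt0// (lt_le_trans ltr01).
Qed.

End Smooth_functions.

Section Plane_derivatives.
Context {R : realType}.
Implicit Types (u : R * R -> R) (p : R * R).

Lemma is_derive_exP u p (l : R) :
  is_derive p ex u l <-> is_derive p.1 1 (fun x => u (x, p.2)) l.
Proof.
have E : (fun h : R => h^-1 *: ((u \o shift p) (h *: ex) - u p)) =
    (fun h : R => h^-1 *: (((fun x => u (x, p.2)) \o shift p.1) (h *: (1 : R)) - u (p.1, p.2))).
  apply/funext => h /=; congr (_ *: (u _ - u _)); case: p => a b /=; last by [].
  by congr pair; rewrite /= -?[h *: (0 : R)]/(h * 0) ?mulr0 ?add0r.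
split => -[dv <-]; first by split; [move: dv; rewrite /derivable E|rewrite /derive E].
by split; [rewrite /derivable E|rewrite /derive E].
Qed.

Lemma is_derive_eyP u p (l : R) :
  is_derive p ey u l <-> is_derive p.2 1 (fun y => u (p.1, y)) l.
Proof.
have E : (fun h : R => h^-1 *: ((u \o shift p) (h *: ey) - u p)) =
    (fun h : R => h^-1 *: (((fun y => u (p.1, y)) \o shift p.2) (h *: (1 : R)) - u (p.1, p.2))).
  apply/funext => h /=; congr (_ *: (u _ - u _)); case: p => a b /=; last by [].
  by congr pair; rewrite /= -?[h *: (0 : R)]/(h * 0) ?mulr0 ?add0r.
split => -[dv <-]; first by split; [move: dv; rewrite /derivable E|rewrite /derive E].
by split; [rewrite /derivable E|rewrite /derive E].
Qed.

Lemma product_continuous (a b : R -> R) : continuous a -> continuous b ->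
  continuous (fun p : R * R => a p.1 * b p.2).
Proof.
move=> ca cb p; apply: cvgM.
  by apply: continuous_comp; [exact: cvg_fst|exact: ca].
by apply: continuous_comp; [exact: cvg_snd|exact: cb].
Qed.

Lemma product_is_derive_ex (a b a' : R -> R) :
  (forall x : R, is_derive x 1 a (a' x)) -> forall p : R * R,
  is_derive p ex (fun p => a p.1 * b p.2) (a' p.1 * b p.2).
Proof. by move=> da p; apply/is_derive_exP; exact: (is_deriveZr1 (b p.2) (da p.1)). Qed.

Lemma product_is_derive_ey (a b b' : R -> R) :
  (forall x : R, is_derive x 1 b (b' x)) -> forall p : R * R,
  is_derive p ey (fun p => a p.1 * b p.2) (a p.1 * b' p.2).
Proof. by move=> da p; apply/is_derive_eyP; exact: (is_deriveZ1 (a p.1) (da p.2)). Qed.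

Lemma product_class_C (a b : R -> R) n : smooth a -> smooth b ->
  class_C n (fun p : R * R => a p.1 * b p.2).
Proof.
elim: n a b => [|n IH] a b sa sb.
  by split => //; apply: product_continuous; [exact: (sa 0)|exact: (sb 0)].
have [a' [da sa']] := smooth_derivative sa; have [b' [db sb']] := smooth_derivative sb.
have dx := product_is_derive_ex b da; have dy := product_is_derive_ey a db.
split; first by apply: product_continuous; [exact: (sa 0)|exact: (sb 0)].
split.
- by move=> p; have [] := dx p.
- by move=> p; have [] := dy p.
- have -> : 'D_ex (fun p : R * R => a p.1 * b p.2) = (fun p => a' p.1 * b p.2).
    by apply/funext => p; have [_] := dx p.
  exact: IH.
- have -> : 'D_ey (fun p : R * R => a p.1 * b p.2) = (fun p => a p.1 * b' p.2).
    by apply/funext => p; have [_] := dy p.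
  exact: IH.
Qed.

Lemma product_test_function (a b : R -> R) (a1 a2 b1 b2 : R) : smooth a -> smooth b ->
  (forall x, ~~ (a1 <= x <= a2) -> a x = 0) ->
  (forall x, ~~ (b1 <= x <= b2) -> b x = 0) ->
  test_function setT (fun p : R * R => a p.1 * b p.2).
Proof.
move=> sa sb az bz; split => //; first by move=> n; exact: product_class_C.
apply: (@subclosed_compact _ _ (`[a1, a2]%classic `*` `[b1, b2]%classic)).
- exact: closed_closure.
- by apply: compact_setX; exact: segment_compact.
- have cl : closed (`[a1, a2]%classic `*` `[b1, b2]%classic : set (R * R)).
    apply: compact_closed; first exact: norm_hausdorff.
    by apply: compact_setX; exact: segment_compact.
  rewrite [X in _ `<=` X]((closure_id _).1 cl).
  apply: closure_subset => p /= h; split => /=; rewrite in_itv/=; apply: contraNT h.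
    by move=> /az ->; rewrite mul0r.
  by move=> /bz ->; rewrite mulr0.
Qed.

End Plane_derivatives.

(** * Smoothed indicators of intervals *)

Section Bumps.
Context {R : realType}.

(** A smooth approximation of the indicator function of [`]c, d]]. *)
Definition bump (n : nat) (c d y : R) : R :=
  smooth_step (n.+1%:R * (y - c)) - smooth_step (n.+1%:R * (y - d)).

Definition step_derivative : R -> R :=
  sval (cid (smooth_derivative (let: And4 h _ _ _ := @smooth_stepP R in h))).

Lemma is_derive_step (x : R) : is_derive x 1 smooth_step (step_derivative x).
Proof. by rewrite /step_derivative; case: cid => g []. Qed.

Lemma smooth_step_derivative : smooth step_derivative.
Proof. by rewrite /step_derivative; case: cid => g []. Qed.

Definition bump_derivative (n : nat) (c d y : R) : R :=
  n.+1%:R * step_derivative (n.+1%:R * (y - c)) -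
  n.+1%:R * step_derivative (n.+1%:R * (y - d)).

Let step_shift_derive n (c y : R) :
  is_derive y 1 (fun y => smooth_step (n.+1%:R * (y - c)))
    (n.+1%:R * step_derivative (n.+1%:R * (y - c))).
Proof.
rewrite mulrC; apply: (@is_derive_comp1 _ smooth_step (fun y => n.+1%:R * (y - c)) y _ _ (is_derive_step _)).
apply: (is_derive_eqval (is_deriveZ1 n.+1%:R (is_deriveB1 (is_derive_id1 y) (is_derive_cst1 y c)))).
by rewrite subr0 mulr1.
Qed.

Lemma is_derive_bump n (c d y : R) :
  is_derive y 1 (bump n c d) (bump_derivative n c d y).
Proof. exact: is_deriveB1. Qed.

Lemma smooth_bump n (c d : R) : smooth (bump n c d).
Proof.
have H (e : R) : smooth (fun y => smooth_step (n.+1%:R * (y - e))).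
  move=> m; have -> : (fun y => smooth_step (n.+1%:R * (y - e))) =
      (fun y => smooth_step (n.+1%:R * y + - (n.+1%:R * e))).
    by apply/funext => y; rewrite mulrBr.
  by apply: smooth_n_affine; have [h _ _ _] := @smooth_stepP R; exact: h.
move=> m; have -> : bump n c d = (fun y => smooth_step (n.+1%:R * (y - c)) +
     (-1) * smooth_step (n.+1%:R * (y - d))).
  by apply/funext => y; rewrite mulN1r.
apply: smooth_nD; first exact: H.
by apply: smooth_nM; [exact: smooth_n_cst|exact: H].
Qed.

Lemma bump_bound n (c d y : R) : `|bump n c d y| <= 1.
Proof.
have [_ h _ _] := @smooth_stepP R; rewrite /bump.
have /andP[h1 h2] := h (n.+1%:R * (y - c)); have /andP[h3 h4] := h (n.+1%:R * (y - d)).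
by rewrite ler_norml; apply/andP; split; lra.
Qed.

Lemma bump_support n (c d y : R) : c <= d -> ~~ (c <= y <= d + 1) -> bump n c d y = 0.
Proof.
move=> cd; have [_ _ h0 h1] := @smooth_stepP R; rewrite negb_and -!ltNge => /orP[yc|dy].
  rewrite /bump !h0 ?subrr//; rewrite mulr_ge0_le0//; lra.
have n1 : 1 <= n.+1%:R :> R by rewrite ler1n.
by rewrite /bump !h1 ?subrr//; rewrite -[1]mulr1 ler_pM//; lra.
Qed.

Lemma bump_cvg (c d y : R) : c <= d ->
  bump n c d y @[n --> \oo] --> (\1_(`]c, d]%classic : set R) y : R).
Proof.
move=> cd; have [_ _ h0 h1] := @smooth_stepP R.
have H (e : R) : \forall n \near \oo,
    smooth_step (n.+1%:R * (y - e)) = (if e < y then 1 else 0).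
  have [ey|ye] := ltP e y; last first.
    by near=> n; apply: h0; rewrite mulr_ge0_le0// subr_le0.
  near=> n; apply: h1; rewrite -ler_pdivrMr ?subr_gt0//.
  apply: (@le_trans _ _ n%:R); last by rewrite ler_nat.
  by near: n; exact: nbhs_infty_ger.
apply: cvg_near_cst; near=> n; rewrite /bump.
rewrite (_ : smooth_step (n.+1%:R * (y - c)) = (if c < y then 1 else 0)); last by near: n; exact: H.
rewrite (_ : smooth_step (n.+1%:R * (y - d)) = (if d < y then 1 else 0)); last by near: n; exact: H.
rewrite indicE; case: (ltP c y) => cy; case: (ltP d y) => dy.
- rewrite subrr memNset// => /=; rewrite in_itv/= => /andP[_]; rewrite leNgt dy//.
- by rewrite subr0 mem_set//= in_itv/= cy.
- by have := lt_le_trans dy (le_trans cy cd); rewrite ltxx.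
- rewrite subrr memNset// => /=; rewrite in_itv/= ltNge cy//.
Unshelve. all: by end_near. Qed.

End Bumps.

Section Bump_limits.
Context {R : realType}.
Notation mu := (@lebesgue_measure R).

Lemma bump_dominated (f : R -> R) (c d : R) : c <= d -> mu.-integrable setT (EFin \o f) ->
  (\int[mu]_y (bump n c d y * f y)) @[n --> \oo] --> \int[mu]_(y in `]c, d]) f y.
Proof.
move=> cd intf; have mf : measurable_fun setT f by apply/measurable_EFinP; case/integrableP: intf.
have mb n : measurable_fun setT (bump n c d).
  by apply: continuous_measurable_fun; exact: (smooth_bump n c d 0).
pose I : R -> R := \1_(`]c, d]%classic : set R).
have mI : measurable_fun setT I by exact: measurable_indic.
have [|||||iI _ H] := @dominated_convergence _ _ R mu setT measurableT
  (fun n y => (bump n c d y * f y)%:E) (fun y => (I y * f y)%:E) (fun y => `|(f y)%:E|%E).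
- by move=> n; apply/measurable_EFinP; exact: (measurable_funM (mb n) mf).
- by apply/measurable_EFinP; exact: (measurable_funM mI mf).
- apply: aeW => y _; apply: cvg_EFin; first by near=> n.
  by apply: cvgM; [exact: bump_cvg|exact: cvg_cst].
- exact: integrable_abse.
- apply: aeW => y n _; rewrite abse_EFin lee_fin normrM.
  by rewrite -[leRHS]mul1r ler_wpM2r// bump_bound.
have E : (\int[mu]_(y in `]c, d]) (f y)%:E)%E = (\int[mu]_y (I y * f y)%:E)%E.
  rewrite integral_mkcond; apply: eq_integral => y _; rewrite patchE /I indicE.
  by case: ifP => _ /=; rewrite ?mul1r ?mul0r.
rewrite /Rintegral E -(@fineK _ (\int[mu]_y (I y * f y)%:E)) in H *; last exact: integrable_fin_num.
by move/fine_cvgP : H => -[_].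
Unshelve. all: by end_near. Qed.

Let step_kernel n (c y : R) : R := n.+1%:R * step_derivative (n.+1%:R * (y - c)).

Let step_derivative0 (x : R) : ~~ (0 <= x <= 1) -> step_derivative x = 0.
Proof.
have [_ _ h0 h1] := @smooth_stepP R.
rewrite negb_and -!ltNge => /orP[x0|x1]; apply: is_derive_unique (is_derive_step x) _.
  have xp : 0 < - x by lra.
  apply: (is_derive_near xp _ (is_derive_cst1 x 0)) => u.
  by rewrite ltr_norml => /andP[_ h]; rewrite h0//; lra.
have xp : 0 < x - 1 by lra.
apply: (is_derive_near xp _ (is_derive_cst1 x 1)) => u.
by rewrite ltr_norml => /andP[h _]; rewrite h1//; lra.
Qed.

Let step_kernel0 n (c y : R) : ~~ (c <= y <= c + n.+1%:R^-1) -> step_kernel n c y = 0.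
Proof.
move=> h; rewrite /step_kernel step_derivative0 ?mulr0//; apply: contraNN h.
move=> /andP[h1 h2]; have n0 : 0 < n.+1%:R :> R by [].
rewrite pmulr_rge0// subr_ge0 in h1; rewrite h1 /= -lerBlDl.
by rewrite -[leRHS]mulr1 -ler_pdivrMl ?invr_gt0// invrK.
Qed.

Let step_kernel_continuous n (c : R) : continuous (step_kernel n c).
Proof.
move=> y; apply: cvgM; first exact: cvg_cst.
apply: (@continuous_comp R R R (fun x : R => n.+1%:R * (x - c)) step_derivative y); last exact: (smooth_step_derivative 0).
by apply: cvgM; [exact: cvg_cst|apply: cvgB; [exact: cvg_id|exact: cvg_cst]].
Qed.

Let step_kernel_integral n (c : R) :
  \int[mu]_(y in `[c, c + n.+1%:R^-1]) step_kernel n c y = 1.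
Proof.
have n0 : 0 < n.+1%:R :> R by [].
have cl : c < c + n.+1%:R^-1 by rewrite ltrDl invr_gt0.
pose F y := smooth_step (n.+1%:R * (y - c)) : R.
have dF (y : R) : is_derive y 1 F (step_kernel n c y).
  rewrite /step_kernel mulrC.
  apply: (@is_derive_comp1 _ smooth_step (fun y => n.+1%:R * (y - c)) y _ _ (is_derive_step _)).
  apply: (is_derive_eqval (is_deriveZ1 n.+1%:R (is_deriveB1 (is_derive_id1 y) (is_derive_cst1 y c)))).
  by rewrite subr0 mulr1.
have cF : continuous F by move=> y; exact: is_derive_continuous (dF y).
have := @continuous_FTC2 R (step_kernel n c) F c (c + n.+1%:R^-1) cl.
rewrite /Rintegral => -> //=.
- have [_ _ h0 h1] := @smooth_stepP R.
  rewrite /F (_ : c + n.+1%:R^-1 - c = n.+1%:R^-1); last by rewrite addrAC subrr add0r.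
  by rewrite subrr mulr0 (h0 0)// divff ?gt_eqF// h1// subr0.
- exact: continuous_subspaceT (@step_kernel_continuous n c).
- split; [by move=> y _; have [] := dF y|exact: cvg_at_right_filter (cF _)|
    exact: cvg_at_left_filter (cF _)].
- by move=> y _; exact: is_derive_derive1.
Qed.

Let step_kernel_bound : exists2 B : R, 0 < B & forall n (c y : R),
  `|step_kernel n c y| <= n.+1%:R * B.
Proof.
have cS : continuous (fun x : R => `|step_derivative x|).
  by move=> x; apply: cvg_norm; exact: (smooth_step_derivative 0).
have [x0 _ hx0] := EVT_max (@ler01 R) (continuous_subspaceT cS).
exists (`|step_derivative x0| + 1); first by rewrite ltr_wpDl.
move=> n c y; rewrite /step_kernel normrM ger0_norm// ler_wpM2l//.
have [h|h] := boolP (0 <= n.+1%:R * (y - c) <= 1).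
  by apply: le_trans (hx0 _ _) _; rewrite ?in_itv//= lerDl.
by rewrite step_derivative0// normr0 addr_ge0.
Qed.

(** The rescaled kernels are an approximate identity: their mass is 1, their
    support shrinks to [c], and their size [(n + 1) B] is bounded by a multiple of
    the inverse of the length of the support. *)
Lemma step_kernel_cvg (u : R -> R) (c : R) : continuous u ->
  (\int[mu]_y (u y * step_kernel n c y)) @[n --> \oo] --> u c.
Proof.
move=> cu; have [B B0 hB] := step_kernel_bound.
apply/cvgrPdist_le => e e0.
have [d d0 hd] := continuous_eps cu c (divr_gt0 e0 B0).
near=> n; have n0 : 0 < n.+1%:R :> R by [].
pose K : set (measurableTypeR R) := `[c, c + n.+1%:R^-1]%classic.
have mK : measurable K by exact: measurable_itv.
have nd : n.+1%:R^-1 < d.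
  rewrite invf_plt ?posrE//; apply: (@le_lt_trans _ _ n%:R); last by rewrite ltr_nat.
  by near: n; exact: nbhs_infty_ger.
have muK : mu K = (n.+1%:R^-1)%:E.
  by rewrite /K lebesgue_measure_itv/= lte_fin ltrDl invr_gt0 n0 -EFinB addrAC subrr add0r.
have muKoo : (mu K < +oo)%E by rewrite muK ltry.
have icont f : continuous f -> mu.-integrable K (EFin \o f).
  move=> cf; apply: continuous_compact_integrable; first exact: segment_compact.
  exact: continuous_subspaceT.
have ck := @step_kernel_continuous n c.
have E : \int[mu]_y (u y * step_kernel n c y) = \int[mu]_(y in K) (u y * step_kernel n c y).
  rewrite [RHS]Rintegral_mkcond; apply: eq_Rintegral => y _; rewrite patchE.
  case: ifPn => //; rewrite notin_setE /K/= in_itv/= => /negP h.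
  by rewrite step_kernel0 ?mulr0.
have cuk : continuous (fun y => u y * step_kernel n c y).
  by move=> y; apply: cvgM; [exact: cu|exact: ck].
have cuk' : continuous (fun y => u c * step_kernel n c y).
  by move=> y; apply: cvgM; [exact: cvg_cst|exact: ck].
have E2 : u c = \int[mu]_(y in K) (u c * step_kernel n c y).
  by rewrite RintegralZl ?step_kernel_integral ?mulr1//; exact: icont.
rewrite E {1}E2 -RintegralB//; [|exact: icont..].
apply: le_trans (le_normr_Rintegral _ _) _ => //.
  apply: icont => y; apply: cvgB; [exact: cuk'|exact: cuk].
have -> : e = \int[mu]_(y in K) (e / B * (n.+1%:R * B)).
  rewrite /Rintegral integral_cst// [X in (_ * X)%E](_ : _ = (n.+1%:R^-1)%:E)//=.
  by field; rewrite !gt_eqF.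
apply: le_Rintegral => //.
- apply: icont => y; apply: cvg_norm; apply: cvgB; [exact: cuk'|exact: cuk].
- by apply: icont; exact: cst_continuous.
move=> y; rewrite /K/= in_itv/= => /andP[cy yc].
rewrite -mulrBl normrM; apply: ler_pM => //.
rewrite distrC ltW//; apply: hd; rewrite ger0_norm ?subr_ge0//.
by apply: le_lt_trans nd; rewrite lerBlDl.
Unshelve. all: by end_near. Qed.

(** Testing the weak derivative against the smoothed indicators of [`]c, d]]
    recovers the fundamental theorem of calculus. *)
Lemma weak_to_increment (u v : R -> R) (c d : R) : c <= d -> continuous u ->
  mu.-integrable `[c, d + 1] (EFin \o v) ->
  (forall n, \int[mu]_y (u y * bump_derivative n c d y) =
     - \int[mu]_y (v y * bump n c d y)) ->
  \int[mu]_(y in `]c, d]) v y = u d - u c.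
Proof.
move=> cd cu iv H.
pose v1 := v \_ `[c, d + 1].
have iv1 : mu.-integrable setT (EFin \o v1).
  by rewrite -restrict_EFin; apply/(integrable_mkcond _ _).1.
have E n : \int[mu]_y (v y * bump n c d y) = \int[mu]_y (bump n c d y * v1 y).
  apply: eq_Rintegral => y _; rewrite /v1 patchE mulrC; case: ifPn => //.
  rewrite notin_setE/= in_itv/= => /negP h; by rewrite bump_support// !mul0r.
have E2 : \int[mu]_(y in `]c, d]) v y = \int[mu]_(y in `]c, d]) v1 y.
  apply: eq_Rintegral => y; rewrite inE/= in_itv/= => /andP[cy yd].
  by rewrite /v1 patchE mem_set//= in_itv/= (ltW cy) (le_trans yd)// lerDl.
have := bump_dominated cd iv1; rewrite -E2 => L1.
have L2 : \int[mu]_y (u y * bump_derivative n c d y) @[n --> \oo] --> u c - u d.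
  have ick n e : mu.-integrable setT (EFin \o (fun y => u y * step_kernel n e y)).
    pose K : set (measurableTypeR R) := `[e, e + n.+1%:R^-1]%classic.
    have cuk : continuous (fun y => u y * step_kernel n e y).
      by move=> y; apply: cvgM; [exact: cu|exact: step_kernel_continuous].
    have : mu.-integrable K (EFin \o (fun y => u y * step_kernel n e y)).
      apply: continuous_compact_integrable; first exact: segment_compact.
      exact: continuous_subspaceT.
    have mK : measurable K by exact: measurable_itv.
    move=> iK; suff -> : EFin \o (fun y => u y * step_kernel n e y) =
        (EFin \o (fun y => u y * step_kernel n e y)) \_ K.
      exact: ((integrable_mkcond _ mK).1 iK).
    apply/funext => y; rewrite patchE; case: ifPn => //.
    by rewrite notin_setE /K/= in_itv/= => /negP h; rewrite step_kernel0 ?mulr0.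
  have -> : (fun n => \int[mu]_y (u y * bump_derivative n c d y)) =
      (fun n => \int[mu]_y (u y * step_kernel n c y) - \int[mu]_y (u y * step_kernel n d y)).
    apply/funext => n; rewrite -RintegralB//; apply: eq_Rintegral => y _.
    by rewrite /bump_derivative /step_kernel; ring.
  by apply: cvgB; exact: step_kernel_cvg.
have L3 : \int[mu]_y (u y * bump_derivative n c d y) @[n --> \oo] --> - \int[mu]_(y in `]c, d]) v y.
  have -> : (fun n => \int[mu]_y (u y * bump_derivative n c d y)) =
      (fun n => - \int[mu]_y (bump n c d y * v1 y)).
    by apply/funext => n; rewrite H E.
  exact: cvgN.
by have h := cvg_unique (@Rhausdorff R) L3 L2; rewrite -[LHS]opprK h opprB.
Qed.

End Bump_limits.

(** * Lebesgue measure on the plane and on coordinate lines *)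

Lemma ae_mono d (T : measurableType d) (R : realType) (m : {measure set T -> \bar R})
    (P Q : T -> Prop) : (forall x, P x -> Q x) ->
  {ae m, forall x, P x} -> {ae m, forall x, Q x}.
Proof.
move=> PQ [A [mA A0 hA]]; exists A; split => // x nQ; apply: hA => Px; apply: nQ; exact: PQ.
Qed.

Section Plane_measure.
Context {R : realType}.
Notation mu := (@lebesgue_measure R).
Notation mu2 := (@plane_measure R).

(** An open set is the union of the boxes with rational vertices that it contains,
    and there are countably many of them. *)
Lemma plane_open_measurable (U : set (R * R)) : open U -> measurable (U : set (measurableTypeR R * measurableTypeR R)%type).
Proof.
move=> oU.
pose box (i : (rat * rat) * (rat * rat)) : set (measurableTypeR R * measurableTypeR R)%type :=
  `]ratr i.1.1, ratr i.1.2[%classic `*` `]ratr i.2.1, ratr i.2.2[%classic.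
have -> : U = \bigcup_i (if `[< box i `<=` U >] then box i else set0).
  apply/seteqP; split => [p Up|p [i _]]; last by case: ifPn => // /asboolP; exact.
  have /nbhs_ballP[e /= e0 he] := open_nbhs_nbhs (conj oU Up).
  have [a1 /andP[]] := @rat_in_itvoo R (p.1 - e) p.1 ltac:(lra); rewrite !bnd_simp => a11 a12.
  have [b1 /andP[]] := @rat_in_itvoo R p.1 (p.1 + e) ltac:(lra); rewrite !bnd_simp => b11 b12.
  have [a2 /andP[]] := @rat_in_itvoo R (p.2 - e) p.2 ltac:(lra); rewrite !bnd_simp => a21 a22.
  have [b2 /andP[]] := @rat_in_itvoo R p.2 (p.2 + e) ltac:(lra); rewrite !bnd_simp => b21 b22.
  exists ((a1, b1), (a2, b2)) => //; rewrite asboolT.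
    by split => /=; rewrite in_itv/=; apply/andP.
  move=> q [/=]; rewrite !in_itv/= => /andP[q1 q2] /andP[q3 q4].
  by apply: he; split; rewrite /ball/= ltr_norml; apply/andP; split; lra.
apply: countable_bigcupT_measurable => [|i]; first exact: countableP.
by case: ifPn => _; [apply: measurableX; exact: measurable_itv|exact: measurable0].
Qed.

Lemma plane_continuous_measurable (u : R * R -> R) : continuous u ->
  measurable_fun setT (u : (measurableTypeR R * measurableTypeR R)%type -> R).
Proof.
move=> cu; apply: (measurability _ (RGenOInfty.measurableE R)) => _ [_ [a ->]] <-.
rewrite setTI; apply: plane_open_measurable.
move/continuousP : cu; apply; exact: interval_open.
Qed.

(** The two families of coordinate lines: horizontal ones for [b = true],
    vertical ones for [b = false]; [a] selects the line, [t] is the position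
    on it. *)
Definition line (b : bool) (a t : R) : R * R := if b then (t, a) else (a, t).
Definition direction (b : bool) : R * R := if b then ex else ey.

Lemma measurable_line b a :
  measurable_fun setT (line b a : measurableTypeR R -> (measurableTypeR R * measurableTypeR R)%type).
Proof. by case: b; [exact: pair2_measurable|exact: pair1_measurable]. Qed.

Lemma continuous_line b a : continuous (line b a).
Proof.
by case: b => t; [exact: (@cvg_pair _ _ _ (nbhs t) (nbhs t) (nbhs a) _ _ _ id (fun=> a) cvg_id (cvg_cst a))|
  exact: (@cvg_pair _ _ _ (nbhs t) (nbhs a) (nbhs t) _ _ _ (fun=> a) id (cvg_cst a) cvg_id)].
Qed.

Lemma line_tonelli b (F : R * R -> \bar R) :
  measurable_fun setT (F : (measurableTypeR R * measurableTypeR R)%type -> \bar R) ->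
  (forall p, (0 <= F p)%E) ->
  measurable_fun setT (fun a : measurableTypeR R => (\int[mu]_t F (line b a t))%E) /\
  (\int[mu2]_p F p = \int[mu]_a \int[mu]_t F (line b a t))%E.
Proof.
move=> mF F0; case: b; split.
- exact: measurable_fun_fubini_tonelli_G.
- exact: fubini_tonelli2.
- exact: measurable_fun_fubini_tonelli_F.
- exact: fubini_tonelli1.
Qed.

Lemma line_fubini b (F : R * R -> R) : mu2.-integrable setT (EFin \o F) ->
  [/\ {ae mu, forall a, mu.-integrable setT (fun t => (F (line b a t))%:E)},
      mu.-integrable setT (fun a => (\int[mu]_t (F (line b a t)))%:E) &
      \int[mu2]_p F p = \int[mu]_a \int[mu]_t F (line b a t)].
Proof.
move=> iF.
have iae : {ae mu, forall a, mu.-integrable setT (fun t => (F (line b a t))%:E)}.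
  by case: b; [exact: (ae_integrable2 iF)|exact: (ae_integrable1 iF)].
have iFF : mu.-integrable setT (fun a => (\int[mu]_t (F (line b a t))%:E)%E).
  have mF := measurable_int _ iF.
  have mabs : measurable_fun setT (abse \o (EFin \o F) : (measurableTypeR R * measurableTypeR R)%type -> \bar R).
    exact: measurableT_comp.
  have [mI EI] := @line_tonelli b (abse \o (EFin \o F)) mabs (fun p => abse_ge0 _).
  have mFF : measurable_fun setT (fun a => (\int[mu]_t (F (line b a t))%:E)%E).
    by case: b {iae mI EI}; [exact: (measurable_fubini_G iF)|exact: (measurable_fubini_F iF)].
  apply/integrableP; split => //; have /integrableP[_] := iF; apply: le_lt_trans.
  rewrite [leRHS]EI; apply: ge0_le_integral => //.
  - exact: measurableT_comp.
  - move=> a _; apply: le_abse_integral => //.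
    exact: (measurableT_comp mF (measurable_line b a)).
have E : (\int[mu2]_p (F p)%:E = \int[mu]_a \int[mu]_t (F (line b a t))%:E)%E.
  by case: b {iae iFF}; [exact/esym/(integral21_prod_meas1 iF)|exact/esym/(integral12_prod_meas1 iF)].
have mF2 : measurable_fun setT (fun a : measurableTypeR R => (\int[mu]_t (F (line b a t)))%:E).
  apply/measurable_EFinP; apply: measurableT_comp => //.
  exact: (measurable_int _ iFF).
have aeE : ae_eq mu setT (fun a => (\int[mu]_t (F (line b a t))%:E)%E)
    (fun a => (\int[mu]_t (F (line b a t)))%:E).
  apply: ae_mono iae => a ia _.
  by rewrite /Rintegral fineK//; exact: integrable_fin_num.
split => //.
  apply: (le_integrable measurableT mF2 _ iFF) => a _ /=; rewrite /Rintegral.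
  have fine_le (x : \bar R) : (`|fine x|%:E <= `|x|)%E.
    by case: x => [x||] /=; rewrite ?normr0 ?leey.
  exact: fine_le.
rewrite /Rintegral E; congr fine; apply: ae_eq_integral => //.
exact: (measurable_int _ iFF).
Qed.

(** Tonelli: the measure of a plane set is the integral of the lengths of its
    sections, and a nonnegative function has integral 0 exactly when it vanishes
    almost everywhere. *)
Lemma line_null b (A : set (R * R)) :
  measurable (A : set (measurableTypeR R * measurableTypeR R)%type) ->
  mu2 A = 0 <-> {ae mu, forall a, {ae mu, forall t, ~ A (line b a t)}}.
Proof.
move=> mA; pose F p : \bar R := (\1_A p)%:E.
have mF : measurable_fun setT (F : (measurableTypeR R * measurableTypeR R)%type -> \bar R).
  by apply/measurable_EFinP; exact: measurable_indic.
have F0 p : (0 <= F p)%E by rewrite lee_fin.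
have [mI E] := @line_tonelli b F mF F0.
rewrite (_ : mu2 A = (\int[mu2]_p F p)%E); last by rewrite integral_indic// setIT.
have mFa a : measurable_fun setT (fun t : measurableTypeR R => F (line b a t)).
  exact: (measurableT_comp mF (measurable_line b a)).
have ia a : (\int[mu]_t F (line b a t) = 0)%E <-> {ae mu, forall t, ~ A (line b a t)}.
  rewrite (_ : (\int[mu]_t F (line b a t))%E = (\int[mu]_t `|F (line b a t)|)%E); last first.
    by apply: eq_integral => t _; rewrite gee0_abs.
  rewrite (ae_eq_integral_abs mu measurableT (mFa a)); split.
    apply: ae_mono => t /= /(_ I).
    rewrite /F indicE => -[] /eqP; rewrite pnatr_eq0 eqb0 => /negP h At.
    by apply: h; rewrite inE.
  apply: ae_mono => t h _.
  by rewrite /F indicE memNset.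
rewrite E (_ : (\int[mu]_a \int[mu]_t F (line b a t))%E =
    (\int[mu]_a `|\int[mu]_t F (line b a t)|)%E); last first.
  by apply: eq_integral => a _; rewrite gee0_abs// integral_ge0.
rewrite (ae_eq_integral_abs mu measurableT mI).
by split; apply: ae_mono => a; [move=> /(_ I)/ia|move=> /ia h _].
Qed.

Lemma ae_line b (P : R * R -> Prop) : {ae mu2, forall p, P p} ->
  {ae mu, forall a, {ae mu, forall t, P (line b a t)}}.
Proof.
move=> [A [mA A0 hA]]; have /(line_null b mA) := A0.
apply: ae_mono => a; apply: ae_mono => t h.
by apply: contrapT => nP; apply: h; exact: hA.
Qed.

Lemma compact_plane_measurable (K : set (R * R)) : compact K ->
  measurable (K : set (measurableTypeR R * measurableTypeR R)%type).
Proof.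
move=> cK; have clK : closed K by apply: compact_closed => //; exact: norm_hausdorff.
rewrite -(setCK K); apply: measurableC; apply: plane_open_measurable.
exact: closed_openC.
Qed.

Lemma compact_plane_finite (K : set (R * R)) : compact K -> (mu2 K < +oo)%E.
Proof.
move=> cK; have mK := compact_plane_measurable cK.
have [M [_ hM]] := compact_bounded cK.
have {}hM := hM (M + 1) ltac:(lra).
pose I := `[- (M + 1), M + 1]%classic : set (measurableTypeR R).
have mI : measurable I by exact: measurable_itv.
have KI : K `<=` I `*` I.
  move=> p Kp; have /= := hM p Kp; rewrite prod_normE/= ge_max => /andP[p1 p2].
  by split; rewrite /I /= in_itv/= -ler_norml.
have mII : measurable (I `*` I) by exact: measurableX.
have h : (mu2 K <= mu2 (I `*` I))%E by apply: le_measure => //; rewrite inE.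
apply: le_lt_trans h _; rewrite /plane_measure product_measure1E//.
have muI : (mu I < +oo)%E.
  by rewrite /I lebesgue_measure_itv/=; case: ifP => _; rewrite -?EFinB ltry.
by rewrite lte_mul_pinfty// fin_num_abs gee0_abs.
Qed.

Lemma bounded_plane_integrable (K : set (R * R)) (u : R * R -> R) (B : R) :
  compact K ->
  measurable_fun setT (u : (measurableTypeR R * measurableTypeR R)%type -> R) ->
  (forall p, K p -> `|u p| <= B) -> mu2.-integrable K (EFin \o u).
Proof.
move=> cK mu uB; have mK := compact_plane_measurable cK.
apply: measurable_bounded_integrable => //.
- exact: compact_plane_finite.
- exact: measurable_funTS.
- exists B; split; first by rewrite num_real.
  by move=> M BM p Kp; apply: le_trans (ltW BM); exact: uB.
Qed.

Lemma continuous_L1loc (u : R * R -> R) : continuous u -> L1loc setT u.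
Proof.
move=> cu; split; first exact: plane_continuous_measurable.
move=> K _ cK; have [M [_ hM]] := compact_bounded (continuous_compact (continuous_subspaceT cu) cK).
apply: (@bounded_plane_integrable K u (M + 1)) => //; first exact: plane_continuous_measurable.
by move=> p Kp; apply: (hM (M + 1)); [lra|exists p].
Qed.

End Plane_measure.

(** * The fundamental theorem of calculus on a line *)

Section Lines_calculus.
Context {R : realType}.
Notation mu := (@lebesgue_measure R).

(** Both sides are continuous in the endpoints, and rational endpoints are dense. *)
Lemma increment_rational (f g : R -> R) : continuous f ->
  (forall a b : R, mu.-integrable `[a, b] (EFin \o g)) ->
  (forall c d : rat, (ratr c : R) <= ratr d ->
    \int[mu]_(y in `]ratr c, ratr d]) g y = f (ratr d) - f (ratr c)) ->
  forall c d : R, c <= d -> \int[mu]_(y in `]c, d]) g y = f d - f c.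
Proof.
move=> cf ig H c d; rewrite le_eqVlt => /predU1P[->|cd].
  by rewrite set_itvoc0 Rintegral_set0 subrr.
have [q /andP[]] := @rat_in_itvoo R (c - 1) c ltac:(lra); rewrite !bnd_simp => _ qc.
pose V := fun x : R => \int[mu]_(y in `[ratr q, x]) g y.
have cV : {in `](ratr q : R), d + 1[, continuous V}.
  have h := @parameterized_integral_continuous R (ratr q) (d + 1) g ltac:(lra) (ig _ _).
  have qd : (ratr q : R) < d + 1 by lra.
  by have [] := (continuous_within_itvP V qd).1 h.
have VE (t : R) : ratr q < t -> t < d + 1 -> V t = f t - f (ratr q).
  move=> qt td; apply/eqP; rewrite -subr_eq0 -normr_le0; apply/ler_addgt0Pl => e e0.
  have ct := cV t; rewrite in_itv/= qt td in ct; have {}ct := ct isT.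
  have e2 : 0 < e / 2 by lra.
  have /cvgrPdist_lt/(_ _ e2)/nbhs_ballP[d1 /= d10 h1] := ct.
  have [d2 d20 h2] := continuous_eps cf t e2.
  pose m := Num.min (d + 1) (t + Num.min d1 d2).
  have tm : t < m by rewrite /m lt_min td ltrDl lt_min d10.
  have [p /andP[]] := rat_in_itvoo tm; rewrite !bnd_simp /m !lt_min => tp /andP[pd pm].
  have [p1 p2] : ratr p - t < d1 /\ ratr p - t < d2.
    by move: pm; rewrite -ltrBlDl lt_min => /andP.
  have nt : `|ratr p - t| = ratr p - t by rewrite ger0_norm// subr_ge0 ltW.
  have := h1 (ratr p); rewrite /ball/= distrC nt => /(_ p1) {}h1.
  have := h2 (ratr p); rewrite nt => /(_ p2) {}h2.
  have E : V (ratr p) = f (ratr p) - f (ratr q).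
    rewrite -H ?(ltW (lt_trans qt tp))// /V Rintegral_itv_obnd_cbnd//.
    by apply: (integrableS _ _ _ (ig (ratr q) (ratr p))) => // x /=; rewrite !in_itv/= => /andP[/ltW-> ->].
  rewrite addr0; rewrite E in h1.
  rewrite (_ : V t - (f t - f (ratr q)) =
    (V t - (f (ratr p) - f (ratr q))) + (f (ratr p) - f t)); last lra.
  by apply: le_trans (ler_normD _ _) _; lra.
have := @Rintegral_itvB R g (BLeft (ratr q)) (BRight d) c (ig _ _).
rewrite !bnd_simp => /(_ (ltW qc) (ltW cd)) <-.
by rewrite -/(V d) -/(V c) !VE//; lra.
Qed.

(** Almost every point is a Lebesgue point of [g]. *)
Lemma ae_derivable_of_increment (f g : R -> R) :
  (forall a b : R, mu.-integrable `[a, b] (EFin \o g)) ->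
  (forall c d : R, c <= d -> \int[mu]_(y in `]c, d]) g y = f d - f c) ->
  {ae mu, forall t : R, is_derive t 1 f (g t)}.
Proof.
move=> ig H.
have loc (N : nat) : {ae mu, forall x : R, - N%:R < x -> x < N%:R -> is_derive x 1 f (g x)}.
  pose H1 := g \_ `[- N%:R, N%:R].
  have iH1 : mu.-integrable setT (EFin \o H1).
    by rewrite -restrict_EFin; apply/(integrable_mkcond _ _).1.
  have locH : locally_integrable [set: R] H1 by apply: open_integrable_locally => //; exact: openT.
  have intfy y : mu.-integrable [set` Interval (BRight (- N%:R)) (BRight y)] (EFin \o H1).
    by apply: integrableS iH1.
  have := @FTC1 R H1 (BRight (- N%:R)) intfy locH.
  apply: ae_mono => x + x1 x2.
  rewrite /= lte_fin => /(_ x1) [dx dE].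
  have HE : H1 x = g x by rewrite /H1 patchE mem_set//= in_itv/= !ltW.
  rewrite derive1E in dE; have dI := DeriveDef dx dE; rewrite HE in dI.
  have dd : 0 < Num.min (x + N%:R) (N%:R - x) by rewrite lt_min; apply/andP; split; lra.
  apply: (is_derive_near dd _ (is_derive_eqval (is_deriveD1 dI (is_derive_cst1 x (f (- N%:R)))) (addr0 _))) => u.
  rewrite lt_min !ltr_norml => /andP[/andP[u1 u2] /andP[u3 u4]].
  rewrite (_ : f u = \int[mu]_(t in `]- N%:R, u]) g t + f (- N%:R)); last first.
    by rewrite H ?subrK//; lra.
  congr (_ + _); apply: eq_Rintegral => y; rewrite inE/= in_itv/= => /andP[y1 y2].
  by rewrite /H1 patchE mem_set//= in_itv/=; apply/andP; split; lra.
have : {ae mu, forall (x : R) (N : nat), - N%:R < x -> x < N%:R -> is_derive x 1 f (g x)}.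
  exact/ae_foralln.
apply: ae_mono => x h; have /ltr_normlP[xl xr] := unstable.ltr_norm_bound x.
by apply: (h (Num.bound x)); rewrite // ltrNl.
Qed.
End Lines_calculus.

(** The fundamental lemma of the calculus of variations on the line: in the limit
    the integral of [H] over every interval vanishes, and [H] is almost everywhere
    the derivative of its integral. *)
Lemma ae_eq0_of_bumps (R : realType) (H : R -> R) :
  (forall a b : R, lebesgue_measure.-integrable `[a, b] (EFin \o H)) ->
  (forall n (c d : R), c <= d -> \int[lebesgue_measure]_x (bump n c d x * H x) = 0) ->
  {ae lebesgue_measure, forall x, H x = 0}.
Proof.
move=> iH bH; have ci (c d : R) : c <= d -> \int[lebesgue_measure]_(x in `]c, d]) H x = 0 - 0.
  move=> cd; apply: (@weak_to_increment R (fun=> 0) H c d cd (@cst_continuous _ _ _) (iH _ _)) => n.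
  under eq_Rintegral do rewrite mul0r.
  under [in RHS]eq_Rintegral do rewrite mulrC.
  by rewrite bH// oppr0 /Rintegral integral0_eq.
have := @ae_derivable_of_increment R (fun=> 0) H iH ci.
by apply: ae_mono => x dx; exact: (is_derive_unique dx (is_derive_cst1 x 0)).
Qed.

Lemma ae_and d (T : measurableType d) (R : realType) (m : {measure set T -> \bar R})
    (P Q : T -> Prop) : {ae m, forall x, P x} -> {ae m, forall x, Q x} ->
  {ae m, forall x, P x /\ Q x}.
Proof. by have F := ae_filter_ringOfSetsType m; exact: filterI. Qed.

Lemma integrable_mul_support d (T : measurableType d) (R : realType)
    (m : {measure set T -> \bar R}) (D : set T) (f h : T -> R) (B : R) :
  measurable D -> m.-integrable D (EFin \o f) -> measurable_fun D h ->
  (forall x, D x -> `|h x| <= B) -> (forall x, ~ D x -> h x = 0) ->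
  m.-integrable setT (EFin \o (f \* h)).
Proof.
move=> mD fi mh hB h0.
have bh : [bounded h x | x in D].
  exists B; split; first by rewrite num_real.
  by move=> M BM x Dx; apply: le_trans (ltW BM); exact: hB.
have := (integrable_mkcond _ mD).1 (integrableMl mD fi mh bh).
congr (_.-integrable _ _); apply/funext => x; rewrite patchE /=.
by case: ifPn => //; rewrite notin_setE => /h0 ->; rewrite mulr0.
Qed.

(** * Weak derivatives on almost every line *)

Section ACL.
Context {R : realType}.
Notation mu := (@lebesgue_measure R).
Notation mu2 := (@plane_measure R).

Definition square (N : R) : set (R * R) := [set p | `|p.1| <= N /\ `|p.2| <= N].

Lemma square_compact N : compact (square N).
Proof.
have -> : square N = `[- N, N]%classic `*` `[- N, N]%classic.
  by apply/seteqP; split => p /=; rewrite !in_itv/= -!ler_norml.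
by apply: compact_setX; exact: segment_compact.
Qed.

Lemma square_line N b a t : square N (line b a t) <-> `|a| <= N /\ `|t| <= N.
Proof. by case: b; rewrite /square /=; split => -[]. Qed.

Definition across (b : bool) (p : R * R) : R := if b then p.2 else p.1.
Definition along (b : bool) (p : R * R) : R := if b then p.1 else p.2.

Lemma across_line b a t : across b (line b a t) = a. Proof. by case: b. Qed.
Lemma along_line b a t : along b (line b a t) = t. Proof. by case: b. Qed.
Lemma line_across_along b p : line b (across b p) (along b p) = p.
Proof. by case: b p => -[]. Qed.

Lemma continuous_across b : continuous (across b).
Proof. by case: b => p; [exact: cvg_snd|exact: cvg_fst]. Qed.

Lemma continuous_on_line b a (u : R * R -> R) : continuous u ->
  continuous (fun t : R => u (line b a t)).
Proof.
move=> cu t; exact: (@continuous_comp R (R * R)%type R (line b a) u t (@continuous_line R b a t) (cu _)).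
Qed.

Lemma continuous_along b : continuous (along b).
Proof. by case: b => p; [exact: cvg_fst|exact: cvg_snd]. Qed.

Lemma is_derive_lineP b (u : R * R -> R) p (l : R) :
  is_derive p (direction b) u l <->
  is_derive (along b p) 1 (fun t => u (line b (across b p) t)) l.
Proof. by case: b; [exact: is_derive_exP|exact: is_derive_eyP]. Qed.

Lemma bump_derivative_support n (c d y : R) : c <= d -> ~~ (c <= y <= d + 1) ->
  bump_derivative n c d y = 0.
Proof.
move=> cd h; apply: (is_derive_unique (is_derive_bump n c d y)).
have [e e0 he] : exists2 e : R, 0 < e & forall z, `|z - y| < e -> ~~ (c <= z <= d + 1).
  move: h; rewrite negb_and -!ltNge => /orP[h|h].
    exists (c - y); first lra.
    move=> z; rewrite ltr_norml => /andP[z1 z2]; rewrite negb_and -ltNge; apply/orP; left; lra.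
  exists (y - (d + 1)); first lra.
  move=> z; rewrite ltr_norml => /andP[z1 z2]; rewrite negb_and -!ltNge; apply/orP; right; lra.
apply: (is_derive_near e0 _ (is_derive_cst1 y 0)) => z /he hz.
by rewrite bump_support.
Qed.

Lemma continuous_bump_derivative n (c d : R) : continuous (bump_derivative n c d).
Proof.
have sk (e : R) : continuous (fun y : R => n.+1%:R * step_derivative (n.+1%:R * (y - e))).
  move=> y; apply: cvgM; first exact: cvg_cst.
  apply: (@continuous_comp R R R (fun x : R => n.+1%:R * (x - e)) step_derivative y); last exact: (smooth_step_derivative 0).
  by apply: cvgM; [exact: cvg_cst|apply: cvgB; [exact: cvg_id|exact: cvg_cst]].
by move=> y; apply: cvgB; exact: sk.
Qed.

Lemma bump_derivative_bounded n (c d : R) : c <= d ->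
  exists B, forall y, `|bump_derivative n c d y| <= B.
Proof.
move=> cd; have cS : continuous (fun x : R => `|bump_derivative n c d x|).
  by move=> x; apply: cvg_norm; exact: continuous_bump_derivative.
have cd1 : c <= d + 1 by lra.
have [x0 _ hx0] := EVT_max cd1 (continuous_subspaceT cS).
exists `|bump_derivative n c d x0| => y.
have [h|h] := boolP (c <= y <= d + 1); first by apply: hx0; rewrite in_itv.
by rewrite (bump_derivative_support n cd h) normr0.
Qed.

(** Products of two smoothed indicators suffice to localize a weak derivative: the
    factor across selects almost every line, the factor along selects an interval
    of that line. *)
Lemma bump_test_function b n m (c d c' d' : R) : c <= d -> c' <= d' ->
  let phi p := bump m c' d' (across b p) * bump n c d (along b p) in
  test_function setT phi /\
  forall p, 'D_(direction b) phi p =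
    bump m c' d' (across b p) * bump_derivative n c d (along b p).
Proof.
move=> cd cd' phi; split; last first.
  move=> p; have [_ //] : is_derive p (direction b) phi
      (bump m c' d' (across b p) * bump_derivative n c d (along b p)).
  apply/is_derive_lineP.
  rewrite (_ : (fun t => phi _) = (fun t => bump m c' d' (across b p) * bump n c d t)); last first.
    by apply/funext => t; rewrite /phi across_line along_line.
  exact: (is_deriveZ1 _ (is_derive_bump n c d _)).
case: b @phi; last first.
  by apply: product_test_function (smooth_bump _ _ _) (smooth_bump _ _ _) _ _ => x;
    exact: bump_support.
rewrite (_ : (fun p => _) = (fun p => bump n c d p.1 * bump m c' d' p.2)); last first.
  by apply/funext => p; rewrite mulrC.
by apply: product_test_function (smooth_bump _ _ _) (smooth_bump _ _ _) _ _ => x;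
  exact: bump_support.
Qed.

Section Weak.
Variables (b : bool) (u v : R * R -> R).
Hypotheses (cu : continuous u) (wuv : weak_derivative setT (direction b) u v).

Let measurable_across : measurable_fun setT (across b : (measurableTypeR R * measurableTypeR R)%type -> R).
Proof. exact: plane_continuous_measurable (@continuous_across b). Qed.

Let measurable_along : measurable_fun setT (along b : (measurableTypeR R * measurableTypeR R)%type -> R).
Proof. exact: plane_continuous_measurable (@continuous_along b). Qed.

Let integrable_product (f : R * R -> R) (A0 B0 : R -> R) (N B1 B2 : R) :
  L1loc setT f -> measurable_fun setT A0 -> measurable_fun setT B0 ->
  (forall a, `|A0 a| <= B1) -> (forall t, `|B0 t| <= B2) ->
  (forall a, ~ (`|a| <= N) -> A0 a = 0) -> (forall t, ~ (`|t| <= N) -> B0 t = 0) ->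
  mu2.-integrable setT (EFin \o (fun p => f p * (A0 (across b p) * B0 (along b p)))).
Proof.
move=> [mf lf] mA mB hA hB sA sB; have cK := @square_compact N.
apply: (@integrable_mul_support _ _ R mu2 (square N) f (fun p => A0 (across b p) * B0 (along b p)) (B1 * B2)).
- exact: compact_plane_measurable.
- by apply: lf.
- apply: measurable_funTS; apply: measurable_funM.
    exact: (measurableT_comp mA measurable_across).
  exact: (measurableT_comp mB measurable_along).
- by move=> p _; rewrite normrM; apply: ler_pM.
move=> p; rewrite -(line_across_along b p) square_line across_line along_line => h.
have [ha|/negP/sA->] := boolP (`|across b p| <= N); last by rewrite mul0r.
have [ht|/negP/sB->] := boolP (`|along b p| <= N); last by rewrite mulr0.
by exfalso; apply: h.
Qed.

Let interval_abs (c d a N : R) : `|c| <= N -> `|d| <= N -> c <= a -> a <= d -> `|a| <= N.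
Proof. by move=> /ler_normlP[? ?] /ler_normlP[? ?] ? ?; rewrite ler_norml; apply/andP; split; lra. Qed.

Let line_locally_integrable :
  {ae mu, forall a, forall N : nat, mu.-integrable `[- N%:R, N%:R] (fun t => (v (line b a t))%:E)}.
Proof.
have [_ Lv _] := wuv.
have H (N : nat) : {ae mu, forall a, `|a| <= N%:R -> mu.-integrable `[- N%:R, N%:R] (fun t => (v (line b a t))%:E)}.
  pose I : R -> R := \1_(`[- N%:R, N%:R]%classic : set R).
  have mI : measurable_fun setT I by exact: measurable_indic.
  have I1 a : `|I a| <= 1 by rewrite /I indicE; case: (_ \in _); rewrite ?normr1 ?normr0.
  have I0 a : ~ (`|a| <= N%:R) -> I a = 0.
    by move=> h; rewrite /I indicE memNset//= in_itv/= -ler_norml.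
  have [+ _ _] := line_fubini b (integrable_product Lv mI mI I1 I1 I0 I0).
  apply: ae_mono => a ia aN.
  apply/integrable_mkcond; first exact: measurable_itv.
  move: ia; congr (_.-integrable _ _); apply/funext => t /=.
  rewrite across_line along_line patchE /I !indicE.
  rewrite (_ : a \in _ = true) ?mul1r; last by rewrite mem_set//= in_itv/= -ler_norml.
  by case: ifP => _; rewrite ?mulr1 ?mulr0.
have : {ae mu, forall a, forall N : nat, `|a| <= N%:R -> mu.-integrable `[- N%:R, N%:R] (fun t => (v (line b a t))%:E)}.
  exact/ae_foralln.
apply: ae_mono => a h N; pose M := maxn N (Num.bound a).
have NM : (N%:R : R) <= M%:R by rewrite ler_nat leq_maxl.
have aM : `|a| <= M%:R.
  by apply: le_trans (ltW (unstable.ltr_norm_bound a)) _; rewrite ler_nat leq_maxr.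
apply: (integrableS _ _ _ (h M aM)) => // t /=; rewrite !in_itv/= => /andP[? ?].
by apply/andP; split; lra.
Qed.

Let line_products a (n : nat) (c d : R) :
  (forall N : nat, mu.-integrable `[- N%:R, N%:R] (fun t => (v (line b a t))%:E)) -> c <= d ->
  mu.-integrable setT (EFin \o (fun t => u (line b a t) * bump_derivative n c d t)) /\
  mu.-integrable setT (EFin \o (fun t => v (line b a t) * bump n c d t)).
Proof.
move=> ia cd; pose N := maxn (Num.bound c) (Num.bound (d + 1)).
have [cN dN] : `|c| <= N%:R /\ `|d + 1| <= N%:R.
  by split; apply: le_trans (ltW (unstable.ltr_norm_bound _)) _; rewrite ler_nat ?leq_maxl ?leq_maxr.
have out t : ~ (`[- N%:R, N%:R]%classic : set R) t -> ~~ (c <= t <= d + 1).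
  move=> h; apply/negP => /andP[h1 h2]; apply: h; rewrite /= in_itv/= -ler_norml.
  exact: interval_abs h1 h2.
have [B hB] := bump_derivative_bounded n cd.
split.
- apply: (@integrable_mul_support _ _ R mu `[- N%:R, N%:R]%classic (fun t => u (line b a t)) (bump_derivative n c d) B) => //.
  + apply: continuous_compact_integrable; first exact: segment_compact.
    by apply: continuous_subspaceT; exact: continuous_on_line.
  + by apply: measurable_funTS; apply: continuous_measurable_fun; exact: continuous_bump_derivative.
  + by move=> t /out; exact: bump_derivative_support.
- apply: (@integrable_mul_support _ _ R mu `[- N%:R, N%:R]%classic (fun t => v (line b a t)) (bump n c d) 1) => //.
  + by apply: measurable_funTS; apply: continuous_measurable_fun; exact: (smooth_bump n c d 0).
  + by move=> t _; exact: bump_bound.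
  + by move=> t /out; exact: bump_support.
Qed.

Let H n (c d a : R) : R :=
  \int[mu]_t (u (line b a t) * bump_derivative n c d t + v (line b a t) * bump n c d t).

(** Fubini applied to the weak derivative tested with a product shows that
    [H n c d], integrated against every smoothed indicator in the transversal
    variable, gives 0. *)
Let line_test n (c d : R) : c <= d -> {ae mu, forall a, H n c d a = 0}.
Proof.
move=> cd; have [Lu Lv wd] := wuv.
have [B hB] := bump_derivative_bounded n cd.
have mb : measurable_fun setT (bump n c d).
  by apply: continuous_measurable_fun; exact: (smooth_bump n c d 0).
have mb' : measurable_fun setT (bump_derivative n c d).
  by apply: continuous_measurable_fun; exact: continuous_bump_derivative.
have big (A0 B0 : R) : exists N : R, [/\ `|A0| <= N, `|B0| <= N,
    forall t, ~ (`|t| <= N) -> bump n c d t = 0 & forall t, ~ (`|t| <= N) -> bump_derivative n c d t = 0].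
  pose N := Num.max (Num.max `|A0| `|B0|) (Num.max `|c| `|d + 1|).
  have [hA hB' hc hd] : [/\ `|A0| <= N, `|B0| <= N, `|c| <= N & `|d + 1| <= N].
    by rewrite /N; split; rewrite !le_max lexx ?orbT.
  by exists N; split => // t /negP h; rewrite ?(bump_support n cd) ?(bump_derivative_support n cd)//;
    apply: contra h => /andP[h1 h2]; exact: interval_abs h1 h2.
have Hint (A B1 : R) : mu.-integrable `[A, B1] (EFin \o H n c d).
  have [N [hA hB1 s0 s1]] := big A B1.
  pose I : R -> R := \1_(`[A, B1]%classic : set R).
  have mI : measurable_fun setT I by exact: measurable_indic.
  have I1 a : `|I a| <= 1 by rewrite /I indicE; case: (_ \in _); rewrite ?normr1 ?normr0.
  have I0 a : ~ (`|a| <= N) -> I a = 0.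
    move=> h; rewrite /I indicE memNset//= in_itv/= => /andP[h1 h2].
    by apply: h; exact: interval_abs h1 h2.
  have i1 := integrable_product Lu mI mb' I1 hB I0 s1.
  have i0 := integrable_product Lv mI mb I1 (@bump_bound _ n c d) I0 s0.
  have [_ iF _] := line_fubini b (integrableD measurableT i1 i0).
  set gg := (X in mu.-integrable _ X) in iF.
  have iG : mu.-integrable `[A, B1] gg by apply: integrableS iF.
  apply: eq_integrable iG => //.
  move=> a; rewrite inE/= in_itv/= => aAB; congr (_%:E); apply: eq_Rintegral => t _.
  by rewrite /= across_line along_line /I indicE mem_set ?mul1r//= in_itv.
apply: ae_eq0_of_bumps => // m c' d' cd'.
have [Tphi dphi] := bump_test_function b n m cd cd'.
set phi := fun p => _ in Tphi dphi.
have [N [hc' hd' s0 s1]] := big c' (d' + 1).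
have sm a : ~ (`|a| <= N) -> bump m c' d' a = 0.
  move=> h; rewrite bump_support//; apply/negP => /andP[h1 h2]; apply: h.
  exact: interval_abs h1 h2.
have mb2 : measurable_fun setT (bump m c' d').
  by apply: continuous_measurable_fun; exact: (smooth_bump m c' d' 0).
have i1 := integrable_product Lu mb2 mb' (@bump_bound _ m c' d') hB sm s1.
have i0 := integrable_product Lv mb2 mb (@bump_bound _ m c' d') (@bump_bound _ n c d) sm s0.
have [_ iF EF] := line_fubini b (integrableD measurableT i1 i0).
have F0 : \int[mu2]_p (u p * (bump m c' d' (across b p) * bump_derivative n c d (along b p)) +
    v p * (bump m c' d' (across b p) * bump n c d (along b p))) = 0.
  rewrite RintegralD//; have := wd phi Tphi.
  under eq_Rintegral do rewrite dphi.
  by move=> ->; rewrite addNr.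
rewrite -F0 EF /Rintegral; congr fine; apply: ae_eq_integral => //.
- pose Hr := (EFin \o H n c d) \_ `[c', d' + 1].
  have iH : mu.-integrable setT Hr.
    by apply/(integrable_mkcond _ _).1.
  have mH := measurable_int _ iH; rewrite (_ : (fun a => _) = (fun a => (bump m c' d' a)%:E * Hr a)%E).
    by apply: emeasurable_funM => //; exact/measurable_EFinP.
  apply/funext => a; rewrite /Hr patchE; case: ifPn => //=.
  by rewrite notin_setE/= in_itv/= => /negP h; rewrite bump_support// mul0e mul0r.
- exact: (measurable_int _ iF).
apply: ae_mono line_locally_integrable => a ia _ /=; congr (_%:E).
have [j1 j0] := line_products n ia cd.
have E := @RintegralZl _ _ R mu setT (fun t => u (line b a t) * bump_derivative n c d t + v (line b a t) * bump n c d t)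
  (bump m c' d' a) measurableT (integrableD measurableT j1 j0).
apply: (etrans (esym E)).
by apply: eq_Rintegral => t _; rewrite across_line along_line mulrDr !(mulrCA (bump m c' d' a)).
Qed.

(** For a fixed interval the tests along the line hold on almost every line. To
    have one exceptional null set for all intervals, only the countably many
    rational ones are tested; [increment_rational] provides the others. *)
Lemma weak_on_lines : {ae mu, forall a,
  (forall c d : R, mu.-integrable `[c, d] (fun t => (v (line b a t))%:E)) /\
  (forall c d : R, c <= d ->
     \int[mu]_(t in `]c, d]) v (line b a t) = u (line b a d) - u (line b a c))}.
Proof.
(* the index enumerates the smoothing parameter and the rational endpoints *)
have Hq (k : nat) : {ae mu, forall a, forall i : nat * (rat * rat), unpickle k = Some i ->
    (ratr i.2.1 : R) <= ratr i.2.2 -> H i.1 (ratr i.2.1) (ratr i.2.2) a = 0}.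
  case: (unpickle k) => [[n [c d]]|]; last by apply: aeW.
  have [cd|dc] := leP (ratr c : R) (ratr d).
    by apply: ae_mono (line_test n cd) => a h i [<-].
  by apply: aeW => a i [<-] /=; rewrite leNgt dc.
have : {ae mu, forall a, forall (k : nat) (i : nat * (rat * rat)), unpickle k = Some i ->
    (ratr i.2.1 : R) <= ratr i.2.2 -> H i.1 (ratr i.2.1) (ratr i.2.2) a = 0}.
  exact/ae_foralln.
move=> aeH; have := ae_and line_locally_integrable aeH.
apply: ae_mono => a [ia ha].
have iv (c d : R) : mu.-integrable `[c, d] (fun t => (v (line b a t))%:E).
  pose N := maxn (Num.bound c) (Num.bound d).
  have [cN dN] : `|c| <= N%:R /\ `|d| <= N%:R.
    by split; apply: le_trans (ltW (unstable.ltr_norm_bound _)) _; rewrite ler_nat ?leq_maxl ?leq_maxr.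
  apply: (integrableS _ _ _ (ia N)) => // t /=; rewrite !in_itv/= => /andP[h1 h2].
  by rewrite -ler_norml; exact: interval_abs h1 h2.
split => //; have cul : continuous (fun t => u (line b a t)).
  exact: continuous_on_line.
apply: increment_rational => // c d cd.
apply: (@weak_to_increment R (fun t => u (line b a t)) (fun t => v (line b a t))) => // n.
have [j1 j0] := line_products n ia cd.
apply/eqP; rewrite -addr_eq0 -RintegralD//; apply/eqP.
exact: (ha _ (n, (c, d)) (pickleK _) cd).
Qed.
End Weak.
End ACL.

(** * Classical partial derivatives almost everywhere *)

Section Classical_derivative.
Context {R : realType}.
Notation mu := (@lebesgue_measure R).
Notation mu2 := (@plane_measure R).
Notation plane := (measurableTypeR R * measurableTypeR R)%type.

Definition slide b (h : R) (p : R * R) := line b (across b p) (along b p + h).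

Lemma continuous_slide b h : continuous (slide b h).
Proof.
case: b => p.
  apply: (@cvg_pair _ _ _ (nbhs p) (nbhs (p.1 + h)) (nbhs p.2) _ _ _ (fun q => q.1 + h) snd); last exact: cvg_snd.
  by apply: cvgD; [exact: cvg_fst|exact: cvg_cst].
apply: (@cvg_pair _ _ _ (nbhs p) (nbhs p.1) (nbhs (p.2 + h)) _ _ _ fst (fun q => q.2 + h)); first exact: cvg_fst.
by apply: cvgD; [exact: cvg_snd|exact: cvg_cst].
Qed.

Lemma measurable_slide b h (u : R * R -> R) : continuous u ->
  measurable_fun setT ((fun p => u (slide b h p)) : plane -> R).
Proof.
move=> cu; apply: plane_continuous_measurable => p.
exact: (@continuous_comp (R * R)%type (R * R)%type R (slide b h) u p (@continuous_slide b h p) (cu _)).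
Qed.

(** Differentiability is expressed by countably many conditions: by continuity of
    [u] it suffices to bound the difference quotients with rational increments. *)
Lemma derivative_set_measurable b (u v : R * R -> R) : continuous u ->
  measurable_fun setT (v : plane -> R) ->
  measurable ([set p | is_derive p (direction b) u (v p)] : set plane).
Proof.
move=> cu mv.
(* the tolerance is [1 / (k + 1)] and the increments are below [1 / (m + 1)] *)
pose A (k m : nat) (q : rat) : set plane := [set p |
  `|ratr q| < m.+1%:R^-1 :> R ->
  `|u (slide b (ratr q) p) - u p - v p * ratr q| <= k.+1%:R^-1 * `|ratr q|].
have mA k m q : measurable (A k m q).
  have [h|h] := boolP (`|ratr q| < m.+1%:R^-1 :> R); last first.
    rewrite (_ : A k m q = setT); first exact: measurableT.
    by apply/seteqP; split => // p _ /=; rewrite /A /= (negbTE h).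
  pose f p := `|u (slide b (ratr q) p) - u p - v p * ratr q|.
  have mf : measurable_fun setT (f : plane -> R).
    apply: measurableT_comp => //; apply: measurable_funB.
      by apply: measurable_funB; [exact: measurable_slide|exact: plane_continuous_measurable].
    by apply: measurable_funM.
  rewrite (_ : A k m q = setT `&` f @^-1` `]-oo, k.+1%:R^-1 * `|ratr q|]).
    by apply: mf => //; exact: measurable_itv.
  apply/seteqP; split => p; rewrite /A /= in_itv/= h; first by move=> /(_ isT).
  by case.
rewrite (_ : [set p | _] = \bigcap_k \bigcup_m ~` \bigcup_q ~` A k m q).
  apply: bigcapT_measurable => k; apply: bigcupT_measurable => m.
  apply: measurableC; apply: bigcupT_measurable_rat => q; exact: measurableC.
apply/seteqP; split => p /=.
  move/is_derive_lineP/is_derive_epsP => H k _.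
  have [d d0 hd] := H k.+1%:R^-1 ltac:(by rewrite invr_gt0).
  have [m hm] : exists m : nat, m.+1%:R^-1 < d.
    exists (Num.bound d^-1); rewrite invf_plt ?posrE//.
    by apply: lt_trans (unstable.ltr_bound _) _; rewrite ltr_nat.
  exists m => //; case=> q _; apply => qm.
  by have := hd _ (lt_trans qm hm); rewrite line_across_along.
move=> H; apply/is_derive_lineP/is_derive_epsP => e e0.
have [k hk] : exists k : nat, k.+1%:R^-1 < e.
  exists (Num.bound e^-1); rewrite invf_plt ?posrE//.
  by apply: lt_trans (unstable.ltr_bound _) _; rewrite ltr_nat.
have [m _ hm] := H k I; exists m.+1%:R^-1; first by rewrite invr_gt0.
move=> h hh; rewrite leNgt; apply/negP => hlt.
pose f (x : R) := `|u (slide b x p) - u p - v p * x| - e * `|x|.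
have cf : continuous f.
  move=> x; apply: cvgB.
    apply: cvg_norm; apply: cvgB; last by apply: cvgM; [exact: cvg_cst|exact: cvg_id].
    apply: cvgB; last exact: cvg_cst.
    have cl := @continuous_on_line R b (across b p) u cu.
    apply: (@continuous_comp R R R (fun y => along b p + y) (fun t => u (line b (across b p) t)) x); last exact: cl.
    by apply: cvgD; [exact: cvg_cst|exact: cvg_id].
  by apply: cvgM; [exact: cvg_cst|apply: cvg_norm; exact: cvg_id].
have fh : 0 < f h by rewrite /f subr_gt0 /slide; rewrite line_across_along in hlt.
have [d d0 hd] := continuous_eps cf h fh.
have hm1 : h < Num.min m.+1%:R^-1 (h + d) by move: hh; rewrite ltr_norml lt_min ltrDl d0 => /andP[_ ->].
have [q /andP[]] := rat_in_itvoo hm1; rewrite !bnd_simp lt_min => hq /andP[qm qd].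
have qm2 : `|ratr q| < m.+1%:R^-1 :> R.
  by move: hh; rewrite !ltr_norml qm andbT => /andP[h1 _]; exact: lt_trans hq.
have := hd (ratr q); rewrite ltr_norml => /(_ ltac:(apply/andP; split; lra)).
rewrite ltr_norml => /andP[fq _].
apply: hm; exists q => // /(_ qm2) Aq.
have : f (ratr q) <= 0.
  rewrite /f subr_le0; apply: le_trans Aq _; apply: ler_wpM2r => //; exact: ltW.
lra.
Qed.

Lemma ae_derivable_of_lines b (u v : R * R -> R) : continuous u ->
  measurable_fun setT (v : plane -> R) ->
  {ae mu, forall a, {ae mu, forall t : R, is_derive t 1 (fun t => u (line b a t)) (v (line b a t))}} ->
  {ae mu2, forall p, is_derive p (direction b) u (v p)}.
Proof.
move=> cu mv H; have mD := derivative_set_measurable b cu mv.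
exists (~` [set p | is_derive p (direction b) u (v p)]); split => //.
  exact: measurableC.
apply/(@line_null R b); first exact: measurableC.
apply: ae_mono H => a; apply: ae_mono => t dt /=; apply.
by apply/is_derive_lineP; rewrite across_line along_line.
Qed.

Lemma weak_ae_derivable b (u v : R * R -> R) : continuous u ->
  weak_derivative setT (direction b) u v ->
  {ae mu2, forall p, is_derive p (direction b) u (v p)}.
Proof.
move=> cu wuv; have [_ [mv _] _] := wuv; apply: ae_derivable_of_lines => //.
apply: ae_mono (weak_on_lines cu wuv) => a [ia Ha].
exact: ae_derivable_of_increment.
Qed.

(** The derivatives on the individual lines come without any measurability across
    the lines. The superior limit of the difference quotients with increments
    [1 / (n + 1)] is measurable in the plane and agrees with them wherever they
    exist. *)
Lemma lipschitz_partial b (u : R * R -> R) (C : R) : continuous u ->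
  (forall a s t, `|u (line b a s) - u (line b a t)| <= C * `|s - t|) ->
  exists v : R * R -> R, [/\ measurable_fun setT (v : plane -> R),
    forall p, `|v p| <= C &
    {ae mu2, forall p, is_derive p (direction b) u (v p)}].
Proof.
move=> cu lu.
have C0 : 0 <= C by have := lu 0 1 0; rewrite subr0 normr1 mulr1; exact: le_trans.
pose q (n : nat) p := n.+1%:R * (u (slide b n.+1%:R^-1 p) - u p).
have qC n p : `|q n p| <= C.
  rewrite /q normrM ger0_norm//; have := lu (across b p) (along b p + n.+1%:R^-1) (along b p).
  rewrite line_across_along (addrAC (along b p)) subrr add0r [X in C * X]ger0_norm// => h.
  by rewrite mulrC -ler_pdivlMr// -[_ / _]/(C * n.+1%:R^-1).
(* where the derivative exists it lies in [[- C, C]], and the truncation keeps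
   [v] bounded elsewhere *)
pose v p := Num.min C (Num.max (- C) (limn_sup (q ^~ p))).
have mv : measurable_fun setT (v : plane -> R).
  apply: measurable_minr => //; apply: measurable_maxr => //.
  apply: measurable_fun_limn_sup => [p _|p _|n].
  - by exists C => _ [n _ <-]; have := qC n p; rewrite ler_norml => /andP[].
  - by exists (- C) => _ [n _ <-]; have := qC n p; rewrite ler_norml => /andP[].
  - apply: measurable_funM => //; apply: measurable_funB; [exact: measurable_slide|exact: plane_continuous_measurable].
exists v; split => //.
  move=> p; rewrite ler_norml /v le_min ge_min !le_max !lexx/= andbT; lra.
have dv p l : is_derive p (direction b) u l -> is_derive p (direction b) u (v p).
  move=> dl; suff -> : v p = l by [].
  have ql : q ^~ p @ \oo --> l.
    apply/cvgrPdist_le => e e0.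
    have /is_derive_lineP/is_derive_epsP/(_ e e0)[d d0 hd] := dl.
    near=> n; have nd : n.+1%:R^-1 < d.
      rewrite invf_plt ?posrE//; apply: (@le_lt_trans _ _ n%:R); last by rewrite ltr_nat.
      by near: n; exact: nbhs_infty_ger.
    have := hd n.+1%:R^-1; rewrite ger0_norm// => /(_ nd); rewrite line_across_along => h.
    rewrite distrC /q -(@ler_pM2r _ n.+1%:R^-1) ?invr_gt0// (le_trans _ h)//.
    rewrite -[X in _ * X]ger0_norm// -normrM /slide.
    by rewrite mulrBl mulrAC divff// mul1r.
  have lC : `|l| <= C.
    rewrite -(cvg_lim (@Rhausdorff R) (cvg_norm ql)); apply: limr_le.
      by apply/cvg_ex; exists `|l|; exact: cvg_norm.
    by apply: nearW => n; exact: qC.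
  rewrite /v (cvg_limn_inf_sup ql).2; move: lC; rewrite ler_norml => /andP[l1 l2].
  by rewrite (max_idPr l1) (min_idPr l2).
apply: ae_derivable_of_lines => //.
apply: aeW => a.
have loc (N : nat) : {ae mu, forall t : R, - N.+1%:R < t < N.+1%:R ->
    is_derive t 1 (fun t => u (line b a t)) (v (line b a t))}.
  have N0 : - N.+1%:R < N.+1%:R :> R by rewrite gtrN.
  have [h [_ _]] := lipschitz_ae_derivable (lu a) N0.
  apply: ae_mono => t ht /ht dt.
  have : is_derive (line b a t) (direction b) u (h t) by apply/is_derive_lineP; rewrite across_line along_line.
  by move/dv/is_derive_lineP; rewrite across_line along_line.
have : {ae mu, forall (t : R) (N : nat), - N.+1%:R < t < N.+1%:R ->
    is_derive t 1 (fun t => u (line b a t)) (v (line b a t))}.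
  exact/ae_foralln.
apply: ae_mono => t /(_ (Num.bound t)); apply; rewrite -ltr_norml.
by apply: lt_trans (unstable.ltr_norm_bound _) _; rewrite ltr_nat.
Unshelve. all: by end_near.
Qed.

End Classical_derivative.

(** * Weak derivatives of Lipschitz functions *)

Section Integration_by_parts.
Context {R : realType}.
Notation mu := (@lebesgue_measure R).
Notation mu2 := (@plane_measure R).
Notation plane := (measurableTypeR R * measurableTypeR R)%type.

Lemma test_function_square (phi : R * R -> R) : test_function setT phi ->
  exists N : R, forall p, ~ square N p -> phi p = 0.
Proof.
move=> [_ cK _]; have [M [_ hM]] := compact_bounded cK.
exists (M + 1) => p np; apply/eqP; apply: contra_notT np => phi0.
have := hM (M + 1) ltac:(lra) p (@subset_closure _ _ p phi0).
by rewrite /= prod_normE/= ge_max => /andP[].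
Qed.

Lemma derivative_outside_square b (phi : R * R -> R) (N : R) :
  (forall p, ~ square N p -> phi p = 0) ->
  forall p, ~ square N p -> 'D_(direction b) phi p = 0.
Proof.
move=> phi0 p np; suff [_ //] : is_derive p (direction b) phi 0.
apply/is_derive_lineP.
have [d d0 hd] : exists2 d : R, 0 < d &
    forall t, `|t - along b p| < d -> ~ square N (line b (across b p) t).
  move: np; rewrite -{1}(line_across_along b p) square_line => np.
  have [ha|ha] := leP `|across b p| N; last first.
    by exists 1 => // t _; rewrite square_line => -[]; rewrite leNgt ha.
  have [ht|ht] := leP `|along b p| N; first by exfalso; apply: np.
  exists (`|along b p| - N); first by rewrite subr_gt0.
  move=> t td; rewrite square_line => -[_ tN].
  have := ler_normB t (t - along b p); rewrite subKr; lra.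
by apply: (is_derive_near d0 _ (is_derive_cst1 (along b p) 0)) => t /hd /phi0.
Qed.

Lemma bounded_outside_square (f : R * R -> R) (N : R) : continuous f ->
  (forall p, ~ square N p -> f p = 0) -> exists M, forall p, `|f p| <= M.
Proof.
move=> cf f0; have [M [_ hM]] := compact_bounded (continuous_compact (continuous_subspaceT cf) (@square_compact R N)).
exists (Num.max (M + 1) 0) => p; rewrite le_max.
have [sp|/f0->] := pselect (square N p); last by rewrite normr0 lexx orbT.
by apply/orP; left; apply: (hM (M + 1)); [lra|exists p].
Qed.

Lemma lipschitz_of_derivative (f df : R -> R) (M : R) :
  (forall t : R, is_derive t 1 f (df t)) -> (forall t, `|df t| <= M) ->
  forall s t, `|f s - f t| <= M * `|s - t|.
Proof.
move=> dF dM; suff H s t : s <= t -> `|f t - f s| <= M * `|t - s|.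
  by move=> s t; have [st|/ltW ts] := leP s t; [rewrite distrC (distrC s)|]; exact: H.
move=> st; have [|c _ ->] := @MVT_segment R f df s t st (fun x _ => dF x).
  by apply: continuous_subspaceT => x; exact: is_derive_continuous (dF x).
by rewrite normrM ler_wpM2r.
Qed.

Lemma lipschitz_continuousR (f : R -> R) (C : R) :
  (forall s t, `|f s - f t| <= C * `|s - t|) -> continuous f.
Proof.
move=> lf t; apply/continuous_epsP => e e0.
have C0 : 0 <= C by have := lf 1 0; rewrite subr0 normr1 mulr1; exact: le_trans.
exists (e / (C + 1)); first by rewrite divr_gt0// ltr_wpDl.
move=> u ut; apply: le_lt_trans (lf _ _) _.
have C1 : 0 < C + 1 by rewrite ltr_wpDl.
move: ut; rewrite ltr_pdivlMr// mulrC; apply: le_lt_trans; apply: ler_wpM2r => //; lra.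
Qed.

Lemma ae_neq (c : R) : {ae mu, forall t : R, t <> c}.
Proof.
exists [set c]; split; [exact: measurable_set1|exact: lebesgue_measure_set1|].
by move=> t /= /contrapT.
Qed.

(** On almost every line the product of [u] and a test function is Lipschitz
    with bounded support, so that its derivative has integral zero. *)
Lemma line_parts (u v phi dphi : R -> R) (C N M M' : R) :
  (forall s t, `|u s - u t| <= C * `|s - t|) ->
  {ae mu, forall t : R, is_derive t 1 u (v t)} ->
  measurable_fun setT (v : measurableTypeR R -> R) ->
  (forall t : R, is_derive t 1 phi (dphi t)) -> continuous dphi ->
  (forall t, `|phi t| <= M) -> (forall t, `|dphi t| <= M') ->
  (forall t, ~ (`|t| <= N) -> phi t = 0) -> (forall t, ~ (`|t| <= N) -> dphi t = 0) ->
  \int[mu]_t (u t * dphi t + v t * phi t) = 0.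
Proof.
move=> lu du mv dp cdp hM hM' p0 dp0.
pose N1 := Num.max N 0 + 1.
have [NN1 N10] : N < N1 /\ 0 < N1.
  have h1 : N <= Num.max N 0 by rewrite le_max lexx.
  have h2 : 0 <= Num.max N 0 by rewrite le_max lexx orbT.
  by split; rewrite /N1; lra.
have cu : continuous u.
  exact: lipschitz_continuousR lu.
have [U hU] : exists U, forall t, `|t| <= N1 -> `|u t| <= U.
  have NN : - N1 <= N1 by lra.
  have cau : continuous (fun t => `|u t|) by move=> t; apply: cvg_norm; exact: cu.
  have [c _ hc] := EVT_max NN (continuous_subspaceT cau).
  by exists `|u c| => t; rewrite ler_norml => tN; apply: hc; rewrite in_itv.
have lphi := lipschitz_of_derivative dp hM'.
pose G t := u t * phi t.
have C0 : 0 <= C by have := lu 1 0; rewrite subr0 normr1 mulr1; exact: le_trans.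
have M0 : 0 <= M by exact: le_trans (hM 0).
have M'0 : 0 <= M' by exact: le_trans (hM' 0).
have U0 : 0 <= U by apply: le_trans (hU 0 _) => //; rewrite normr0 ltW.
have lG1 s t : `|t| <= N -> `|G s - G t| <= (M * C + U * M') * `|s - t|.
  move=> tN; rewrite (_ : G s - G t = (u s - u t) * phi s + u t * (phi s - phi t)); last by rewrite /G; ring.
  apply: le_trans (ler_normD _ _) _; rewrite !normrM mulrDl; apply: lerD.
    by rewrite -mulrA mulrC; apply: ler_pM.
  rewrite -mulrA; apply: ler_pM => //; apply: hU; exact: le_trans (ltW NN1).
have lG s t : `|G s - G t| <= (M * C + U * M') * `|s - t|.
  have [/lG1//|tN] := leP `|t| N.
  have [sN|sN] := leP `|s| N; first by rewrite distrC (distrC s); exact: lG1.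
  rewrite /G !p0 ?mulr0 ?subrr ?normr0 ?mulr_ge0 ?addr_ge0 ?mulr_ge0//; by apply/negP; rewrite -ltNge.
have NN : - N1 < N1 by lra.
have [h [ih Eh dh]] := lipschitz_ae_derivable lG NN.
have GN1 t : `|t| = N1 -> G t = 0.
  by move=> tN; rewrite /G p0 ?mulr0// tN; apply/negP; rewrite -ltNge.
rewrite !GN1 ?subrr ?normrN ?ger0_norm ?(ltW N10)// in Eh.
have out t : ~~ (- N1 < t < N1) -> ~ (`|t| <= N).
  rewrite -ltr_norml -leNgt => h1 h2; have := le_trans h1 h2; lra.
pose I := `[- N1, N1]%classic : set (measurableTypeR R).
have mI : measurable I by exact: measurable_itv.
have mF : measurable_fun setT (fun t : measurableTypeR R => u t * dphi t + v t * phi t).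
  have mphi : measurable_fun setT phi.
    by apply: continuous_measurable_fun => t; exact: is_derive_continuous (dp t).
  have mdphi := continuous_measurable_fun cdp.
  have mu' := continuous_measurable_fun cu.
  by apply: measurable_funD; [exact: (measurable_funM mu' mdphi)|exact: (measurable_funM mv mphi)].
rewrite -Eh; transitivity (\int[mu]_(t in I) (u t * dphi t + v t * phi t)).
  rewrite [RHS]Rintegral_mkcond; apply: eq_Rintegral => t _; rewrite patchE.
  case: ifPn => //; rewrite notin_setE /I /= in_itv/= => h1.
  have tN : ~ `|t| <= N.
    by apply: out; apply/negP => /andP[h2 h3]; apply: h1; rewrite !ltW.
  by rewrite p0// dp0// !mulr0 addr0.
rewrite /Rintegral; congr fine; apply: ae_eq_integral => //.
- by apply/measurable_EFinP; exact: measurable_funTS.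
- exact: (measurable_int _ ih).
have nul : {ae mu, forall t : R, t <> - N1 /\ t <> N1}.
  by apply: ae_and; exact: ae_neq.
apply: ae_mono (ae_and (ae_and du dh) nul) => t [[dut dht] [t1 t2]] It; congr (_%:E).
have tN : - N1 < t < N1.
  move: It; rewrite /I /= in_itv/= => /andP[h1 h2]; rewrite !lt_neqAle h1 h2 !andbT.
  by apply/andP; split; apply/eqP => // /esym.
apply: (is_derive_unique _ (dht tN)).
by apply: (is_derive_eqval (is_deriveM1 dut (dp t))); rewrite addrC.
Qed.

(** Integration by parts on almost every line, integrated over the lines. *)
Lemma lipschitz_weak_derivative b (u : R * R -> R) (C : R) : continuous u ->
  (forall a s t, `|u (line b a s) - u (line b a t)| <= C * `|s - t|) ->
  exists2 v, weak_derivative setT (direction b) u v &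
    {ae mu2, forall p, is_derive p (direction b) u (v p)}.
Proof.
move=> cu lu; have [v [mv vC dv]] := lipschitz_partial cu lu.
exists v => //.
have Lv : L1loc setT v.
  split => // K _ cK; apply: (@bounded_plane_integrable R K v C) => //.
have Lu := continuous_L1loc cu.
split => // phi tphi; have [N phi0] := test_function_square tphi.
have Dphi0 := derivative_outside_square b phi0.
have [smooth_phi _ _] := tphi.
have cphi : continuous phi := (smooth_phi 0%N).1.
have [cDphi derphi] : continuous ('D_(direction b) phi) /\ forall p, is_derive p (direction b) phi ('D_(direction b) phi p).
  have [_ [dx dy [cx _] [cy _]]] := smooth_phi 1%N.
  clear lu dv Dphi0; case: b.
    split; first exact: cx.
    by move=> p; split; [exact: dx|].
  split; first exact: cy.
  by move=> p; split; [exact: dy|].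
have [M hM] := bounded_outside_square cphi phi0.
have [M' hM'] := bounded_outside_square cDphi Dphi0.
have sq := compact_plane_measurable (@square_compact R N).
have i1 : mu2.-integrable setT (EFin \o (u \* 'D_(direction b) phi)).
  apply: (@integrable_mul_support _ _ R mu2 (square N) u ('D_(direction b) phi) M') => //.
    by apply: Lu.2 => //; exact: square_compact.
  by apply: measurable_funTS; exact: plane_continuous_measurable.
have i0 : mu2.-integrable setT (EFin \o (v \* phi)).
  apply: (@integrable_mul_support _ _ R mu2 (square N) v phi M) => //.
    by apply: Lv.2 => //; exact: square_compact.
  by apply: measurable_funTS; exact: plane_continuous_measurable.
apply/eqP; rewrite -addr_eq0 -RintegralD//; apply/eqP.
have [_ iF ->] := line_fubini b (integrableD measurableT i1 i0).
rewrite /Rintegral; set J := (X in fine X); suff -> : J = 0%E by [].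
transitivity (\int[mu]_a (0 : \bar R))%E; last exact: integral0.
apply: ae_eq_integral => //; first exact: (measurable_int _ iF).
apply: ae_mono (ae_line b dv) => a dva _ /=; congr (_%:E).
have dphi (t : R) : is_derive t 1 (fun t => phi (line b a t)) ('D_(direction b) phi (line b a t)).
  by have /is_derive_lineP := derphi (line b a t); rewrite across_line along_line.
apply: (@line_parts (fun t => u (line b a t)) (fun t => v (line b a t)) (fun t => phi (line b a t))
  (fun t => 'D_(direction b) phi (line b a t)) C N M M') => //.
- apply: ae_mono dva => t /is_derive_lineP; by rewrite across_line along_line.
- exact: (measurableT_comp mv (measurable_line b a)).
- exact: (@continuous_on_line R b a _ cDphi).
- by move=> t tN; apply: phi0; rewrite square_line => -[].
- by move=> t tN; apply: Dphi0; rewrite square_line => -[].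
Qed.

End Integration_by_parts.

(** * The phase of a planar curve *)

Section Phase_of_curve.
Context {R : realType}.
Variables (g : R -> R[i]) (rho Phi : R -> R) (y0 : R).
Hypotheses (g_polar : forall y, g y = (rho y)%:C * expi (Phi y))
  (rho_gt0 : forall y, 0 < rho y) (Phi_cont : {for y0, continuous Phi}).

Let turned y := g y * expi (- Phi y0).

Let turnedE y : turned y = (rho y)%:C * expi (Phi y - Phi y0).
Proof. by rewrite /turned g_polar -mulrA -expiD. Qed.

Let phase_near : exists2 d : R, 0 < d & forall y, `|y - y0| < d ->
  0 < complex.Re (turned y) /\
  Phi y = Phi y0 + atan (complex.Im (turned y) / complex.Re (turned y)).
Proof.
have p4 : 0 < pi / 4 :> R by rewrite divr_gt0// pi_gt0.
have [d d0 hd] := (continuous_epsP Phi y0).1 Phi_cont _ p4.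
exists d => // y /hd; rewrite ltr_norml => /andP[h1 h2].
have pp := @pi_gt0 R.
have c0 : 0 < cos (Phi y - Phi y0) by apply: cos_gt0_pihalf; apply/andP; split; lra.
have rn : rho y != 0 by rewrite gt_eqF.
rewrite turnedE !ReImE /= !mul0r subr0 addr0; split; first exact: mulr_gt0.
rewrite (_ : _ / _ = tan (Phi y - Phi y0)); last by rewrite /tan; field; rewrite rn gt_eqF.
by rewrite tanK ?in_itv/=; [ring|apply/andP; split; lra].
Qed.

(** After rotation by [- Phi y0] the curve is near the positive real axis, where
    its phase is the arctangent of the quotient of its components. *)
Lemma phase_is_derive (l : R[i]) : is_cderive g y0 l ->
  is_derive y0 1 Phi (complex.Im (l * expi (- Phi y0)) / rho y0).
Proof.
move=> [dx dy]; have [d d0 hd] := phase_near.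
have cx (a : R) : is_derive y0 1 (fun y => complex.Re (g y) * a) (complex.Re l * a) by exact: is_deriveZr1.
have cy (a : R) : is_derive y0 1 (fun y => complex.Im (g y) * a) (complex.Im l * a) by exact: is_deriveZr1.
pose c := cos (- Phi y0); pose s := sin (- Phi y0).
have dRe : is_derive y0 1 (fun y => complex.Re (turned y)) (complex.Re l * c - complex.Im l * s).
  rewrite (_ : (fun y => _) = (fun y => complex.Re (g y) * c - complex.Im (g y) * s)); last first.
    by apply/funext => y; rewrite /turned; case: (g y).
  exact: is_deriveB1.
have dIm : is_derive y0 1 (fun y => complex.Im (turned y)) (complex.Re l * s + complex.Im l * c).
  rewrite (_ : (fun y => _) = (fun y => complex.Re (g y) * s + complex.Im (g y) * c)); last first.
    by apply/funext => y; rewrite /turned; case: (g y).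
  exact: is_deriveD1.
have T0 : turned y0 = (rho y0)%:C by rewrite turnedE subrr expi0 mulr1.
have rn : rho y0 != 0 by rewrite gt_eqF.
have Rn : complex.Re (turned y0) != 0 by rewrite T0.
have dV := is_deriveV1 Rn dRe.
have dQ := is_deriveM1 dIm dV.
have dA := is_derive_comp1 (is_derive1_atan _) dQ.
apply: (is_derive_near d0 _ (is_derive_eqval (is_deriveDc1 (Phi y0) dA) _)) => [u /hd[_ ->]//|].
rewrite T0 /= !mul0r expr0n/= addr0 invr1 mul1r addr0.
by case: (l) => a b /=; rewrite -/c -/s addrC.
Qed.

(** In the rotated frame the imaginary part is at most the displacement and the
    real part at least [rho y0 / 2], and the arctangent is 1-Lipschitz. *)
Lemma phase_lipschitz (B : R) : (forall y, modulus (g y - g y0) <= B * `|y - y0|) ->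
  exists2 d : R, 0 < d & forall y, `|y - y0| < d ->
    `|Phi y - Phi y0| <= 2 * B / rho y0 * `|y - y0|.
Proof.
move=> lg; have [d d0 hd] := phase_near.
have r0 := rho_gt0 y0.
have B0 : 0 <= B by have := lg (y0 + 1); rewrite addrAC subrr add0r normr1 mulr1; apply: le_trans; exact: modulus_ge0.
pose d1 := rho y0 / (2 * (B + 1)).
have d10 : 0 < d1 by rewrite divr_gt0// mulr_gt0// ltr_wpDl.
exists (Num.min d d1); first by rewrite lt_min d0.
move=> y; rewrite lt_min => /andP[/hd[Re0 ->] yd1].
have hB : B * `|y - y0| <= rho y0 / 2.
  have : (B + 1) * `|y - y0| <= rho y0 / 2.
    have B1 : 0 < B + 1 by lra.
    by move: (ltW yd1); rewrite /d1 invfM mulrA ler_pdivlMr// mulrC.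
  by apply: le_trans; rewrite ler_wpM2r// lerDl.
have T0 : turned y0 = (rho y0)%:C by rewrite turnedE subrr expi0 mulr1.
have mT : modulus (turned y - turned y0) <= B * `|y - y0|.
  by rewrite /turned -mulrBl modulusM modulus_expi mulr1.
have hI : `|complex.Im (turned y)| <= B * `|y - y0|.
  apply: le_trans mT; apply: le_trans (Im_le_modulus _).
  by rewrite T0 raddfB /= subr0.
have hR : rho y0 / 2 <= complex.Re (turned y).
  have : `|complex.Re (turned y - turned y0)| <= B * `|y - y0| by apply: le_trans mT; exact: Re_le_modulus.
  rewrite T0 raddfB /= => /ler_normlP[h1 _]; lra.
rewrite addrAC subrr add0r.
have atan_le (x : R) : `|atan x| <= `|x|.
  have := @lipschitz_of_derivative R atan (fun x => (1 + x ^+ 2)^-1) 1 (fun x => is_derive1_atan x) _ x 0.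
  rewrite atan0 !subr0 mul1r; apply => z.
  have h : 1 <= 1 + z ^+ 2 by rewrite lerDl sqr_ge0.
  by rewrite ger0_norm ?invr_ge0 ?invf_le1//; lra.
apply: le_trans (atan_le _) _; rewrite normrM normfV (ger0_norm (ltW Re0)).
rewrite ler_pdivrMr//; apply: le_trans hI _.
rewrite [leRHS](_ : _ = B * `|y - y0| * (2 * complex.Re (turned y) / rho y0)); last by ring.
rewrite ler_peMr ?mulr_ge0// ler_pdivlMr// mul1r; lra.
Qed.

End Phase_of_curve.

(** * Partial derivatives of the radial extension *)

Section Polar_chain.
Context {R : realType}.

Lemma polar_chain (lam th psi : R -> R) (P : R -> R[i]) (u0 dl dth q : R) (V : R[i]) :
  is_derive u0 1 lam dl -> is_derive u0 1 th dth -> is_derive (th u0) 1 psi q ->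
  is_cderive P (psi (th u0)) V ->
  is_cderive (fun u => (lam u)%:C * P (psi (th u))) u0
    (dl%:C * P (psi (th u0)) + (lam u0 * (q * dth))%:C * V).
Proof.
move=> dlam dt dpsi [dRe dIm].
have dc := is_derive_comp1 dpsi dt.
have h1 := is_deriveM1 dlam (is_derive_comp1 dRe dc).
have h2 := is_deriveM1 dlam (is_derive_comp1 dIm dc).
split.
  rewrite (_ : (fun u => _) = (fun u => lam u * complex.Re (P (psi (th u))))).
    by apply: (is_derive_eqval h1); case: (V) (P _) => a b [a' b'] /=; ring.
  by apply/funext => u; case: (P _) => a b /=; rewrite mul0r subr0.
rewrite (_ : (fun u => _) = (fun u => lam u * complex.Im (P (psi (th u))))).
  by apply: (is_derive_eqval h2); case: (V) (P _) => a b [a' b'] /=; ring.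
by apply/funext => u; case: (P _) => a b /=; rewrite mul0r addr0.
Qed.

End Polar_chain.

Section Half_planes.
Context {R : realType}.

(** A branch of the argument on each of the half-planes [x > 0] and [x < 0]. *)
Definition half_arg (x y : R) : R := atan (y / x) + (if 0 < x then 0 else pi).

Lemma half_arg_polar (x y : R) : x != 0 ->
  toC (x, y) = (modulus (toC (x, y)))%:C * expi (half_arg x y).
Proof.
rewrite /half_arg /toC /=; case: (ltgtP x 0) => // x0 _.
  have h : 0 < complex.Re (- (x +i* y)) by rewrite /=; lra.
  have E : x +i* y = - (- (x +i* y)) by rewrite opprK.
  rewrite {1}E {1}(polar_atan h) modulusN /= invrN mulrNN expiD.
  have -> : expi (pi : R) = -1 by apply: complex_ext; rewrite ReImE /= ?cospi ?sinpi ?oppr0.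
  by rewrite mulrN1 mulrN.
have h : 0 < complex.Re (x +i* y) by [].
by rewrite {1}(polar_atan h) /= addr0.
Qed.

Section At_point.
Variables (x y : R).
Hypothesis x_neq0 : x != 0.

Let z : R[i] := x +i* y.
Let lam := modulus z.
Let t := half_arg x y.

Lemma half_arg_modulus_gt0 : 0 < lam.
Proof.
by rewrite modulus_gt0; apply/eqP => -[xz _]; move: x_neq0; rewrite xz eqxx.
Qed.

Let ln0 : lam != 0. Proof. by rewrite gt_eqF// half_arg_modulus_gt0. Qed.

Lemma half_arg_coordinates : x = lam * cos t /\ y = lam * sin t.
Proof.
have := half_arg_polar y x_neq0; rewrite /toC /= -/z -/lam -/t => E.
by split; [have := congr1 (@complex.Re R) E|have := congr1 (@complex.Im R) E];
  rewrite /= !mul0r ?subr0 ?addr0.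
Qed.

Let lam_sqr : lam ^+ 2 = x ^+ 2 + y ^+ 2.
Proof.
have [hx hy] := half_arg_coordinates.
by rewrite [in RHS]hx [in RHS]hy !exprMn -mulrDr cos2Dsin2 mulr1.
Qed.

Let sqn0 : x ^+ 2 + y ^+ 2 != 0. Proof. by rewrite -lam_sqr expf_neq0. Qed.

Lemma is_derive_half_arg_y : is_derive y 1 (half_arg x) (cos t / lam).
Proof.
have d1 := is_deriveZr1 x^-1 (is_derive_id1 y).
have d2 := is_derive_comp1 (is_derive1_atan _) d1.
apply: (is_derive_eqval (is_deriveD1 d2 (is_derive_cst1 y (if 0 < x then 0 else pi)))).
have [hx hy] := half_arg_coordinates.
rewrite addr0 mul1r (_ : cos t / lam = x / lam ^+ 2); last first.
  by rewrite {1}hx; field.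
by rewrite lam_sqr; field; rewrite x_neq0 sqn0.
Qed.

Lemma is_derive_half_arg_x : is_derive x 1 (half_arg^~ y) (- sin t / lam).
Proof.
have d1 := is_deriveZ1 y (is_deriveV1 x_neq0 (is_derive_id1 x)).
have d2 := is_derive_comp1 (is_derive1_atan _) d1.
have d3 := is_deriveD1 d2 (is_derive_cst1 x (if 0 < x then 0 else pi)).
have x0 : 0 < `|x| by rewrite normr_gt0.
have [hx hy] := half_arg_coordinates.
apply: (is_derive_near x0 _ (is_derive_eqval d3 _)) => [u ux|].
  rewrite /half_arg; congr (_ + _); move: ux.
  case: (ltgtP x 0) x_neq0 => // xl _; rewrite ltr_norml => /andP[u1 u2].
    by rewrite (ltr0_norm xl) in u1 u2; case: ltP => // h; exfalso; lra.
  by rewrite (gtr0_norm xl) in u1 u2; case: ltP => // h; exfalso; lra.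
rewrite addr0 (_ : - sin t / lam = - y / lam ^+ 2); last first.
  by rewrite {1}hy; field.
by rewrite lam_sqr; field; rewrite x_neq0 sqn0.
Qed.

End At_point.

Lemma modulus_half_arg (x y : R) : x != 0 ->
  modulus (x +i* y) = x * cos (half_arg x y) + y * sin (half_arg x y).
Proof.
move=> x0; have [hx hy] := half_arg_coordinates y x0.
rewrite -[LHS]mulr1 -(cos2Dsin2 (half_arg x y)) mulrDr !expr2 !mulrA.
by rewrite -hx -hy.
Qed.

Lemma is_derive_modulus_y (x y : R) : x != 0 ->
  is_derive y 1 (fun y => modulus (x +i* y)) (sin (half_arg x y)).
Proof.
move=> x0; have dt := is_derive_half_arg_y y x0.
rewrite (_ : (fun y => _) = (fun y => x * cos (half_arg x y) + y * sin (half_arg x y))); last first.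
  by apply/funext => u; exact: modulus_half_arg.
have dc := is_derive_comp1 (is_derive_cos _) dt.
have ds := is_derive_comp1 (is_derive_sin _) dt.
apply: (is_derive_eqval (is_deriveD1 (is_deriveZ1 x dc) (is_deriveM1 (is_derive_id1 y) ds))).
have [hx hy] := half_arg_coordinates y x0.
move: hx hy; set l := modulus _; set t := half_arg x y => -> ->; rewrite mul1r.
have ln : l != 0 by rewrite gt_eqF//; exact: (half_arg_modulus_gt0 y x0).
by field.
Qed.

Lemma is_derive_modulus_x (x y : R) : x != 0 ->
  is_derive x 1 (fun x => modulus (x +i* y)) (cos (half_arg x y)).
Proof.
move=> x0; have dt := is_derive_half_arg_x y x0.
have dc := is_derive_comp1 (is_derive_cos _) dt.
have ds := is_derive_comp1 (is_derive_sin _) dt.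
have ax0 : 0 < `|x| by rewrite normr_gt0.
apply: (is_derive_near ax0 _ (is_derive_eqval
  (is_deriveD1 (is_deriveM1 (is_derive_id1 x) dc) (is_deriveZ1 y ds)) _)) => [u ux|].
  rewrite modulus_half_arg//; apply/eqP => u0; move: ux.
  by rewrite u0 sub0r normrN ltxx.
have [hx hy] := half_arg_coordinates y x0.
move: hx hy; set l := modulus _; set t := half_arg x y => -> ->; rewrite mul1r.
have ln : l != 0 by rewrite gt_eqF//; exact: (half_arg_modulus_gt0 y x0).
by field.
Qed.

End Half_planes.

Section Radial_partials.
Context {R : realType}.
Variables (r psi kap : R -> R) (w : R[i] -> R[i]).
Let P s := (r s)%:C * expi s.
Let V s := P s * (kap s +i* 1).
Hypotheses (dP : forall s, is_cderive P s (V s)) (r_gt0 : forall s, 0 < r s)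
  (psi_cont : continuous psi)
  (w_polar : forall lam t, 0 <= lam -> w (lam%:C * expi t) = lam%:C * P (psi t)).

Lemma w_half_arg x y : x != 0 ->
  w (x +i* y) = (modulus (x +i* y))%:C * P (psi (half_arg x y)).
Proof.
by move=> x0; rewrite {1}(_ : x +i* y = toC (x, y))// (half_arg_polar y x0) w_polar// modulus_ge0.
Qed.

Lemma cos_half_arg_neq0 (x y : R) : x != 0 -> cos (half_arg x y) != 0.
Proof.
move=> x0; have [hx _] := half_arg_coordinates y x0; apply/eqP => c0.
by move: x0; rewrite hx c0 mulr0 eqxx.
Qed.

Lemma half_arg_y_continuous (x : R) : x != 0 -> continuous (half_arg x).
Proof. by move=> x0 y; exact: is_derive_continuous (is_derive_half_arg_y y x0). Qed.

Lemma phase_half_arg_continuous (x : R) : x != 0 -> continuous (psi \o half_arg x).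
Proof.
move=> x0 y; apply: continuous_comp; [exact: half_arg_y_continuous|exact: psi_cont].
Qed.

Lemma vertical_polar x y : x != 0 -> w (x +i* y) =
  (modulus (x +i* y) * r (psi (half_arg x y)))%:C * expi (psi (half_arg x y)).
Proof. by move=> x0; rewrite w_half_arg// /P rmorphM mulrA. Qed.

(** The chain rule in polar coordinates: the gradients of modulus and argument are
    [(cos t, sin t)] and [(- sin t, cos t) / lam]. *)
Lemma radial_partials x y q : x != 0 -> is_derive (half_arg x y) 1 psi q ->
  let t := half_arg x y in
  is_cderive (fun y => w (x +i* y)) y
    ((sin t)%:C * P (psi t) + (cos t * q)%:C * V (psi t)) /\
  is_cderive (fun x => w (x +i* y)) x
    ((cos t)%:C * P (psi t) + (- sin t * q)%:C * V (psi t)).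
Proof.
move=> x0 dpsi t; have ln : modulus (x +i* y) != 0 by rewrite gt_eqF// half_arg_modulus_gt0.
split.
  have := polar_chain (is_derive_modulus_y y x0) (is_derive_half_arg_y y x0) dpsi (dP _).
  rewrite (_ : modulus _ * (q * _) = cos t * q); last by rewrite -/t; field.
  congr (is_cderive _ _ _); apply/funext => u.
  by rewrite w_half_arg.
have := polar_chain (is_derive_modulus_x y x0) (is_derive_half_arg_x y x0) dpsi (dP _).
rewrite (_ : modulus _ * (q * _) = - sin t * q); last by rewrite -/t; field.
have ax0 : 0 < `|x| by rewrite normr_gt0.
have un (u : R) : `|u - x| < `|x| -> w (u +i* y) = (modulus (u +i* y))%:C * P (psi (half_arg u y)).
  move=> ux; apply: w_half_arg; apply/eqP => u0; move: ux.
  by rewrite u0 sub0r normrN ltxx.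
by move=> [h1 h2]; split; [apply: (is_derive_near ax0 _ h1)|apply: (is_derive_near ax0 _ h2)];
  move=> u /un ->.
Qed.

(** Differentiability of [w] along a vertical line makes its phase
    [psi (half_arg x y)] differentiable in [y]; since the argument has nonzero
    derivative in [y], [psi] itself is differentiable. *)
Lemma vertical_partial x y l : x != 0 -> is_cderive (fun y => w (x +i* y)) y l ->
  exists2 q, is_derive (half_arg x y) 1 psi q &
    is_derive y 1 (psi \o half_arg x) (q * (cos (half_arg x y) / modulus (x +i* y))) /\
    l = (sin (half_arg x y))%:C * P (psi (half_arg x y)) +
        (cos (half_arg x y) * q)%:C * V (psi (half_arg x y)).
Proof.
move=> x0 dl; set t := half_arg x y.
have l0 := half_arg_modulus_gt0 y x0.
have dPhi := phase_is_derive (fun y => vertical_polar y x0)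
  (fun y => mulr_gt0 (half_arg_modulus_gt0 y x0) (r_gt0 _))
  (@phase_half_arg_continuous x x0 y) dl.
have n0 : cos t / modulus (x +i* y) != 0.
  by rewrite mulf_neq0 ?cos_half_arg_neq0// invr_eq0 gt_eqF.
have dpsi := derive_through n0 (ltr01) (fun u _ => @half_arg_y_continuous x x0 u)
  (fun u _ => erefl ((psi \o half_arg x) u)) (is_derive_half_arg_y y x0) dPhi.
eexists; first exact: dpsi; split.
  exact: (is_derive_comp1 dpsi (is_derive_half_arg_y y x0)).
have [[h1 h2] _] := radial_partials x0 dpsi; have [k1 k2] := dl.
by apply: complex_ext; [exact: (is_derive_unique k1 h1)|exact: (is_derive_unique k2 h2)].
Qed.

(** With [c = q (kappa + i)] the partials are [P (cos t - c sin t)] and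
    [P (sin t + c cos t)], so that the complex derivatives are
    [P expi (- t) (1 - i c) / 2] and [P expi t (1 + i c) / 2]. *)
Lemma radial_dilatation (t q : R) (wx wy : R[i]) :
  wx = (cos t)%:C * P (psi t) + (- sin t * q)%:C * V (psi t) ->
  wy = (sin t)%:C * P (psi t) + (cos t * q)%:C * V (psi t) ->
  let k := kap (psi t) in
  modulus ((wx - 'i%C * wy) / 2) ^+ 2 = (r (psi t) / 2) ^+ 2 * ((1 + q) ^+ 2 + (q * k) ^+ 2) /\
  modulus ((wx + 'i%C * wy) / 2) ^+ 2 = (r (psi t) / 2) ^+ 2 * ((1 - q) ^+ 2 + (q * k) ^+ 2).
Proof.
move=> -> -> k; set s := psi t.
have m2 : modulus (2^-1 : R[i]) ^+ 2 = 2^-1 ^+ 2.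
  by rewrite modulusV (_ : modulus 2 = 2)// (_ : 2 = (2 : R)%:C) ?modulus_real ?ger0_norm// rmorph_nat.
have P2 : modulus (P s) ^+ 2 = r s ^+ 2.
  by rewrite /P modulusM modulus_real modulus_expi mulr1 real_normK// num_real.
have M3 (a b c : R[i]) : modulus (a * b * c / 2) ^+ 2 =
    modulus a ^+ 2 * modulus b ^+ 2 * modulus c ^+ 2 * 2^-1 ^+ 2.
  by rewrite !modulusM !exprMn m2.
split.
- have -> : (cos t)%:C * P s + (- sin t * q)%:C * V s - 'i%C * ((sin t)%:C * P s + (cos t * q)%:C * V s) =
    P s * expi (- t) * ((1 + q) +i* (- (q * k))).
    rewrite /V -/k; case: (P s) => a b; apply: complex_ext; rewrite !ReImE /= cosN sinN; ring.
  rewrite M3 modulus_expi P2 expr1n mulr1 modulus_sqr /= sqrrN.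
  by rewrite exprMn; ring.
- have -> : (cos t)%:C * P s + (- sin t * q)%:C * V s + 'i%C * ((sin t)%:C * P s + (cos t * q)%:C * V s) =
    P s * expi t * ((1 - q) +i* (q * k)).
    rewrite /V -/k; case: (P s) => a b; apply: complex_ext; rewrite !ReImE /=; ring.
  rewrite M3 modulus_expi P2 expr1n mulr1 modulus_sqr /=.
  by rewrite exprMn; ring.
Qed.

End Radial_partials.

(** * Increments of Lipschitz functions *)

Section Lipschitz_calculus.
Context {R : realType}.
Notation mu := (@lebesgue_measure R).

Lemma ae_exists_between (Q : R -> Prop) (a b : R) : a < b -> {ae mu, forall x, Q x} ->
  exists x, a < x < b /\ Q x.
Proof.
move=> ab aeQ; apply: contrapT => nx.
have [A [mA A0 hA]] := aeQ.
have sub : `]a, b[%classic `<=` A.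
  move=> x /=; rewrite in_itv/= => xab; apply: hA => Qx; apply: nx; exists x; split => //.
have mI : measurable (`]a, b[%classic : set (measurableTypeR R)) by exact: measurable_itv.
have : (mu (`]a, b[%classic : set (measurableTypeR R)) <= mu A)%E by apply: le_measure; rewrite ?inE.
rewrite A0 lebesgue_measure_itv/= lte_fin ab -EFinB lee_fin subr_le0 leNgt ab.
by [].
Qed.

Lemma ae_bounded_increment (g : R -> R) (B c d : R) : c <= d ->
  mu.-integrable `[c, d] (EFin \o g) -> {ae mu, forall t, `|g t| <= B} ->
  `|\int[mu]_(t in `]c, d]) g t| <= B * (d - c).
Proof.
move=> cd ig gB.
pose I : set (measurableTypeR R) := `]c, d]%classic.
have mI : measurable I by exact: measurable_itv.
have iI : mu.-integrable I (EFin \o g).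
  by apply: (integrableS _ _ _ ig) => // t; rewrite /I /= !in_itv/= => /andP[/ltW-> ->].
have B0 : 0 <= B.
  by have [x [_ hx]] := ae_exists_between (ltr01) gB; exact: le_trans hx.
have muI : mu I = (d - c)%:E.
  rewrite /I lebesgue_measure_itv/= lte_fin; case: ltP => [_|dc]; first by rewrite EFinB.
  by congr (_%:E); apply/eqP; rewrite eq_sym subr_eq0; apply/eqP/le_anti/andP.
apply: le_trans (le_normr_Rintegral _ _) _ => //.
rewrite -lee_fin /Rintegral fineK; last exact: (integrable_fin_num _ (integrable_norm iI)).
apply: (@le_trans _ _ (\int[mu]_(t in I) (B%:E))%E).
  apply: ae_ge0_le_integral => //.
  - by apply/measurable_EFinP; apply: measurableT_comp => //; apply/measurable_EFinP; exact: (measurable_int _ iI).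
  - by apply: ae_mono gB => t h _; rewrite lee_fin.
by rewrite integral_cst// [X in (_ * X)%E](_ : _ = (d - c)%:E)// -EFinM lexx.
Qed.

(** A Lipschitz function is the integral of its derivative. *)
Lemma lipschitz_nondecreasing (F : R -> R) (C : R) :
  (forall s t, `|F s - F t| <= C * `|s - t|) ->
  {ae mu, forall t : R, exists2 l, 0 <= l & is_derive t 1 F l} ->
  forall a b, a <= b -> F a <= F b.
Proof.
move=> lF dF a b; rewrite le_eqVlt => /predU1P[->//|ab].
have [h [ih Eh dh]] := lipschitz_ae_derivable lF ab.
rewrite -subr_ge0 -Eh.
pose I : set (measurableTypeR R) := `[a, b]%classic.
have mI : measurable I by exact: measurable_itv.
have mh : measurable_fun I h by apply/measurable_EFinP; exact: (measurable_int _ ih).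
rewrite (_ : \int[mu]_(t in `[a, b]) h t = \int[mu]_(t in I) `|h t|); first by apply: Rintegral_ge0.
rewrite /Rintegral; congr fine; apply: ae_eq_integral => //.
- by apply/measurable_EFinP.
- by apply/measurable_EFinP; apply: measurableT_comp.
apply: ae_mono (ae_and (ae_and dF dh) (ae_and (ae_neq a) (ae_neq b))) => t [[[l l0 dl] dht] [ta tb]].
rewrite /I /= in_itv/= => /andP[at_ tb_].
have tab : a < t < b by rewrite !lt_neqAle at_ tb_ !andbT; apply/andP; split; apply/eqP => // /esym.
by rewrite (is_derive_unique (dht tab) dl) ger0_norm.
Qed.

Lemma lipschitzR_of_local (f : R -> R) (C : R) : continuous f ->
  (forall t, exists2 d : R, 0 < d & forall u, `|u - t| < d -> `|f u - f t| <= C * `|u - t|) ->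
  forall s t, `|f s - f t| <= C * `|s - t|.
Proof.
move=> cf H.
have up (g : R -> R) (a b : R) : continuous g -> a <= b ->
    (forall t, exists2 d : R, 0 < d & forall u, `|u - t| < d -> `|g u - g t| <= C * `|u - t|) ->
    g b - g a <= C * (b - a).
  move=> cg ab Hg; apply: dini_increment => // t _ e e0.
  have [d d0 hd] := Hg t; exists d => // h /andP[h0 hd'].
  have := hd (t + h); rewrite addrAC subrr add0r gtr0_norm// => /(_ hd') h1.
  apply: le_trans (le_trans (ler_norm _) h1) _; rewrite ler_wpM2r ?ltW//; lra.
suff K a b : a <= b -> `|f b - f a| <= C * `|b - a|.
  by move=> s t; have [st|/ltW ts] := leP s t; [rewrite distrC (distrC s)|]; exact: K.
move=> ab; rewrite [`|b - a|]ger0_norm ?subr_ge0// ler_norml; apply/andP; split; last exact: up.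
have cN : continuous (fun u => - f u) by move=> u; apply: cvgN; exact: cf.
have h := up (fun u => - f u) a b cN ab.
have : - f b - - f a <= C * (b - a).
  apply: h => t; have [d d0 hd] := H t; exists d => // u /hd.
  by rewrite -opprD normrN.
lra.
Qed.

End Lipschitz_calculus.

(** * Consequences of a dilatation bound *)

Section Dilatation_bounds.
Context {R : realType}.
Implicit Types (k q a T : R).

(** Dropping [a ^ 2], whose coefficient has the favourable sign, leaves
    [|1 - q| <= k (1 + q)]. *)
Lemma dilatation_speed k q a : 0 <= k < 1 ->
  (1 - q) ^+ 2 + a ^+ 2 <= k ^+ 2 * ((1 + q) ^+ 2 + a ^+ 2) ->
  (1 - k) / (1 + k) <= q <= (1 + k) / (1 - k).
Proof.
move=> /andP[k0 k1] H.
have k21 : k ^+ 2 <= 1 by rewrite expr_le1// ltW.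
have a0 : k ^+ 2 * a ^+ 2 <= a ^+ 2 by rewrite ler_piMl// sqr_ge0.
have H1 : (1 - q) ^+ 2 <= (k * (1 + q)) ^+ 2 by rewrite exprMn; lra.
have q0 : 0 <= q.
  have h : (1 - k ^+ 2) * (1 + q ^+ 2) <= 2 * q * (1 + k ^+ 2).
    have -> : 2 * q * (1 + k ^+ 2) = (k * (1 + q)) ^+ 2 - (1 - q) ^+ 2 + (1 - k ^+ 2) * (1 + q ^+ 2) by ring.
    lra.
  have h2 : 0 <= (1 - k ^+ 2) * (1 + q ^+ 2).
    by rewrite mulr_ge0 ?subr_ge0// addr_ge0// sqr_ge0.
  have h3 : 0 < 1 + k ^+ 2 by rewrite ltr_pwDl// sqr_ge0.
  have := le_trans h2 h; rewrite pmulr_lge0// => h4; lra.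
have kq0 : 0 <= k * (1 + q) by rewrite mulr_ge0// addr_ge0.
have H2 : `|1 - q| <= k * (1 + q).
  by rewrite -(@ler_pXn2r _ 2)// ?nnegrE// real_normK// num_real.
move: H2; rewrite ler_norml => /andP[h1 h2].
have p1 : 0 < 1 + k by lra.
have p2 : 0 < 1 - k by lra.
rewrite ler_pdivrMr// ler_pdivlMr//; apply/andP; split; lra.
Qed.

(** The hypothesis says that
    [(1 - k ^ 2) (1 + q ^ 2 (1 + T ^ 2)) <= 2 q (1 + k ^ 2)]; a quadratic polynomial
    in [q] that takes a nonpositive value has a nonnegative discriminant. *)
Lemma dilatation_angle k q T : 0 <= k < 1 ->
  (1 - q) ^+ 2 + (q * T) ^+ 2 <= k ^+ 2 * ((1 + q) ^+ 2 + (q * T) ^+ 2) ->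
  ((1 - k ^+ 2) / (1 + k ^+ 2)) ^+ 2 * (1 + T ^+ 2) <= 1.
Proof.
move=> /andP[k0 k1] H.
have A0 : 0 < 1 - k ^+ 2 by rewrite subr_gt0 expr_lt1.
have B0 : 0 < 1 + k ^+ 2 by rewrite ltr_pwDl// sqr_ge0.
rewrite expr_div_n mulrAC ler_pdivrMr ?exprn_gt0// mul1r.
have T0 : 0 < 1 + T ^+ 2 by rewrite ltr_pwDl// sqr_ge0.
set A := 1 - k ^+ 2 in A0 *; set B := 1 + k ^+ 2 in B0 *; set S := 1 + T ^+ 2 in T0 *.
have H1 : A * (1 + q ^+ 2 * S) - 2 * q * B <= 0.
  rewrite (_ : _ - _ = ((1 - q) ^+ 2 + (q * T) ^+ 2) - k ^+ 2 * ((1 + q) ^+ 2 + (q * T) ^+ 2)); first lra.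
  by rewrite /A /B /S; ring.
have H2 : A * S * (A * (1 + q ^+ 2 * S) - 2 * q * B) <= 0 by rewrite mulr_ge0_le0// ltW// mulr_gt0.
have H3 : 0 <= (A * S * q - B) ^+ 2 by exact: sqr_ge0.
have E : A * S * (A * (1 + q ^+ 2 * S) - 2 * q * B) = (A * S * q - B) ^+ 2 - B ^+ 2 + A ^+ 2 * S by ring.
lra.
Qed.

End Dilatation_bounds.

(** * The phase of a quasiconformal radial extension *)

Section Plane_functions.
Context {R : realType}.

Lemma toC_dist (p q : R * R) : modulus (toC p - toC q) <= `|p.1 - q.1| + `|p.2 - q.2|.
Proof. by apply: le_trans (modulus_le_sum _) _; rewrite /toC /=. Qed.

Let eps_component (f : R[i] -> R) (w : R[i] -> R[i]) :
  (forall z z', `|f z - f z'| <= modulus (z - z')) -> eps_continuous w ->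
  continuous (fun p : R * R => f (w (toC p))).
Proof.
move=> fl cw p; apply/cvgrPdist_lt => e e0; have [d d0 hd] := cw (toC p) e e0.
have d2 : 0 < d / 2 by rewrite divr_gt0.
exists (ball p.1 (d / 2), ball p.2 (d / 2)); first by split; exact: nbhsx_ballx.
move=> q [/= h1 h2]; rewrite distrC; apply: le_lt_trans (fl _ _) _; apply: hd.
apply: le_lt_trans (toC_dist _ _) _.
have := ltrD h1 h2; rewrite -splitr (distrC p.1) (distrC p.2); by [].
Qed.

Lemma continuous_Re_plane (w : R[i] -> R[i]) : eps_continuous w ->
  continuous (fun p : R * R => complex.Re (w (toC p))).
Proof. by apply: eps_component => z z'; rewrite -raddfB; exact: Re_le_modulus. Qed.

Lemma continuous_Im_plane (w : R[i] -> R[i]) : eps_continuous w ->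
  continuous (fun p : R * R => complex.Im (w (toC p))).
Proof. by apply: eps_component => z z'; rewrite -raddfB; exact: Im_le_modulus. Qed.

End Plane_functions.

Lemma increment_rearrange (R : realType) (c C s p1 p2 t1 t2 : R) :
  1 * (s * p1) + - c * (s * t1) <= 1 * (s * p2) + - c * (s * t2) ->
  -1 * (s * p1) + C * (s * t1) <= -1 * (s * p2) + C * (s * t2) ->
  c * (s * (t2 - t1)) <= s * (p2 - p1) <= C * (s * (t2 - t1)).
Proof. by move=> h1 h2; apply/andP; split; lra. Qed.

Lemma increment_sign (R : realType) (c C s p t : R) : `|s| = 1 -> c * t <= C * t ->
  c * (s * t) <= s * p <= C * (s * t) -> c * t <= p <= C * t.
Proof.
move=> /eqP; rewrite eqr_norml => /andP[/orP[]/eqP-> _] h; first by rewrite !mul1r.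
by rewrite !mulN1r !mulrN !lerN2 => /andP[h1 h2]; apply/andP; split; lra.
Qed.

Lemma increment_sign_swap (R : realType) (c C s p1 p2 t1 t2 : R) : `|s| = 1 ->
  c * (t2 - t1) <= C * (t2 - t1) ->
  c * (s * (t1 - t2)) <= s * (p1 - p2) <= C * (s * (t1 - t2)) ->
  c * (t2 - t1) <= p2 - p1 <= C * (t2 - t1).
Proof.
move=> /eqP; rewrite eqr_norml => /andP[/orP[]/eqP-> _] h /andP[h1 h2];
  by apply/andP; split; lra.
Qed.

Section Radial_quasiconformal.
Context {R : realType}.
Notation mu := (@lebesgue_measure R).
Variables (r psi kap : R -> R) (w wx wy : R[i] -> R[i]) (M rmin B k : R).
Let P s := (r s)%:C * expi s.
Let V s := P s * (kap s +i* 1).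
Hypotheses (dP : forall s, is_cderive P s (V s)) (rmin_gt0 : 0 < rmin)
  (r_ge : forall s, rmin <= r s) (r_le : forall s, r s <= M) (kap_le : forall s, `|kap s| <= B)
  (kap_cont : continuous kap) (psi_cont : continuous psi)
  (w_polar : forall lam t, 0 <= lam -> w (lam%:C * expi t) = lam%:C * P (psi t))
  (w_cont : eps_continuous w) (k01 : 0 <= k < 1) (w_sob : W11loc_with setT w wx wy)
  (w_dil : ae_on setT (fun z => dz wx wy z != 0 /\ modulus (dzbar wx wy z / dz wx wy z) <= k)).

Let K := (1 + k) / (1 - k).

Let r_gt0 s : 0 < r s. Proof. exact: lt_le_trans (r_ge s). Qed.

Let K_ge1 : 1 <= K.
Proof. by case/andP: k01 => k0 k1; rewrite ler_pdivlMr; lra. Qed.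

Let M_gt0 : 0 < M. Proof. exact: lt_le_trans (r_gt0 0) (r_le 0). Qed.
Let B_ge0 : 0 <= B. Proof. exact: le_trans (kap_le 0). Qed.

(** What the dilatation bound says at a point where [w] has classical partial
    derivatives and [psi] has speed [q]. *)
Let speed_bounds (x y q : R) : Prop :=
  [/\ is_derive y 1 (psi \o half_arg x) (q * (cos (half_arg x y) / modulus (x +i* y))),
      K^-1 <= q <= K,
      wy (x +i* y) = (sin (half_arg x y))%:C * P (psi (half_arg x y)) +
        (cos (half_arg x y) * q)%:C * V (psi (half_arg x y)) &
      ((1 - k ^+ 2) / (1 + k ^+ 2)) ^+ 2 * (1 + kap (psi (half_arg x y)) ^+ 2) <= 1].

Let KV : (1 - k) / (1 + k) = K^-1.
Proof. by rewrite /K invf_div. Qed.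

(** The dilatation is a function of [q] and [kappa] by [radial_dilatation]. *)
Let speed_at (x y : R) : x != 0 ->
  is_cderive (fun y => w (x +i* y)) y (wy (x +i* y)) ->
  is_cderive (fun x => w (x +i* y)) x (wx (x +i* y)) ->
  dz wx wy (x +i* y) != 0 ->
  modulus (dzbar wx wy (x +i* y) / dz wx wy (x +i* y)) <= k ->
  exists q, speed_bounds x y q.
Proof.
move=> x0 dy dx z0 hk.
have [q dq [dPhi Ey]] := vertical_partial dP r_gt0 psi_cont w_polar x0 dy.
have [_ [h1 h2]] := radial_partials dP w_polar x0 dq.
have Ex : wx (x +i* y) = (cos (half_arg x y))%:C * P (psi (half_arg x y)) +
    (- sin (half_arg x y) * q)%:C * V (psi (half_arg x y)).
  have [k1 k2] := dx.
  by apply: complex_ext; [exact: (is_derive_unique k1 h1)|exact: (is_derive_unique k2 h2)].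
have [E1 E2] := radial_dilatation Ex Ey.
have k0 : 0 <= k by case/andP: k01.
have z1 : 0 < modulus (dz wx wy (x +i* y)) by rewrite modulus_gt0.
have H : modulus (dzbar wx wy (x +i* y)) ^+ 2 <= k ^+ 2 * modulus (dz wx wy (x +i* y)) ^+ 2.
  rewrite -exprMn ler_sqr ?nnegrE ?modulus_ge0 ?mulr_ge0 ?modulus_ge0//.
  by rewrite -ler_pdivrMr// -modulusV -modulusM.
rewrite [X in X <= _]E2 [X in _ <= _ * X]E1 mulrCA ler_pM2l in H; last by rewrite exprn_gt0// divr_gt0.
exists q; split => //; last exact: dilatation_angle H.
by rewrite -KV; exact: dilatation_speed H.
Qed.

Let good_line (x : R) : Prop :=
  [/\ forall c d : R, mu.-integrable `[c, d] (fun y => (complex.Re (wy (x +i* y)))%:E) /\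
        mu.-integrable `[c, d] (fun y => (complex.Im (wy (x +i* y)))%:E),
      forall c d : R, c <= d ->
        \int[mu]_(y in `]c, d]) complex.Re (wy (x +i* y)) = complex.Re (w (x +i* d)) - complex.Re (w (x +i* c)) /\
        \int[mu]_(y in `]c, d]) complex.Im (wy (x +i* y)) = complex.Im (w (x +i* d)) - complex.Im (w (x +i* c)) &
      x != 0 -> {ae mu, forall y, exists q, speed_bounds x y q}].

Let ae_good_line : {ae mu, forall x, good_line x}.
Proof.
have [[wxR wxI] [wyR wyI]] := w_sob.
have cR := continuous_Re_plane w_cont; have cI := continuous_Im_plane w_cont.
have lR := @weak_on_lines R false _ _ cR wyR.
have lI := @weak_on_lines R false _ _ cI wyI.
have aR := ae_and (@weak_ae_derivable R true _ _ cR wxR) (@weak_ae_derivable R false _ _ cR wyR).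
have aI := ae_and (@weak_ae_derivable R true _ _ cI wxI) (@weak_ae_derivable R false _ _ cI wyI).
have al := ae_line false (ae_and (ae_and aR aI) w_dil).
apply: ae_mono (ae_and (ae_and lR lI) al) => x [[[iR eR] [iI eI]] hal].
split => [c d|c d cd|x0].
- by split; [exact: iR|exact: iI].
- by split; [exact: (eR c d cd)|exact: (eI c d cd)].
apply: ae_mono hal => y [[[/is_derive_exP xR /is_derive_eyP yR] [/is_derive_exP xI /is_derive_eyP yI]]].
move=> /(_ I)[z0 hk].
apply: speed_at => //; by split.
Qed.

Let wy_bound := M + K * (M * (B + 1)).

Let wy_le x y q : speed_bounds x y q -> modulus (wy (x +i* y)) <= wy_bound.
Proof.
move=> [_ /andP[q1 q2] -> _]; set t := half_arg x y.
have Kp : 0 < K by exact: lt_le_trans K_ge1.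
have q0 : 0 <= q by apply: le_trans q1; rewrite invr_ge0 ltW.
have mP s : modulus (P s) = r s by rewrite modulus_polar// ltW.
have mV s : modulus (V s) <= M * (B + 1).
  rewrite /V modulusM mP; apply: ler_pM; rewrite ?modulus_ge0 ?(ltW (r_gt0 _))//.
  by apply: le_trans (modulus_le_sum _) _; rewrite /= normr1 lerD2r.
apply: le_trans (modulusD _ _) _.
rewrite (modulusM (sin t)%:C) (modulusM (cos t * q)%:C) !modulus_real mP; apply: lerD.
  rewrite -[leRHS]mul1r; apply: ler_pM; rewrite ?(ltW (r_gt0 _))//.
  by rewrite ler_norml; apply/andP; split; [exact: sin_geN1|exact: sin_le1].
apply: ler_pM; rewrite ?modulus_ge0// normrM (ger0_norm q0) -[leRHS]mul1r.
apply: ler_pM => //.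
by rewrite ler_norml; apply/andP; split; [exact: cos_geN1|exact: cos_le1].
Qed.

(** On such a line [w] is the integral of [wy], which is bounded since [q] is. *)
Let vertical_lipschitz x : x != 0 -> good_line x ->
  forall c d, modulus (w (x +i* d) - w (x +i* c)) <= 2 * wy_bound * `|d - c|.
Proof.
move=> x0 [iw ew sp]; have {}sp := sp x0.
have H c d : c <= d -> modulus (w (x +i* d) - w (x +i* c)) <= 2 * wy_bound * `|d - c|.
  move=> cd; apply: le_trans (modulus_le_sum _) _; rewrite !raddfB /=.
  have [<- <-] := ew c d cd; rewrite [`|d - c|]ger0_norm ?subr_ge0//.
  rewrite (_ : 2 * wy_bound * (d - c) = wy_bound * (d - c) + wy_bound * (d - c)); last by ring.
  apply: lerD; apply: ae_bounded_increment => //.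
  - exact: (iw c d).1.
  - by apply: ae_mono sp => y [q /wy_le]; apply: le_trans; exact: Re_le_modulus.
  - exact: (iw c d).2.
  - by apply: ae_mono sp => y [q /wy_le]; apply: le_trans; exact: Im_le_modulus.
move=> c d; have [cd|/ltW dc] := leP c d; first exact: H.
by rewrite -modulusN opprB distrC; exact: H.
Qed.

(** The modulus of [w] on the line is bounded below, so that the phase inherits
    the Lipschitz bound of [w]. *)
Let phase_line_lipschitz x : x != 0 -> good_line x -> exists C, forall y y',
  `|psi (half_arg x y) - psi (half_arg x y')| <= C * `|y - y'|.
Proof.
move=> x0 gx; have ax0 : 0 < `|x| by rewrite normr_gt0.
exists (2 * (2 * wy_bound) / (`|x| * rmin)).
apply: lipschitzR_of_local; first exact: phase_half_arg_continuous.
move=> y0; have l0 y := half_arg_modulus_gt0 y x0.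
have [e e0 he] := phase_lipschitz (fun y => vertical_polar w_polar y x0)
  (fun y => mulr_gt0 (l0 y) (r_gt0 _)) (@phase_half_arg_continuous _ _ psi_cont x x0 y0)
  (fun y => vertical_lipschitz x0 gx y0 y).
exists e => // y /he h; apply: le_trans h _; rewrite ler_wpM2r//.
have wb0 : 0 <= wy_bound.
  have K0 : 0 < K by exact: lt_le_trans K_ge1.
  apply: addr_ge0; first exact: ltW.
  apply: mulr_ge0; first exact: ltW.
  by apply: mulr_ge0; [exact: ltW|exact: addr_ge0].
apply: ler_pM; rewrite ?invr_ge0 ?mulr_ge0 ?(ltW (l0 _)) ?(ltW (r_gt0 _))//.
rewrite lef_pV2 ?posrE ?mulr_gt0//; apply: ler_pM; rewrite ?(ltW rmin_gt0)//.
exact: (Re_le_modulus (x +i* y0)).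
Qed.

Let half_arg_lipschitz (x : R) : x != 0 -> forall y y',
  `|half_arg x y - half_arg x y'| <= `|x|^-1 * `|y - y'|.
Proof.
move=> x0; apply: (lipschitz_of_derivative (fun y => is_derive_half_arg_y y x0)) => y.
have ax0 : 0 < `|x| by rewrite normr_gt0.
have l0 := half_arg_modulus_gt0 y x0.
rewrite normrM normfV (gtr0_norm l0) -[leRHS]mul1r; apply: ler_pM => //.
- by rewrite invr_ge0 ltW.
- by rewrite ler_norml; apply/andP; split; [exact: cos_geN1|exact: cos_le1].
- by rewrite lef_pV2 ?posrE//; exact: (Re_le_modulus (x +i* y)).
Qed.

(** On the line, [psi - K^-1 t] and [K t - psi], as functions of [y], are Lipschitz
    with derivatives of one sign. The sign [s] accounts for the left half-plane,
    where the argument decreases with [y]. *)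
Let line_increments x (s : R) : good_line x -> `|s| = 1 -> 0 < s * x -> forall y1 y2, y1 <= y2 ->
  K^-1 * (s * (half_arg x y2 - half_arg x y1)) <=
    s * (psi (half_arg x y2) - psi (half_arg x y1)) <=
  K * (s * (half_arg x y2 - half_arg x y1)).
Proof.
move=> gx s1 sx y1 y2 y12.
have x0 : x != 0 by apply: contraTneq sx => ->; rewrite mulr0 ltxx.
have [C hC] := phase_line_lipschitz x0 gx.
have [_ _ /(_ x0) sp] := gx; have hA := half_arg_lipschitz x0.
have sc y : 0 <= s * (cos (half_arg x y) / modulus (x +i* y)).
  have l0 := half_arg_modulus_gt0 y x0.
  rewrite mulrA divr_ge0 ?(ltW l0)//.
  have [hx _] := half_arg_coordinates y x0.
  by have := sx; rewrite {1}hx mulrCA pmulr_rgt0// => /ltW.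
have comb (a b : R) : (forall y q, speed_bounds x y q -> 0 <= a * q + b) ->
    a * (s * psi (half_arg x y1)) + b * (s * half_arg x y1) <=
    a * (s * psi (half_arg x y2)) + b * (s * half_arg x y2).
  move=> ab0; apply: (@lipschitz_nondecreasing R (fun y => a * (s * psi (half_arg x y)) + b * (s * half_arg x y))
      (`|a| * C + `|b| * `|x|^-1)) => //.
    move=> y y'.
    rewrite (_ : _ - _ = a * s * (psi (half_arg x y) - psi (half_arg x y')) +
        b * s * (half_arg x y - half_arg x y')); last by ring.
    apply: le_trans (ler_normD _ _) _; rewrite !normrM s1 !mulr1 mulrDl -!mulrA.
    by apply: lerD; rewrite ler_wpM2l.
  apply: ae_mono sp => y [q Sq]; exists ((a * q + b) * (s * (cos (half_arg x y) / modulus (x +i* y)))).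
    by rewrite mulr_ge0//; exact: ab0 Sq.
  have [dPhi _ _ _] := Sq; have dT := is_derive_half_arg_y y x0.
  apply: (is_derive_eqval (is_deriveD1 (is_deriveZ1 a (is_deriveZ1 s dPhi)) (is_deriveZ1 b (is_deriveZ1 s dT)))).
  by ring.
have h1 : 1 * (s * psi (half_arg x y1)) + - K^-1 * (s * half_arg x y1) <=
    1 * (s * psi (half_arg x y2)) + - K^-1 * (s * half_arg x y2).
  by apply: comb => y q [_ /andP[q1 _] _ _]; rewrite mul1r subr_ge0.
have h2 : -1 * (s * psi (half_arg x y1)) + K * (s * half_arg x y1) <=
    -1 * (s * psi (half_arg x y2)) + K * (s * half_arg x y2).
  by apply: comb => y q [_ /andP[_ q2] _ _]; rewrite mulN1r addrC subr_ge0.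
exact: increment_rearrange.
Qed.

Let half_circle (x c : R) : x != 0 -> (0 < x /\ c = 0 \/ x < 0 /\ c = pi) ->
  forall t, - (pi / 2) < t - c < pi / 2 -> half_arg x (x * tan (t - c)) = t.
Proof.
move=> x0 xc t tc; rewrite /half_arg mulrAC divff// mul1r tanK ?in_itv//.
by case: xc => -[xl ->]; [rewrite xl|rewrite ltNge (ltW xl)]; rewrite /= ?subr0 ?addr0 ?subrK.
Qed.

Let half_plane_line (c : R) : c = 0 \/ c = pi -> exists x s : R,
  [/\ x != 0, good_line x, `|s| = 1, 0 < s * x & 0 < x /\ c = 0 \/ x < 0 /\ c = pi].
Proof.
case=> ->.
  have [x [/andP[x0 _] gx]] := ae_exists_between (@ltr01 R) ae_good_line.
  by exists x, 1; split; rewrite ?normr1 ?mul1r ?gt_eqF//; left.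
have [x [/andP[_ x0] gx]] := ae_exists_between (@ltrN10 R) ae_good_line.
by exists x, (-1); split; rewrite ?normrN1 ?mulN1r ?oppr_gt0 ?lt_eqF//; right.
Qed.

(** A vertical line to the right or to the left of the origin is parametrized by
    its argument, which runs through an open half circle; almost every line will do
    and every point of the half circle is attained on it. *)
Lemma quasiconformal_half_circle (c : R) : c = 0 \/ c = pi ->
  (forall t1 t2, t1 <= t2 -> - (pi / 2) < t1 - c < pi / 2 -> - (pi / 2) < t2 - c < pi / 2 ->
    (1 - k) / (1 + k) * (t2 - t1) <= psi t2 - psi t1 <= (1 + k) / (1 - k) * (t2 - t1)) /\
  (forall t, - (pi / 2) < t - c < pi / 2 ->
    ((1 - k ^+ 2) / (1 + k ^+ 2)) ^+ 2 * (1 + kap (psi t) ^+ 2) <= 1).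
Proof.
move=> /half_plane_line[x [s [x0 gx s1 sx xc]]]; split.
  move=> t1 t2 t12 h1 h2; rewrite KV -/K.
  have K0 : 0 < K by exact: lt_le_trans K_ge1.
  have KK : K^-1 <= K by rewrite (le_trans _ K_ge1)// invf_le1.
  have li := line_increments gx s1 sx.
  have Kt : K^-1 * (t2 - t1) <= K * (t2 - t1) by rewrite ler_wpM2r// subr_ge0.
  have [y12|/ltW y21] := leP (x * tan (t1 - c)) (x * tan (t2 - c)).
    have := li _ _ y12; rewrite !(half_circle x0 xc)// => h; exact: increment_sign s1 Kt h.
  have := li _ _ y21; rewrite !(half_circle x0 xc)// => h; exact: increment_sign_swap s1 Kt h.
move=> t ht; rewrite -(half_circle x0 xc ht); set y0 := x * _.
rewrite leNgt; apply/negP => h1.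
pose f y := ((1 - k ^+ 2) / (1 + k ^+ 2)) ^+ 2 * (1 + kap (psi (half_arg x y)) ^+ 2) - 1.
have cf : continuous f.
  move=> y; apply: cvgB; last exact: cvg_cst.
  apply: cvgM; first exact: cvg_cst.
  apply: cvgD; first exact: cvg_cst.
  have ck : continuous_at y (fun y => kap (psi (half_arg x y))).
    apply: (@continuous_comp R R R (fun y => psi (half_arg x y)) kap y); last exact: kap_cont.
    exact: (phase_half_arg_continuous psi_cont x0).
  by rewrite /= (_ : (fun _ => _) = (fun y => kap (psi (half_arg x y)) * kap (psi (half_arg x y)))); 
    [exact: cvgM|apply/funext => u; rewrite expr2].
have fy0 : 0 < f y0 by rewrite /f subr_gt0.
have [e e0 he] := continuous_near_gt0 (cf y0) fy0.
have ey : y0 < y0 + e by rewrite ltrDl.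
have [_ _ /(_ x0) sp] := gx.
have [y [/andP[y1 y2] [q [_ _ _ hq]]]] := ae_exists_between ey sp.
have := he y; rewrite ltr_norml => /(_ ltac:(apply/andP; split; lra)).
rewrite /f; lra.
Qed.

End Radial_quasiconformal.

Section Right_half_circles.
Context {R : realType}.

(** The half circles [cos > 0] and [cos < 0] cover everything but the points where
    [cos] vanishes, and to the right of such a point one of them begins. *)
Lemma right_half_circle (t : R) : exists (m : int) (c d : R),
  [/\ c = 0 \/ c = pi, 0 < d & forall t', t < t' < t + d ->
     - (pi / 2) < t' + m%:~R * (2 * pi) - c < pi / 2].
Proof.
have pp := @pi_gt0 R; have p2 : 0 < 2 * pi :> R by lra.
pose n := Num.floor ((t + pi / 2) / (2 * pi)).
have /andP[n1 n2] := Num.Theory.floor_itv ((t + pi / 2) / (2 * pi)).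
have {}n1 : n%:~R * (2 * pi) <= t + pi / 2 by rewrite -ler_pdivlMr.
have {}n2 : t + pi / 2 < n%:~R * (2 * pi) + 2 * pi.
  by have := n2; rewrite intrD ltr_pdivrMr// [X in _ < X]mulrDl [X in _ < _ + X]mul1r.
exists (- n).
have E (t' : R) : t' + (- n)%:~R * (2 * pi) = t' - n%:~R * (2 * pi) by rewrite mulrNz mulNr.
set N := n%:~R * (2 * pi) in n1 n2 E.
have [h|h] := ltP (t - N) (pi / 2).
  exists 0, (pi / 2 - (t - N)); split; [by left|lra|].
  by move=> t' /andP[h1 h2]; rewrite E subr0; apply/andP; split; lra.
exists pi, (3 * pi / 2 - (t - N)); split; [by right|lra|].
by move=> t' /andP[h1 h2]; rewrite E; apply/andP; split; lra.
Qed.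

End Right_half_circles.

Section Radial_quasiconformal_bounds.
Context {R : realType} (gamma : set R[i]) (r : R -> R) (G : R[i] -> R[i])
  (psi : R -> R).
Context (gamma_smooth : smooth_jordan_curve gamma)
  (gamma_tangent : forall l, tangent_line gamma l -> ~ l 0)
  (r_polar : polar_parametrization gamma r)
  (G_homeo : homeomorphism_between unit_circle gamma G)
  (psi_cont : continuous psi)
  (psi_arg : forall t, G (expi t) = (rho_of G t)%:C * expi (psi t)).

Let w := radial_extension G.
Let P s := (r s)%:C * expi s.

Lemma polar_curve_kappa s : is_cderive P s (P s * (kappa r s +i* 1)).
Proof.
have := polar_curve_derivable gamma_smooth gamma_tangent r_polar s.
congr (is_cderive _ _ _); have r0 := polar_gt0 r_polar s.
apply: complex_ext; rewrite !ReImE /= /kappa; field; by rewrite gt_eqF.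
Qed.

Lemma radial_extension_at lam t : 0 <= lam -> w (lam%:C * expi t) = lam%:C * P (psi t).
Proof. exact: (radial_extension_polar r_polar G_homeo psi_arg). Qed.

(** The half circles have to be considered up to full turns, which amounts to
    shifting the phase; increments over short intervals then combine by
    [bilipschitz_of_local]. The bound for [kappa (psi t)] covers the whole curve
    because [psi] is onto. *)
Lemma quasiconformal_phase k : k_quasiconformal setT k w ->
  bilipschitz_with distR distR setT ((1 - k) / (1 + k)) ((1 + k) / (1 - k)) psi /\
  (1 - k ^+ 2) / (1 + k ^+ 2) <= sin (alpha_of r).
Proof.
move=> [k01 [_ [_ cw _] _] [wx [wy [sob dil]]]].
have we : eps_continuous w by apply/eps_continuousP; exact/continuous_subspace_setT.
have [M hM] := periodic_max (polar_continuous gamma_smooth gamma_tangent r_polar) (polar_periodic r_polar).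
have [B hB] := kappa_bounded gamma_smooth gamma_tangent r_polar.
have kc := kappa_continuous gamma_smooth gamma_tangent r_polar.
have d0 := dist_to_origin_gt0 gamma_smooth gamma_tangent r_polar.
have dr := dist_to_origin_le r_polar.
have shift (m : int) := fun c => @quasiconformal_half_circle R r (fun t => psi (t + m%:~R * (2 * pi)))
  (kappa r) w wx wy (r M) (dist_to_origin gamma) B k polar_curve_kappa d0 dr hM hB kc.
have {}shift (m : int) c : c = 0 \/ c = pi ->
  (forall t1 t2, t1 <= t2 -> - (pi / 2) < t1 - c < pi / 2 -> - (pi / 2) < t2 - c < pi / 2 ->
    (1 - k) / (1 + k) * (t2 - t1) <= psi (t2 + m%:~R * (2 * pi)) - psi (t1 + m%:~R * (2 * pi))
      <= (1 + k) / (1 - k) * (t2 - t1)) /\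
  (forall t, - (pi / 2) < t - c < pi / 2 ->
    ((1 - k ^+ 2) / (1 + k ^+ 2)) ^+ 2 * (1 + kappa r (psi (t + m%:~R * (2 * pi))) ^+ 2) <= 1).
  apply: shift => //.
    move=> t; apply: (@continuous_comp R R R (fun t => t + m%:~R * (2 * pi)) psi t); last exact: psi_cont.
    by apply: cvgD; [exact: cvg_id|exact: cvg_cst].
  move=> lam t lam0; rewrite -(expi_period_int t m); exact: radial_extension_at.
have /andP[k0 k1] := k01.
have c0 : 0 < (1 - k) / (1 + k) by rewrite divr_gt0; lra.
have bl : bilipschitz_with distR distR setT ((1 - k) / (1 + k)) ((1 + k) / (1 - k)) psi.
  apply: bilipschitz_of_local => //.
    exact: (phase_inj r_polar G_homeo psi_cont psi_arg).
  move=> t; have [m [c [d [hc d0' hd]]]] := right_half_circle t.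
  exists d => // t' /andP[tt' t'd] e e0.
  exists (t + d - t'); first by rewrite subr_gt0.
  move=> h /andP[h0 hh].
  have [H _] := shift (- m) c hc.
  pose s0 := t' + m%:~R * (2 * pi); pose s1 := t' + h + m%:~R * (2 * pi).
  have s01 : s0 <= s1 by rewrite /s0 /s1; lra.
  have h1 : - (pi / 2) < s0 - c < pi / 2 by apply: hd; rewrite tt'.
  have h2 : - (pi / 2) < s1 - c < pi / 2 by apply: hd; apply/andP; split; lra.
  have := H _ _ s01 h1 h2.
  rewrite /s0 /s1 mulrNz mulNr !addrK.
  rewrite (_ : t' + h + m%:~R * (2 * pi) - (t' + m%:~R * (2 * pi)) = h); last by ring.
  move=> /andP[b1 b2].
  have b0 : 0 <= psi (t' + h) - psi t' by apply: le_trans b1; rewrite mulr_ge0// ltW.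
  rewrite ger0_norm//; split; [apply: le_trans b1|apply: le_trans b2 _];
    rewrite ler_wpM2r ?(ltW h0)//; lra.
split => //; apply: (sin_alpha_ge r_polar).
  have A0 : 0 <= 1 - k ^+ 2 by rewrite subr_ge0 expr_le1// ltW.
  by rewrite divr_ge0// addr_ge0// sqr_ge0.
have onpsi t : ((1 - k ^+ 2) / (1 + k ^+ 2)) ^+ 2 * (1 + kappa r (psi t) ^+ 2) <= 1.
  rewrite leNgt; apply/negP => h1.
  pose f y := ((1 - k ^+ 2) / (1 + k ^+ 2)) ^+ 2 * (1 + kappa r (psi y) ^+ 2) - 1.
  have cf : continuous f.
    move=> y; apply: cvgB; last exact: cvg_cst.
    apply: cvgM; first exact: cvg_cst.
    apply: cvgD; first exact: cvg_cst.
    have ck : continuous_at y (fun y => kappa r (psi y)).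
      by apply: (@continuous_comp R R R psi (kappa r) y); [exact: psi_cont|exact: kc].
    by rewrite /= (_ : (fun _ => _) = (fun y => kappa r (psi y) * kappa r (psi y)));
      [exact: cvgM|apply/funext => u; rewrite expr2].
  have ft : 0 < f t by rewrite /f subr_gt0.
  have [e e0 he] := continuous_near_gt0 (cf t) ft.
  have [m [c [d [hc d0' hd]]]] := right_half_circle t.
  have [_ H] := shift (- m) c hc.
  have tm : t < t + Num.min d e by rewrite ltrDl lt_min d0'.
  have [t' /andP[tt' t'm]] : exists t', t < t' < t + Num.min d e.
    by exists ((t + (t + Num.min d e)) / 2); apply/andP; split; lra.
  move: t'm; rewrite -ltrBlDl lt_min => /andP[t'd t'e].
  have := H _ (hd t' ltac:(apply/andP; split; lra)).
  rewrite mulrNz mulNr addrK.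
  have := he t'; rewrite gtr0_norm ?subr_gt0// => /(_ t'e); rewrite /f; lra.
move=> s; have [t <-] := bilipschitzR_surj psi_cont bl s.
exact: onpsi.
Qed.

End Radial_quasiconformal_bounds.

(** * Winding numbers and connectedness *)

Section Winding.
Context {R : realType}.
Implicit Types c : R -> R[i].

Lemma continuous_ReIm (f : R -> R[i]) : (forall t e, 0 < e -> exists2 d : R, 0 < d &
    forall u, `|u - t| < d -> modulus (f u - f t) < e) ->
  continuous (fun t => complex.Re (f t)) /\ continuous (fun t => complex.Im (f t)).
Proof.
move=> H; split => t; apply/continuous_epsP => e e0; have [d d0 hd] := H t e e0;
  exists d => // u /hd; apply: le_lt_trans; rewrite -raddfB.
  exact: Re_le_modulus.
exact: Im_le_modulus.
Qed.

(** Rouche's principle: a loop that stays closer to another one than that one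
    to the centre winds the same number of times, since the angle between the
    two position vectors stays in [-pi / 2, pi / 2]. *)
Lemma winds_once_near c0 c1 (a0 a1 : R[i]) :
  continuous (fun t => complex.Re (c1 t)) -> continuous (fun t => complex.Im (c1 t)) ->
  c1 (2 * pi) = c1 0 ->
  (forall t, modulus ((c1 t - a1) - (c0 t - a0)) < modulus (c0 t - a0)) ->
  winds_once c0 a0 -> winds_once c1 a1.
Proof.
move=> cR cI c1p near [th cth [hth th2]].
pose m t := (c1 t - a1) * expi (- th t).
have Rem t : 0 < complex.Re (m t).
  have E : m t = (modulus (c0 t - a0))%:C + ((c1 t - a1) - (c0 t - a0)) * expi (- th t).
    have -> : (modulus (c0 t - a0))%:C = (c0 t - a0) * expi (- th t).
      by rewrite [in RHS]hth -mulrA expiNK mulr1.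
    by rewrite /m; ring.
  set X := (c1 t - a1 - (c0 t - a0)) * expi (- th t) in E.
  have h : `|complex.Re X| <= modulus ((c1 t - a1) - (c0 t - a0)).
    by apply: le_trans (Re_le_modulus _) _; rewrite modulusM modulus_expi mulr1.
  have EX : complex.Re (m t) = modulus (c0 t - a0) + complex.Re X by rewrite E raddfD.
  rewrite EX; have := ler_norm (- complex.Re X); rewrite normrN => h2; have h3 := near t.
  rewrite -ltrBlDr sub0r; apply: le_lt_trans h2 _; exact: le_lt_trans h h3.
have cmR : continuous (fun t => complex.Re (m t)).
  rewrite (_ : (fun t => _) = (fun t => (complex.Re (c1 t) - complex.Re a1) * cos (th t) +
      (complex.Im (c1 t) - complex.Im a1) * sin (th t))); last first.
    by apply/funext => t; rewrite /m; case: (c1 t) (a1) => x y [x' y'] /=; rewrite cosN sinN; ring.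
  move=> t; apply: cvgD.
    apply: cvgM; first by apply: cvgB; [exact: cR|exact: cvg_cst].
    by apply: (@continuous_comp R R R th cos t); [exact: cth|exact: continuous_cos].
  apply: cvgM; first by apply: cvgB; [exact: cI|exact: cvg_cst].
  by apply: (@continuous_comp R R R th sin t); [exact: cth|exact: continuous_sin].
have cmI : continuous (fun t => complex.Im (m t)).
  rewrite (_ : (fun t => _) = (fun t => (complex.Im (c1 t) - complex.Im a1) * cos (th t) -
      (complex.Re (c1 t) - complex.Re a1) * sin (th t))); last first.
    by apply/funext => t; rewrite /m; case: (c1 t) (a1) => x y [x' y'] /=; rewrite cosN sinN; ring.
  move=> t; apply: cvgB.
    apply: cvgM; first by apply: cvgB; [exact: cI|exact: cvg_cst].
    by apply: (@continuous_comp R R R th cos t); [exact: cth|exact: continuous_cos].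
  apply: cvgM; first by apply: cvgB; [exact: cR|exact: cvg_cst].
  by apply: (@continuous_comp R R R th sin t); [exact: cth|exact: continuous_sin].
exists (fun t => th t + atan (complex.Im (m t) / complex.Re (m t))).
  move=> t; apply: cvgD; first exact: cth.
  apply: (@continuous_comp R R R (fun t => complex.Im (m t) / complex.Re (m t)) atan t); last exact: continuous_atan.
  by apply: cvgM; [exact: cmI|apply: cvgV; [rewrite gt_eqF|exact: cmR]].
split=> [t|].
  have := polar_atan (Rem t); rewrite {1 2}/m modulusM modulus_expi mulr1.
  move=> /(congr1 (fun z => z * expi (th t))).
  by rewrite -!mulrA -!expiD (addrC _ (th t)) subrr expi0 mulr1 (addrC _ (th t)).
rewrite (_ : m (2 * pi) = m 0); first by rewrite th2; ring.
by rewrite /m c1p -(expi_period_int (- th (2 * pi)) 1) th2 mul1r opprD subrK.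
Qed.

(** The plane is a union of segments issuing from the origin. *)
Lemma complex_connected : connected [set: R[i]].
Proof.
have -> : [set: R[i]] = \bigcup_(z in [set: R[i]]) ((fun s : R => s%:C * z) @` `[0, 1]%classic).
  apply/seteqP; split => // z _; exists z => //; exists 1; last by rewrite mul1r.
  by rewrite /= in_itv/= ler01 lexx.
apply: bigcup_connected.
  by exists 0 => z _; exists 0; rewrite ?mul0r//= in_itv/= lexx ler01.
move=> z _; apply: connected_continuous_connected; first exact: segment_connected.
apply: continuous_subspaceT => s A /nbhs_complexP[e e0 he].
have m0 : 0 < modulus z + 1 by rewrite ltr_wpDl// modulus_ge0.
apply/nbhs_ballP; exists (e / (modulus z + 1)); first by rewrite /= divr_gt0.
move=> u; rewrite /ball/= distrC ltr_pdivlMr// => h; apply: he.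
rewrite -mulrBl -rmorphB modulusM modulus_real; apply: le_lt_trans h.
by rewrite ler_wpM2l// lerDl.
Qed.

End Winding.

(** * Quasiconformality of bi-Lipschitz radial extensions *)

Lemma lipschitz_W11loc (R : realType) (w : R[i] -> R[i]) (C : R) :
  (forall z z', modulus (w z - w z') <= C * modulus (z - z')) -> eps_continuous w ->
  exists wx wy, W11loc_with setT w wx wy /\
    {ae @plane_measure R, forall p,
      is_cderive (fun x => w (x +i* p.2)) p.1 (wx (toC p)) /\
      is_cderive (fun y => w (p.1 +i* y)) p.2 (wy (toC p))}.
Proof.
move=> lw cw.
have cR := continuous_Re_plane cw; have cI := continuous_Im_plane cw.
have dl b (a s t : R) : modulus (toC (line b a s) - toC (line b a t)) = `|s - t|.
  case: b; rewrite /toC /= /modulus /= subrr expr0n /= ?addr0 ?add0r; exact: sqrtr_sqr.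
have lR b a s t : `|complex.Re (w (toC (line b a s))) - complex.Re (w (toC (line b a t)))| <= C * `|s - t|.
  by rewrite -raddfB -(dl b a); apply: le_trans (Re_le_modulus _) (lw _ _).
have lI b a s t : `|complex.Im (w (toC (line b a s))) - complex.Im (w (toC (line b a t)))| <= C * `|s - t|.
  by rewrite -raddfB -(dl b a); apply: le_trans (Im_le_modulus _) (lw _ _).
have [xR wxR dxR] := lipschitz_weak_derivative cR (lR true).
have [xI wxI dxI] := lipschitz_weak_derivative cI (lI true).
have [yR wyR dyR] := lipschitz_weak_derivative cR (lR false).
have [yI wyI dyI] := lipschitz_weak_derivative cI (lI false).
pose pt (z : R[i]) : R * R := (complex.Re z, complex.Im z).
have ptK p : pt (toC p) = p by case: p.
have eta (f : R * R -> R) : (fun p => f (pt (toC p))) = f by apply/funext => p; rewrite ptK.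
exists (fun z => xR (pt z) +i* xI (pt z)), (fun z => yR (pt z) +i* yI (pt z)); split.
  by split; split; rewrite /= eta.
apply: ae_mono (ae_and (ae_and dxR dxI) (ae_and dyR dyI)) => p [[h1 h2] [h3 h4]].
rewrite !ptK; split; split.
- by move/is_derive_exP : h1.
- by move/is_derive_exP : h2.
- by move/is_derive_eyP : h3.
- by move/is_derive_eyP : h4.
Qed.

Section Qc_const.
Context {R : realType} (s L : R).
Context (s01 : 0 < s <= 1) (L1 : 1 <= L).

Let D1 := L ^+ 2 + s ^+ 2 * (1 - 2 * L).
Let D2 := L ^+ 2 + s ^+ 2 * (1 + 2 * L).

Let s2 : 0 < s ^+ 2 <= 1.
Proof. by case/andP: s01 => s0 s1; rewrite exprn_gt0// expr_le1// ltW. Qed.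

Let D10 : 0 <= D1.
Proof.
case/andP: s2 => s0 s1.
have -> : D1 = (L - s ^+ 2) ^+ 2 + s ^+ 2 * (1 - s ^+ 2) by rewrite /D1; ring.
by rewrite addr_ge0 ?sqr_ge0// mulr_ge0 ?subr_ge0// ltW.
Qed.

Let D12 : D1 < D2.
Proof.
case/andP: s2 => s0 _; rewrite -subr_gt0.
have -> : D2 - D1 = 4 * (s ^+ 2 * L) by rewrite /D1 /D2; ring.
by rewrite mulr_gt0// mulr_gt0//; exact: lt_le_trans L1.
Qed.

Let D20 : 0 < D2. Proof. exact: le_lt_trans D12. Qed.

Lemma qc_const_bounds : 0 <= qc_const s L < 1.
Proof.
rewrite /qc_const -/D1 -/D2 sqrtr_ge0 /=.
by have : Num.sqrt (D1 / D2) < Num.sqrt 1; [rewrite ltr_sqrt// ltr_pdivrMr// mul1r|rewrite sqrtr1].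
Qed.

(** Since [s ^ 2 (1 + T ^ 2) <= 1], the difference of the two sides is at least a
    positive multiple of [(L - q) (L q - s ^ 2)], and [s ^ 2 <= 1 <= L q]. *)
Lemma qc_const_dilatation (q T : R) : s ^+ 2 * (1 + T ^+ 2) <= 1 -> L^-1 <= q <= L ->
  (1 - q) ^+ 2 + (q * T) ^+ 2 <= qc_const s L ^+ 2 * ((1 + q) ^+ 2 + (q * T) ^+ 2).
Proof.
move=> hT /andP[q1 q2]; case/andP: s2 => s0 s1.
have L0 : 0 < L by exact: lt_le_trans L1.
have Lq : 1 <= L * q by rewrite mulrC -ler_pdivrMr// div1r.
rewrite /qc_const sqr_sqrtr; last by rewrite divr_ge0 ?(ltW D20).
rewrite -/D1 -/D2 mulrAC ler_pdivlMr// -subr_ge0.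
have F : 0 <= (L - q) * (L * q - s ^+ 2) by rewrite mulr_ge0 ?subr_ge0//; exact: le_trans Lq.
have Q : q ^+ 2 * L * (s ^+ 2 * (1 + T ^+ 2)) <= q ^+ 2 * L.
  by rewrite -[leRHS]mulr1 ler_wpM2l// mulr_ge0 ?sqr_ge0// ltW.
have -> : D1 * ((1 + q) ^+ 2 + (q * T) ^+ 2) - ((1 - q) ^+ 2 + (q * T) ^+ 2) * D2 =
  4 * ((L - q) * (L * q - s ^+ 2) + (q ^+ 2 * L - q ^+ 2 * L * (s ^+ 2 * (1 + T ^+ 2)))).
  by rewrite /D1 /D2; ring.
by rewrite mulr_ge0// addr_ge0// subr_ge0.
Qed.

End Qc_const.

Section Bilipschitz_quasiconformal.
Context {R : realType} (gamma : set R[i]) (r : R -> R) (G : R[i] -> R[i])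
  (psi : R -> R).
Context (gamma_smooth : smooth_jordan_curve gamma)
  (gamma_tangent : forall l, tangent_line gamma l -> ~ l 0)
  (r_polar : polar_parametrization gamma r)
  (G_homeo : homeomorphism_between unit_circle gamma G)
  (psi_cont : continuous psi)
  (psi_arg : forall t, G (expi t) = (rho_of G t)%:C * expi (psi t))
  (G_orient : orientation_preserving_circle_map G).

Let w := radial_extension G.
Let P s := (r s)%:C * expi s.

Let w_at lam t : 0 <= lam -> w (lam%:C * expi t) = lam%:C * P (psi t).
Proof. exact: (radial_extension_at r_polar G_homeo psi_arg). Qed.

(** The given lift of [G] and [psi] differ by a constant, being lifts of the same
    loop. *)
Lemma phase_turn : psi (2 * pi) = psi 0 + 2 * pi.
Proof.
have [th cth [hth th2]] := G_orient.
have lift t : exists n : int, th t - psi t = n%:~R * (2 * pi).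
  have := hth t; rewrite subr0 -/(rho_of G t) {1}psi_arg => /esym E.
  have r0 : (rho_of G t)%:C != 0 :> R[i].
    rewrite (rho_polar r_polar G_homeo psi_arg) eq_complex /= eqxx andbT gt_eqF//.
    exact: (polar_gt0 r_polar).
  have [n ->] := expi_eq (mulfI r0 E); exists n; by rewrite addrAC subrr add0r.
have cd : continuous (fun t => th t - psi t) by move=> t; apply: cvgB; [exact: cth|exact: psi_cont].
have := int_valued_constant cd lift (2 * pi); rewrite th2 => h; lra.
Qed.

(** An injective phase is monotone, and it increases over a full turn. *)
Lemma phase_increasing a b : a < b -> psi a < psi b.
Proof.
move=> ab; have pp := @pi_gt0 R.
have [s [s1 hs]] := inj_monotone_sign psi_cont (phase_inj r_polar G_homeo psi_cont psi_arg).
have p2 : (0 : R) < 2 * pi by lra.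
have := hs _ _ p2; rewrite phase_turn addrAC subrr add0r pmulr_lgt0// => s0.
by have := hs _ _ ab; rewrite pmulr_rgt0// subr_gt0.
Qed.

Lemma phase_speed (L t q : R) : bilipschitz_const distR distR setT L psi ->
  is_derive t 1 psi q -> L^-1 <= q <= L.
Proof.
move=> [/andP[Li0 _] psiL] /is_derive_epsP dq.
have H (e : R) : 0 < e -> L^-1 - e <= q <= L + e.
  move=> e0; have [d d0 hd] := dq e e0.
  have d2 : 0 < d / 2 by rewrite divr_gt0.
  have := hd (d / 2); rewrite gtr0_norm// ltr_pdivrMr// mulr_natr mulr2n ltrDl d0 => /(_ isT).
  have tt : t < t + d / 2 by rewrite ltrDl.
  have pt := phase_increasing tt.
  have [] := psiL (t + d / 2) t I I; rewrite /distR addrAC subrr add0r (gtr0_norm d2).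
  rewrite (@gtr0_norm _ (psi _ - psi _)) ?subr_gt0//.
  set D := psi _ - psi t => h1 h2 /ler_normlP[h3 h4].
  rewrite -(ler_pM2r d2) -[X in _ && X](ler_pM2r d2) mulrBl mulrDl.
  by apply/andP; split; lra.
by apply/andP; split; apply/ler_addgt0Pr => e /H /andP[h1 h2]; lra.
Qed.

Section Bilipschitz_extension.
Context (l U : R) (w_bilip : bilipschitz_with distC distC setT l U w).

Let l_gt0 : 0 < l. Proof. by have [/andP[]] := w_bilip. Qed.
Let U_gt0 : 0 < U. Proof. by have [/andP[l0 lU] _] := w_bilip; exact: lt_le_trans lU. Qed.
Let w_up z z' : modulus (w z - w z') <= U * modulus (z - z').
Proof. by have [_ /(_ z z' I I)[]] := w_bilip. Qed.
Let w_lo z z' : l * modulus (z - z') <= modulus (w z - w z').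
Proof. by have [_ /(_ z z' I I)[]] := w_bilip. Qed.

Lemma bilipschitz_eps_continuous : eps_continuous w.
Proof.
move=> z e e0; exists (e / U); first by rewrite divr_gt0.
move=> z'; rewrite ltr_pdivlMr// mulrC; exact: le_lt_trans (w_up _ _).
Qed.

(** The image of a circle about the origin winds once because [psi] makes one
    turn; moving the centre in small steps does not change this. *)
Lemma bilipschitz_orientation : orientation_preserving_on setT w.
Proof.
move=> z rad rad0 _.
(* moving the centre by [v = z / N] displaces the loop relative to its centre by
   at most [2 U |v|], less than its distance [l rad] to the centre *)
pose N := (Num.bound (2 * U * modulus z / (l * rad))).+1.
have N0 : 0 < N%:R :> R by [].
pose v := (N%:R^-1)%:C * z.
have hv : 2 * U * modulus v < l * rad.
  rewrite /v modulusM modulus_real ger0_norm ?invr_ge0//.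
  have lr : 0 < l * rad by rewrite mulr_gt0.
  have h : 2 * U * modulus z / (l * rad) < N%:R.
    by apply: lt_trans (unstable.ltr_bound _) _; rewrite ltr_nat.
  rewrite ltr_pdivrMr// in h.
  by rewrite mulrCA -ltr_pdivlMl ?invr_gt0// invrK.
pose c (j : nat) t := w (j%:R * v + rad%:C * expi t).
have mr t : modulus (rad%:C * expi t) = rad by rewrite modulus_polar// ltW.
suff H j : winds_once (c j) (w (j%:R * v)).
  have := H N; rewrite /c (_ : N%:R * v = z)//.
  by rewrite /v mulrA -(rmorph_nat (real_complex R)) -rmorphM divff ?gt_eqF// rmorph1 mul1r.
have w0 : w 0 = 0 := radial_extension0 r_polar G_homeo psi_arg.
elim: j => [|j].
  exists psi => //; split; last exact: phase_turn.
  move=> t; rewrite /c !mul0r add0r w0 subr0.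
  rewrite w_at ?(ltW rad0)// /P mulrA -rmorphM modulus_polar// mulr_ge0 ?(ltW rad0)//.
  exact: ltW (polar_gt0 r_polar _).
have cc : (forall t e, 0 < e -> exists2 d : R, 0 < d &
    forall u, `|u - t| < d -> modulus (c j.+1 u - c j.+1 t) < e).
  move=> t e e0; have [d d0 hd] := bilipschitz_eps_continuous (j.+1%:R * v + rad%:C * expi t) e0.
  have dr : 0 < d / rad by rewrite divr_gt0.
  have [d' d'0 hd'] := is_cderive_continuous (is_cderive_expi t) dr.
  exists d' => // u /hd' h; apply: hd; rewrite opprD addrACA subrr add0r -mulrBr.
  by rewrite modulusM modulus_real gtr0_norm// mulrC -ltr_pdivlMr.
have [cR cI] := continuous_ReIm cc.
apply: winds_once_near => // [|t].
  by rewrite /c -(expi_period_int 0 1) mul1r add0r.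
apply: lt_le_trans (_ : l * rad <= _); last first.
  apply: le_trans (w_lo _ _); rewrite addrAC subrr add0r mr.
  by [].
apply: le_lt_trans hv.
have E (j' : nat) : j'.+1%:R * v - j'%:R * v = v by rewrite -mulrBl -addn1 natrD addrAC subrr add0r mul1r.
rewrite (_ : _ - _ = (c j.+1 t - c j t) - (w (j.+1%:R * v) - w (j%:R * v))); last by ring.
apply: le_trans (modulusD _ _) _; rewrite modulusN (_ : 2 * U * modulus v = U * modulus v + U * modulus v); last by ring.
apply: lerD; apply: le_trans (w_up _ _) _; rewrite ?E//.
by rewrite opprD addrACA subrr addr0 E.
Qed.

Lemma bilipschitz_homeomorphism : orientation_preserving_homeomorphism setT w.
Proof.
have winj := radial_extension_inj r_polar G_homeo psi_arg.
have wsurj := radial_extension_surj r_polar G_homeo.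
split; last exact: bilipschitz_orientation.
  split; [exact: openT|exact: complex_connected|by exists 0].
pose g y := sval (cid (wsurj y)).
have gK y : w (g y) = y by exact: svalP (cid (wsurj y)).
split.
- by split; [move=> z _; exists z|move=> z z' _ _; exact: winj|move=> y].
- by apply: continuous_subspaceT; apply/eps_continuousP; exact: bilipschitz_eps_continuous.
exists g; split; last by move=> z _; apply: winj; exact: gK.
apply: continuous_subspaceT; apply/eps_continuousP => y e e0.
exists (l * e); first exact: mulr_gt0.
move=> y' hy; rewrite -(ltr_pM2l l_gt0); apply: le_lt_trans (w_lo _ _) _.
by rewrite !gK.
Qed.

(** Almost everywhere the partial derivatives are classical, [psi] has a speed
    between [1 / L] and [L], and the dilatation is given by it. *)
Lemma bilipschitz_k_quasiconformal L : bilipschitz_const distR distR setT L psi ->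
  k_quasiconformal setT (qc_const (sin (alpha_of r)) L) w.
Proof.
move=> psiL.
have s01 : 0 < sin (alpha_of r) <= 1.
  by rewrite sin_alpha_le1 andbT; exact: (sin_alpha_gt0 gamma_smooth gamma_tangent r_polar).
have L1 : 1 <= L := bilipschitz_const_ge1 psiL.
split; [exact: qc_const_bounds|exact: bilipschitz_homeomorphism|].
have [wx [wy [sob part]]] := lipschitz_W11loc w_up bilipschitz_eps_continuous.
exists wx, wy; split => //.
have x_neq0 : {ae @plane_measure R, forall p, p.1 != 0}.
  exists [set p | p.1 = 0].
  have mA : measurable ([set p | p.1 = 0] : set (measurableTypeR R * measurableTypeR R)%type).
    rewrite (_ : [set p | _] = setT `&` fst @^-1` [set 0]); last by rewrite setTI.
    by apply: plane_continuous_measurable => // p; exact: cvg_fst.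
  split => //; last by move=> p /= /negP; rewrite negbK => /eqP.
  apply/(line_null false mA); apply: ae_mono (ae_neq 0) => a a0.
  by apply: aeW => t /=.
apply: ae_mono (ae_and part x_neq0) => -[x y] /= [[dx dy] x0] _.
have dP := polar_curve_kappa gamma_smooth gamma_tangent r_polar.
have rp := polar_gt0 r_polar.
have [q dq [_ Ey]] := vertical_partial dP rp psi_cont w_at x0 dy.
have [_ [h1 h2]] := radial_partials dP w_at x0 dq.
have Ex : wx (x +i* y) = (cos (half_arg x y))%:C * P (psi (half_arg x y)) +
    (- sin (half_arg x y) * q)%:C * (P (psi (half_arg x y)) * (kappa r (psi (half_arg x y)) +i* 1)).
  have [k1 k2] := dx.
  by apply: complex_ext; [exact: (is_derive_unique k1 h1)|exact: (is_derive_unique k2 h2)].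
have [E1 E2] := radial_dilatation Ex Ey.
have q1L := phase_speed psiL dq; have /andP[q1 _] := q1L.
have q0 : 0 < q by apply: lt_le_trans q1; rewrite invr_gt0; exact: lt_le_trans L1.
have [k0 k1] := andP (qc_const_bounds s01 L1).
have N0 : 0 < (1 + q) ^+ 2 + (q * kappa r (psi (half_arg x y))) ^+ 2.
  by rewrite ltr_pwDl ?sqr_ge0// exprn_gt0// addr_gt0.
have r20 : 0 < (r (psi (half_arg x y)) / 2) ^+ 2 by rewrite exprn_gt0// divr_gt0.
have F1 : modulus (dz wx wy (toC (x, y))) ^+ 2 = _ := E1.
have F2 : modulus (dzbar wx wy (toC (x, y))) ^+ 2 = _ := E2.
have z0 : 0 < modulus (dz wx wy (toC (x, y))).
  have : 0 < modulus (dz wx wy (toC (x, y))) ^+ 2 by rewrite F1 mulr_gt0.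
  rewrite modulus_gt0; apply: contraTneq => ->.
  by rewrite modulus0 expr0n ltxx.
split; first by rewrite -modulus_gt0.
rewrite modulusM modulusV ler_pdivrMr//.
rewrite -(@ler_pXn2r _ 2)// ?nnegrE ?modulus_ge0 ?mulr_ge0 ?modulus_ge0//.
rewrite exprMn F2 F1 [leRHS]mulrCA ler_pM2l//.
have H := sin_alpha_le r_polar (psi (half_arg x y)).
exact: (qc_const_dilatation s01 L1 H q1L).
Qed.

End Bilipschitz_extension.
End Bilipschitz_quasiconformal.

(** * The supremum norm and the constants of quasiconformality *)

Section Linfty.
Context {R : realType}.
Notation mu := (@lebesgue_measure R).

(** A value above the essential supremum would, by continuity, persist on an
    interval. *)
Lemma Linfty_norm_ge (f : R -> R) (B : R) : continuous f ->
  (forall t, 0 <= f t <= B) -> forall t, f t <= Linfty_norm f.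
Proof.
move=> cf fB t.
have muT : (0 < mu [set: R])%E.
  have h : (mu (`]0%R, 1%R[%classic : set (measurableTypeR R)) <= mu [set: R])%E.
    by apply: le_measure; rewrite ?inE.
  apply: lt_le_trans h; by rewrite lebesgue_measure_itv/= lte_fin ltr01 -EFinB subr0 lte_fin.
have NE : ('N[mu]_+oo[EFin \o f] = ess_sup_inf.ess_sup mu (abse \o (EFin \o f)))%E.
  by rewrite unlock /= muT.
rewrite /Linfty_norm NE; set S := ess_sup_inf.ess_sup _ _.
have aS : {ae mu, forall x, (`|(f x)%:E| <= S)%E} := ess_sup_inf.ess_sup_ge mu (abse \o (EFin \o f)).
have SB : (S <= B%:E)%E.
  apply/ess_sup_inf.ess_supP; apply: aeW => x /=.
  by have /andP[f0 fb] := fB x; rewrite lee_fin ger0_norm.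
have S0 : (0 <= S)%E.
  have [x [_ hx]] := ae_exists_between (@ltr01 R) aS.
  by apply: le_trans hx; exact: abse_ge0.
have fS : S = (fine S)%:E by rewrite fineK// fin_real// (lt_le_trans _ S0) ?(le_lt_trans SB) ?ltry ?ltNyr.
rewrite leNgt; apply/negP => hlt.
have ft : 0 < f t - fine S by rewrite subr_gt0.
have cf' : {for t, continuous (fun x => f x - fine S)}.
  by apply: cvgB; [exact: cf|exact: cvg_cst].
have [d d0 hd] := continuous_near_gt0 cf' ft.
have td : t < t + d by rewrite ltrDl.
have [x [/andP[x1 x2]]] := ae_exists_between td aS.
have /andP[f0 _] := fB x; rewrite fS /= lee_fin ger0_norm// => h.
have := hd x; rewrite gtr0_norm ?subr_gt0// => /(_ ltac:(lra)); lra.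
Qed.

End Linfty.

Lemma bilipschitz_common_const (R : realType) (psi : R -> R) :
  bilipschitz distR distR setT psi -> exists L, bilipschitz_const distR distR setT L psi.
Proof.
move=> [l [L [/andP[l0 lL] H]]]; have L0 : 0 < L by exact: lt_le_trans lL.
pose L1 := Num.max L l^-1.
have h1 : L <= L1 by rewrite le_max lexx.
have h2 : l^-1 <= L1 by rewrite le_max lexx orbT.
have L10 : 0 < L1 by exact: lt_le_trans h1.
have h3 : L1^-1 <= l by rewrite -[leRHS]invrK lef_pV2// posrE ?invr_gt0.
exists L1; split; first by rewrite invr_gt0 L10 (le_trans h3)// (le_trans lL).
move=> x y _ _; have [k1 k2] := H x y I I.
by split; [apply: le_trans k1|apply: le_trans k2 _]; rewrite ler_wpM2r// /distR.
Qed.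

Lemma K_quasiconformal_k (R : realType) (D : set R[i]) (K : R) (w : R[i] -> R[i]) :
  K_quasiconformal D K w -> k_quasiconformal D ((K - 1) / (K + 1)) w.
Proof.
move=> [K1 hw [wx [wy [sob dil]]]]; have K0 : 0 < K + 1 by lra.
split => //.
  by rewrite divr_ge0 ?subr_ge0// ?(ltW K0)// ltr_pdivrMr//; lra.
exists wx, wy; split => //.
apply: ae_mono dil => p h Dp; have {h} [ba q] := h Dp.
set a := modulus (dz _ _ _) in ba q; set b := modulus (dzbar _ _ _) in ba q.
have a0 : 0 < a by apply: le_lt_trans ba; exact: modulus_ge0.
split; first by rewrite -modulus_gt0.
rewrite modulusM modulusV -/a -/b ler_pdivrMr// mulrAC ler_pdivlMr//.
rewrite ler_pdivrMr ?subr_gt0// in q; lra.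
Qed.

Lemma k_quasiconformal_K (R : realType) (D : set R[i]) (k : R) (w : R[i] -> R[i]) :
  k_quasiconformal D k w -> K_quasiconformal D ((1 + k) / (1 - k)) w.
Proof.
move=> [/andP[k0 k1] hw [wx [wy [sob dil]]]]; have k10 : 0 < 1 - k by lra.
split => //; first by rewrite ler_pdivlMr//; lra.
exists wx, wy; split => //.
apply: ae_mono dil => p h Dp; have {h} [] := h Dp.
rewrite -modulus_gt0 modulusM modulusV.
set a := modulus (dz _ _ _); set b := modulus (dzbar _ _ _) => a0.
rewrite ler_pdivrMr// => bka.
have ka : k * a < a by rewrite gtr_pMl.
split; first exact: le_lt_trans ka.
rewrite ler_pdivrMr ?subr_gt0; last exact: le_lt_trans ka.
rewrite mulrAC ler_pdivlMr//; lra.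
Qed.

(** * The equivalences and the bounds *)

Theorem theorem4p2 (R : realType) (gamma : set R[i]) (r : R -> R)
    (G : R[i] -> R[i]) (psi : R -> R)
    (gamma_smooth : smooth_jordan_curve gamma)
    (gamma_starlike : starlike_wrt_origin gamma)
    (gamma_tangent : forall l, tangent_line gamma l -> ~ l 0)
    (r_polar : polar_parametrization gamma r)
    (G_homeo : homeomorphism_between unit_circle gamma G)
    (psi_cont : continuous psi)
    (psi_arg : forall t, G (expi t) = (rho_of G t)%:C * expi (psi t)) :
  let w := radial_extension G in
  let s := sin (alpha_of r) in
  let M := Linfty_norm (rho_of G) in
  let d := dist_to_origin gamma in
  let a := bilipschitz distC distC unit_circle G in
  let b := bilipschitz distR distR setT psi in
  let c := bilipschitz distC distC setT w in
  let qc := quasiconformal setT w in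
  [/\ a <-> b,
      b <-> c,
      qc -> c &
      orientation_preserving_circle_map G -> c -> qc] /\
  (forall L : R, bilipschitz_const distR distR setT L psi ->
     bilipschitz_with distC distC setT
       (lower_const d M s L) (upper_const M s L) w /\
     (orientation_preserving_circle_map G ->
      k_quasiconformal setT (qc_const s L) w)) /\
  (forall k : R, k_quasiconformal setT k w ->
     bilipschitz_with distR distR setT
       ((1 - k) / (1 + k)) ((1 + k) / (1 - k)) psi /\
     (1 - k ^+ 2) / (1 + k ^+ 2) <= s).
Proof.
move=> w s M d a b c qc.
have rho_r := rho_polar r_polar G_homeo psi_arg.
have r_gt0 := polar_gt0 r_polar.
have r_cont := polar_continuous gamma_smooth gamma_tangent r_polar.
have s01 : 0 < s <= 1.
  by rewrite sin_alpha_le1 andbT; exact: (sin_alpha_gt0 gamma_smooth gamma_tangent r_polar).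
have r_le t : r (psi t) <= M.
  have [u hu] := periodic_max r_cont (polar_periodic r_polar).
  have rho_cont : continuous (rho_of G).
    rewrite (_ : rho_of G = r \o psi); last by apply/funext => x; exact: rho_r.
    by move=> x; apply: continuous_comp; [exact: psi_cont|exact: r_cont].
  rewrite -rho_r; apply: (@Linfty_norm_ge R _ (r u)) => // x.
  by rewrite rho_r hu andbT ltW.
have e L : bilipschitz_const distR distR setT L psi ->
    bilipschitz_with distC distC setT (lower_const d M s L) (upper_const M s L) w.
  move=> hL; apply: (radial_bilipschitz (r := r) (psi := psi)) => //.
  - exact: (polar_curve_derivable gamma_smooth gamma_tangent r_polar).
  - exact: (dist_to_origin_gt0 gamma_smooth gamma_tangent r_polar).
  - exact: (sin_alpha_le r_polar).
  - exact: (dist_to_origin_le r_polar).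
  - exact: (radial_extension_polar r_polar G_homeo psi_arg).
  - exact: (radial_extension_inj r_polar G_homeo psi_arg).
  - exact: (radial_extension_surj r_polar G_homeo).
have f L : bilipschitz_const distR distR setT L psi ->
    orientation_preserving_circle_map G -> k_quasiconformal setT (qc_const s L) w.
  move=> hL oG; exact: (bilipschitz_k_quasiconformal gamma_smooth gamma_tangent
    r_polar G_homeo psi_cont psi_arg oG (e L hL) hL).
have gh k : k_quasiconformal setT k w ->
    bilipschitz_with distR distR setT ((1 - k) / (1 + k)) ((1 + k) / (1 - k)) psi /\
    (1 - k ^+ 2) / (1 + k ^+ 2) <= s.
  exact: (quasiconformal_phase gamma_smooth gamma_tangent r_polar G_homeo psi_cont psi_arg).
have ab : a -> b.
  exact: (bilipschitz_phase gamma_smooth gamma_tangent r_polar G_homeo psi_cont psi_arg).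
have bc : b -> c.
  move=> /bilipschitz_common_const[L /e h]; by exists (lower_const d M s L), (upper_const M s L).
have ca : c -> a by exact: bilipschitz_restrict.
split; last by split => [L hL|k]; [split; [exact: e|exact: f]|exact: gh].
split.
- by split=> [|/bc/ca].
- by split=> [|/ca/ab].
- move=> [K /K_quasiconformal_k/gh[h _]]; apply: bc.
  by do 2 eexists; exact: h.
- move=> oG /ca/ab/bilipschitz_common_const[L hL].
  by eexists; exact: (k_quasiconformal_K (f L hL oG)).
Qed.
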